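(* Let $k=\overline{\mathbb F}_q$. (i) Let $\gamma\in\mathbb T^\vee/W_0$ be regular. The spherical map induces a bijection $$\mathrm{Sph}^\gamma:(V^\gamma_{\widehat{\mathbf T},0}/W_0)(k)\xrightarrow{\ \sim\ }\{\text{simple finite dimensional left }\mathcal H^\gamma_{\overline{\mathbb F}_q}\text{-modules}\}/\!\sim .$$ The singular locus of the $k$-scheme $V^\gamma_{\widehat{\mathbf T},0}/W_0\simeq V_{\widehat{\mathbf T},0}=\mathrm{SingDiag}_{2\times2}\times\mathbb G_m$ is $(0,0)\times\mathbb G_m$ in the standard coordinates, and its $k$-points correspond to the supersingular Hecke modules through $\mathrm{Sph}^\gamma$. (ii) Let $\gamma\in\mathbb T^\vee/W_0$ be non-regular. Consider the decomposition $$V^\gamma_{\widehat{\mathbf T},0}/W_0=V_{\widehat{\mathbf T},0}/W_0\simeq\mathbb A^1\times\mathbb G_m=D(2)_\gamma\cup D(1)_\gamma,$$ where $D(1)_\gamma$ is the closed subscheme defined by the parabola $z_2=z_1^2$ in the Steinberg coordinates $z_1,z_2$ and $D(2)_\gamma$ is its open complement. The spherical map induces bijections $$\mathrm{Sph}^\gamma(2):D(2)_\gamma(k)\xrightarrow{\ \sim\ }\{\text{simple }2\text{-dimensional left }\mathcal H^\gamma_{\overline{\mathbb F}_q}\text{-modules}\}/\!\sim,$$ $$\mathrm{Sph}^\gamma(1):D(1)_\gamma(k)\xrightarrow{\ \sim\ }\{\text{spherical pairs of characters of }\mathcal H^\gamma_{\overline{\mathbb F}_q}\}/\!\sim,$$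 where $\mathrm{Sph}^\gamma(1)(v)$ is the pair of Jordan–Hölder factors of $\mathrm{Sph}^\gamma(v)$. The branch locus of the covering $V_{\widehat{\mathbf T},0}\to V_{\widehat{\mathbf T},0}/W_0\simeq V^\gamma_{\widehat{\mathbf T},0}/W_0$ is contained in $D(2)_\gamma$, with equation $z_1=0$ in Steinberg coordinates, and its $k$-points correspond to the supersingular Hecke modules through $\mathrm{Sph}^\gamma(2)$.
   Context: Let $q$ be a power of a prime, $k=\overline{\mathbb F}_q$, $\mathbb T=\mathbb F_q^\times\times\mathbb F_q^\times$, $\mathbb T^\vee=\operatorname{Hom}(\mathbb T,k^\times)$, $W_0=\{1,s\}$ exchanging the coordinates of $\mathbb T$. An orbit $\gamma\in\mathbb T^\vee/W_0$ is regular if $|\gamma|=2$, non-regular if $|\gamma|=1$. The mod $p$ pro-$p$ Iwahori–Hecke algebra of $GL_2$, $\mathcal H^{(1)}_{\overline{\mathbb F}_q}$, is the $k$-algebra generated by $T_t$ ($t\in\mathbb T$), $S$, $U^{\pm1}$ with relations $T_tT_{t'}=T_{tt'}$, $T_1=1$, $ST_t=T_{s(t)}S$, $UT_t=T_{s(t)}U$, $U^2S=SU^2$, $S^2=c_sS$, where $c_s=\sum_{a\in\mathbb F_q^\times}T_{(a,a^{-1})}$ (it is the generic algebra at $\mathbf q=q=0$). With $\varepsilon_\lambda=|\mathbb T|^{-1}\sum_{t}\lambda^{-1}(t)T_t$ and the central idempotent $\varepsilon_\gamma=\sum_{\lambda\in\gamma}\varepsilon_\lambda$, let $\mathcal H^\gamma_{\overline{\mathbb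 F}_q}=\mathcal H^{(1)}_{\overline{\mathbb F}_q}\varepsilon_\gamma$, so $\mathcal H^{(1)}_{\overline{\mathbb F}_q}=\prod_\gamma\mathcal H^\gamma_{\overline{\mathbb F}_q}$. $V_{\widehat{\mathbf T},0}=\mathrm{SingDiag}_{2\times2}\times\mathbb G_m=\operatorname{Spec}k[X,Y,z_2^{\pm1}]/(XY)$, with standard coordinates $(x,y,z_2)$ and $W_0$ exchanging $X,Y$; $V_{\widehat{\mathbf T},0}/W_0=\operatorname{Spec}k[z_1,z_2^{\pm1}]$ with Steinberg coordinates $z_1=X+Y$, $z_2$. $V^\gamma_{\widehat{\mathbf T},0}=\coprod_{\lambda\in\gamma}V_{\widehat{\mathbf T},0}$ with the natural $W_0$-action (permuting $\gamma$ and exchanging $X,Y$). For regular $\gamma$, an ordering $\gamma=(\lambda,\mu)$ identifies $V^\gamma_{\widehat{\mathbf T},0}/W_0$ with $V_{\widehat{\mathbf T},0}$ (the copy indexed by $\lambda$); for non-regular $\gamma$ it is $V_{\widehat{\mathbf T},0}/W_0$. Spherical map, $\gamma=(\lambda,\mu)$ regular. Put $\varepsilon_1=\varepsilon_\lambda,\varepsilon_2=\varepsilon_\mu$. Then $\mathcal H^\gamma_{\overline{\mathbb F}_q}$ is generated over $k$ by $\varepsilon_1,\varepsilon_2,S,U^{\pm1}$ with $S^2=0$, $U^2S=SU^2$, $S$ and $U$ interchanging $\varepsilon_1,\varepsilon_2$. Let $X=US$, $Y=SU$, $z_2=U^2$ and let $\mathcal A$ be the commutative subalgebra generated by $\varepsilon_1,\varepsilon_2,X,Y,z_2^{\pm1}$;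 it equals $(k\varepsilon_1\times k\varepsilon_2)\otimes_kk[z_2^{\pm1}][X,Y]/(XY)$. The center $Z$ of $\mathcal H^\gamma_{\overline{\mathbb F}_q}$ is $\{a\varepsilon_1+s(a)\varepsilon_2\}$, $a\in k[z_2^{\pm1}][X,Y]/(XY)$. $\mathcal A$ becomes a left $\mathcal H^\gamma_{\overline{\mathbb F}_q}$-module where $\mathcal A$ acts by multiplication and $S,U$ act $Z$-linearly by $S\varepsilon_1=z_2^{-1}Y\varepsilon_2$, $S\varepsilon_2=Y\varepsilon_1$, $U\varepsilon_1=\varepsilon_2$, $U\varepsilon_2=z_2\varepsilon_1$. A point $v=(x,y,z_2)$ gives $\theta_v:Z\to k$, $a\varepsilon_1+s(a)\varepsilon_2\mapsto a(v)$, and $\mathrm{Sph}^\gamma(v):=\mathcal A\otimes_{Z,\theta_v}k$. A simple module is supersingular if its central character $\theta$ satisfies $\theta(X+Y)=0$. Spherical map, $\gamma$ non-regular. $\mathcal H^\gamma_{\overline{\mathbb F}_q}$ is generated over $k$ by $S,U^{\pm1}$ with $S^2=-S$, $U^2S=SU^2$. Let $X=U(S+1)$, $Y=SU$, $z_2=U^2$, and let $\mathcal A=k[z_2^{\pm1}][X,Y]/(XY)$ be the commutative subalgebra they generate (with $z_2^{-1}$); the center is $Z=k[z_1,z_2^{\pm1}]$, $z_1=X+Y$, and $\mathcal A=Z\oplus ZY$. $\mathcal A$ becomes a left module where $\mathcal A$ acts by multiplication and $S,U$ act $Z$-linearly by $S1=0$, $SY=-Y$, $U1=z_1-Y$, $UY=(z_1^2-z_2)-z_1Y$.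 A point $v=(z_1,z_2)$ gives $\theta_v:Z\to k$ and $\mathrm{Sph}^\gamma(v):=\mathcal A\otimes_{Z,\theta_v}k$. Characters of $\mathcal H^\gamma_{\overline{\mathbb F}_q}$ are parametrized by their values on $(S,U)$ in $\{0,-1\}\times k^\times$; a spherical pair is a pair $\{(0,z_1),(-1,-z_1)\}$ with $z_1\in k^\times$. For $(z_1,z_2)\in k\times k^\times$ the standard module $M_2(z_1,z_2)$ is $km\oplus kUm$ with $Sm=-m$, $SUm=z_1m$, $U^2m=z_2m$; it is simple iff $z_2\ne z_1^2$; it is supersingular if $z_1=0$. *)

(* Defs.v *)
From HB Require Import structures.
From mathcomp Require Import all_boot all_order all_algebra all_fingroup all_field.
From mathcomp Require Import boolp classical_sets ring.

Set Implicit Arguments.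
Unset Strict Implicit.
Unset Printing Implicit Defensive.

Import GRing.Theory.
Local Open Scope ring_scope.
Local Open Scope quotient_scope.
Local Notation repr := generic_quotient.repr.

(* Associative unital k-algebras by generators and relations: [pres rel] below
   is the set of noncommutative expressions in the generators, modulo the least
   congruence [cong rel] containing the algebra axioms and the relations rel.
   Its universal property is given by the lemmas on [pres_eval]. *)
Inductive expr (k G : Type) : Type :=
| Gen of G
| Cst of k
| Add of expr k G & expr k G
| Mul of expr k G & expr k G.
Arguments Gen {k G}.
Arguments Cst {k G}.

HB.instance Definition _ k G := gen_eqMixin (expr k G).
HB.instance Definition _ k G := gen_choiceMixin (expr k G).

Section Presented.
Variables (k : comNzRingType) (G : Type).
Implicit Types (a b c : expr k G) (x y : k).
Variable rel : expr k G -> expr k G -> Prop.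

Inductive cong : expr k G -> expr k G -> Prop :=
| cong_rel a b : rel a b -> cong a b
| cong_refl a : cong a a
| cong_sym a b : cong a b -> cong b a
| cong_trans a b c : cong a b -> cong b c -> cong a c
| cong_add a a' b b' : cong a a' -> cong b b' -> cong (Add a b) (Add a' b')
| cong_mul a a' b b' : cong a a' -> cong b b' -> cong (Mul a b) (Mul a' b')
| cong_addA a b c : cong (Add a (Add b c)) (Add (Add a b) c)
| cong_addC a b : cong (Add a b) (Add b a)
| cong_add0 a : cong (Add (Cst 0) a) a
| cong_mul0 a : cong (Mul (Cst 0) a) (Cst 0)
| cong_mulA a b c : cong (Mul a (Mul b c)) (Mul (Mul a b) c)
| cong_1mul a : cong (Mul (Cst 1) a) a
| cong_mulDl a b c : cong (Mul (Add a b) c) (Add (Mul a c) (Mul b c))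
| cong_mulDr a b c : cong (Mul c (Add a b)) (Add (Mul c a) (Mul c b))
| cong_cstD x y : cong (Cst (x + y)) (Add (Cst x) (Cst y))
| cong_cstM x y : cong (Cst (x * y)) (Mul (Cst x) (Cst y))
| cong_cstC x a : cong (Mul (Cst x) a) (Mul a (Cst x)).

Definition congb a b : bool := `[< cong a b >].

Lemma congb_refl : reflexive congb.
Proof. by move=> a; apply/asboolP/cong_refl. Qed.
Lemma congb_sym : symmetric congb.
Proof. by move=> a b; apply/asboolP/asboolP => /cong_sym. Qed.
Lemma congb_trans : transitive congb.
Proof. by move=> b a c /asboolP h /asboolP h'; apply/asboolP/(cong_trans h). Qed.

Canonical congb_equiv := EquivRel congb congb_refl congb_sym congb_trans.

Definition pres := {eq_quot congb}.
HB.instance Definition _ := Choice.on pres.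
HB.instance Definition _ := EqQuotient.on pres.

Definition cls a : pres := \pi_pres a.

Lemma clsP a b : reflect (cong a b) (cls a == cls b).
Proof. by rewrite /cls eqmodE; apply: asboolP. Qed.
Lemma cls_eq a b : cong a b -> cls a = cls b.
Proof. by move=> h; apply/eqP/clsP. Qed.
Lemma cls_inj a b : cls a = cls b -> cong a b.
Proof. by move/eqP/clsP. Qed.
Lemma cls_repr (u : pres) : cls (repr u) = u.
Proof. by rewrite /cls reprK. Qed.
Lemma repr_cls a : cong (repr (cls a)) a.
Proof. by apply: cls_inj; rewrite cls_repr. Qed.
Lemma pres_ind (P : pres -> Prop) : (forall a, P (cls a)) -> forall u, P u.
Proof. by move=> h u; rewrite -(cls_repr u). Qed.

Definition pres_add (u v : pres) := cls (Add (repr u) (repr v)).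
Definition pres_mul (u v : pres) := cls (Mul (repr u) (repr v)).
Definition pres_opp (u : pres) := cls (Mul (Cst (-1)) (repr u)).
Definition pres_scale x (u : pres) := cls (Mul (Cst x) (repr u)).

Lemma clsD a b : pres_add (cls a) (cls b) = cls (Add a b).
Proof. by apply: cls_eq; apply: cong_add; apply: repr_cls. Qed.
Lemma clsM a b : pres_mul (cls a) (cls b) = cls (Mul a b).
Proof. by apply: cls_eq; apply: cong_mul; apply: repr_cls. Qed.
Lemma clsN a : pres_opp (cls a) = cls (Mul (Cst (-1)) a).
Proof. by apply: cls_eq; apply: cong_mul; [apply: cong_refl|apply: repr_cls]. Qed.
Lemma clsZ x a : pres_scale x (cls a) = cls (Mul (Cst x) a).
Proof. by apply: cls_eq; apply: cong_mul; [apply: cong_refl|apply: repr_cls]. Qed.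

Fact pres_addA : associative pres_add.
Proof.
elim/pres_ind=> a; elim/pres_ind=> b; elim/pres_ind=> c.
by rewrite !clsD; apply/cls_eq/cong_addA.
Qed.
Fact pres_addC : commutative pres_add.
Proof.
by elim/pres_ind=> a; elim/pres_ind=> b; rewrite !clsD; apply/cls_eq/cong_addC.
Qed.
Fact pres_add0 : left_id (cls (Cst 0)) pres_add.
Proof. by elim/pres_ind=> a; rewrite !clsD; apply/cls_eq/cong_add0. Qed.
Fact pres_addN : left_inverse (cls (Cst 0)) pres_opp pres_add.
Proof.
elim/pres_ind=> a; rewrite clsN clsD; apply/cls_eq.
apply: (@cong_trans _ (Mul (Cst (-1 + 1)) a)); last first.
  by rewrite addNr; apply: cong_mul0.
apply: cong_sym.
apply: (@cong_trans _ (Mul (Add (Cst (-1)) (Cst 1)) a)).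
  by apply: cong_mul; [apply: cong_cstD|apply: cong_refl].
apply: (cong_trans (cong_mulDl _ _ _)).
by apply: cong_add; [apply: cong_refl|apply: cong_1mul].
Qed.
HB.instance Definition _ :=
  GRing.isZmodule.Build pres pres_addA pres_addC pres_add0 pres_addN.

Lemma cls_addE a b : cls (Add a b) = cls a + cls b.
Proof. by rewrite -clsD. Qed.

Fact pres_mulA : associative pres_mul.
Proof.
elim/pres_ind=> a; elim/pres_ind=> b; elim/pres_ind=> c.
by rewrite !clsM; apply/cls_eq/cong_mulA.
Qed.
Fact pres_mul1 : left_id (cls (Cst 1)) pres_mul.
Proof. by elim/pres_ind=> a; rewrite !clsM; apply/cls_eq/cong_1mul. Qed.
Fact pres_1mul : right_id (cls (Cst 1)) pres_mul.
Proof.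
elim/pres_ind=> a; rewrite !clsM; apply/cls_eq.
by apply: cong_trans (cong_sym (cong_cstC _ _)) (cong_1mul _).
Qed.
Fact pres_mulDl : left_distributive pres_mul +%R.
Proof.
elim/pres_ind=> a; elim/pres_ind=> b; elim/pres_ind=> c.
by rewrite -cls_addE !clsM -cls_addE; apply/cls_eq/cong_mulDl.
Qed.
Fact pres_mulDr : right_distributive pres_mul +%R.
Proof.
elim/pres_ind=> a; elim/pres_ind=> b; elim/pres_ind=> c.
by rewrite -cls_addE !clsM -cls_addE; apply/cls_eq/cong_mulDr.
Qed.
HB.instance Definition _ := GRing.Zmodule_isPzRing.Build pres
  pres_mulA pres_mul1 pres_1mul pres_mulDl pres_mulDr.

Lemma cls_mulE a b : cls (Mul a b) = cls a * cls b.
Proof. by rewrite -clsM. Qed.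
Lemma pres_scaleE x u : pres_scale x u = cls (Cst x) * u.
Proof. by elim/pres_ind: u => a; rewrite clsZ cls_mulE. Qed.
Lemma cls_cstD x y : cls (Cst (x + y)) = cls (Cst x) + cls (Cst y).
Proof. by rewrite -cls_addE; apply/cls_eq/cong_cstD. Qed.
Lemma cls_cstM x y : cls (Cst (x * y)) = cls (Cst x) * cls (Cst y).
Proof. by rewrite -cls_mulE; apply/cls_eq/cong_cstM. Qed.
Lemma cls_cstC x u : cls (Cst x) * u = u * cls (Cst x).
Proof. by elim/pres_ind: u => a; rewrite -!cls_mulE; apply/cls_eq/cong_cstC. Qed.

Fact pres_scaleA x y u : pres_scale x (pres_scale y u) = pres_scale (x * y) u.
Proof. by rewrite !pres_scaleE cls_cstM mulrA. Qed.
Fact pres_scale1 : left_id 1 pres_scale.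
Proof. by move=> u; rewrite pres_scaleE mul1r. Qed.
Fact pres_scaleDr : right_distributive pres_scale +%R.
Proof. by move=> x u v; rewrite !pres_scaleE mulrDr. Qed.
Fact pres_scaleDl u : {morph pres_scale^~ u : x y / x + y}.
Proof. by move=> x y; rewrite !pres_scaleE cls_cstD mulrDl. Qed.
HB.instance Definition _ := GRing.Zmodule_isLmodule.Build k pres
  pres_scaleA pres_scale1 pres_scaleDr pres_scaleDl.

Lemma pres_scalerAl x (u v : pres) : x *: (u * v) = (x *: u) * v.
Proof. by rewrite /GRing.scale /= !pres_scaleE mulrA. Qed.
Lemma pres_scalerAr x (u v : pres) : x *: (u * v) = u * (x *: v).
Proof. by rewrite /GRing.scale /= !pres_scaleE mulrA cls_cstC -mulrA. Qed.
Lemma cls_cst x : cls (Cst x) = x *: (1 : pres).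
Proof. by rewrite /GRing.scale /= pres_scaleE mulr1. Qed.

Fixpoint expr_eval (A : algType k) (f : G -> A) (a : expr k G) : A :=
  match a with
  | Gen g => f g
  | Cst x => x%:A
  | Add b c => expr_eval f b + expr_eval f c
  | Mul b c => expr_eval f b * expr_eval f c
  end.

(* the homomorphism sending the generators to f; only meaningful when f
   satisfies the relations *)
Definition pres_eval (A : algType k) (f : G -> A) (u : pres) : A :=
  expr_eval f (repr u).

Section Eval.
Variables (A : algType k) (f : G -> A).
Hypothesis f_rel : forall a b, rel a b -> expr_eval f a = expr_eval f b.

Lemma eval_cong a b : cong a b -> expr_eval f a = expr_eval f b.
Proof.
elim=> //=.
- by move=> a1 b1 c1 _ -> _ ->.
- by move=> a1 a2 b1 b2 _ -> _ ->.
- by move=> a1 a2 b1 b2 _ -> _ ->.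
- by move=> *; rewrite addrA.
- by move=> *; rewrite addrC.
- by move=> *; rewrite scale0r add0r.
- by move=> *; rewrite scale0r mul0r.
- by move=> *; rewrite mulrA.
- by move=> *; rewrite scale1r mul1r.
- by move=> *; rewrite mulrDl.
- by move=> *; rewrite mulrDr.
- by move=> *; rewrite scalerDl.
- by move=> *; rewrite mulr_algl scalerA.
- by move=> *; rewrite mulr_algl mulr_algr.
Qed.
Lemma pres_eval_cls a : pres_eval f (cls a) = expr_eval f a.
Proof. exact: eval_cong (repr_cls a). Qed.
Lemma pres_eval_gen g : pres_eval f (cls (Gen g)) = f g.
Proof. by rewrite pres_eval_cls. Qed.
Lemma pres_evalD u v : pres_eval f (u + v) = pres_eval f u + pres_eval f v.
Proof.
by elim/pres_ind: u => a; elim/pres_ind: v => b; rewrite -cls_addE !pres_eval_cls.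
Qed.
Lemma pres_evalM u v : pres_eval f (u * v) = pres_eval f u * pres_eval f v.
Proof.
by elim/pres_ind: u => a; elim/pres_ind: v => b; rewrite -cls_mulE !pres_eval_cls.
Qed.
Lemma pres_evalZ x u : pres_eval f (x *: u) = x *: pres_eval f u.
Proof.
elim/pres_ind: u => a; rewrite /GRing.scale /= pres_scaleE -cls_mulE.
by rewrite !pres_eval_cls /= mulr_algl.
Qed.
Lemma pres_eval1 : pres_eval f 1 = 1.
Proof. by rewrite -[1]/(cls (Cst 1)) pres_eval_cls /= scale1r. Qed.
Lemma pres_eval0 : pres_eval f 0 = 0.
Proof. by rewrite -[0]/(cls (Cst 0)) pres_eval_cls /= scale0r. Qed.

Lemma pres_nz : (1 : pres) != 0.
Proof.
apply/eqP => /(congr1 (pres_eval f)); rewrite pres_eval1 pres_eval0.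
by apply/eqP/oner_neq0.
Qed.
End Eval.

End Presented.
Arguments cls {k G rel} a.

Section PresentedCommutative.
Variables (k : comNzRingType) (G : Type) (rel : expr k G -> expr k G -> Prop).

Variant com_rel : expr k G -> expr k G -> Prop :=
| com_rel_rel a b : rel a b -> com_rel a b
| com_rel_mulC a b : com_rel (Mul a b) (Mul b a).

Definition cpres := pres com_rel.
HB.instance Definition _ := Choice.on cpres.
HB.instance Definition _ := GRing.PzRing.on cpres.
HB.instance Definition _ := GRing.Lmodule.on cpres.

Fact cpres_mulC : commutative ( *%R : cpres -> cpres -> cpres).
Proof.
elim/pres_ind=> a; elim/pres_ind=> b; rewrite -!cls_mulE.
exact/cls_eq/cong_rel/com_rel_mulC.
Qed.
HB.instance Definition _ := GRing.PzRing_hasCommutativeMul.Build cpres cpres_mulC.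

Lemma com_rel_eval (A : comAlgType k) (f : G -> A) :
  (forall a b, rel a b -> expr_eval f a = expr_eval f b) ->
  forall a b, com_rel a b -> expr_eval f a = expr_eval f b.
Proof. by move=> h a b [{}a {}b /h //|{}a {}b] /=; rewrite mulrC. Qed.
End PresentedCommutative.

Section Coordinates.
Variable k : fieldType.

(* V = Spec coordV, with coordV = k[X, Y, z2, z2^-1]/(XY) *)
Variant genV := gX | gY | gZ | gZinv.
Variant relV : expr k genV -> expr k genV -> Prop :=
| relV_XY : relV (Mul (Gen gX) (Gen gY)) (Cst 0)
| relV_Z : relV (Mul (Gen gZ) (Gen gZinv)) (Cst 1).
Definition coordV := cpres relV.
HB.instance Definition _ := GRing.ComPzRing.on coordV.
HB.instance Definition _ := GRing.Lmodule.on coordV.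

(* V/W_0 = Spec coordW, with coordW = k[z1, z2, z2^-1] *)
Variant genW := gW1 | gW2 | gW2inv.
Variant relW : expr k genW -> expr k genW -> Prop :=
| relW_Z : relW (Mul (Gen gW2) (Gen gW2inv)) (Cst 1).
Definition coordW := cpres relW.
HB.instance Definition _ := GRing.ComPzRing.on coordW.
HB.instance Definition _ := GRing.Lmodule.on coordW.

Definition valV (A : algType k) (x y z z' : A) (g : genV) : A :=
  match g with gX => x | gY => y | gZ => z | gZinv => z' end.
Definition valW (A : algType k) (z1 z2 z2' : A) (g : genW) : A :=
  match g with gW1 => z1 | gW2 => z2 | gW2inv => z2' end.

Lemma valVP (A : comAlgType k) (x y z z' : A) : x * y = 0 -> z * z' = 1 ->
  forall a b, com_rel relV a b ->
  expr_eval (valV x y z z') a = expr_eval (valV x y z z') b.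
Proof.
move=> xy zz'; apply: com_rel_eval => _ _ [] /=; first by rewrite xy scale0r.
by rewrite zz' scale1r.
Qed.
Lemma valWP (A : comAlgType k) (z1 z2 z2' : A) : z2 * z2' = 1 ->
  forall a b, com_rel relW a b ->
  expr_eval (valW z1 z2 z2') a = expr_eval (valW z1 z2 z2') b.
Proof.
move=> zz'; apply: com_rel_eval => _ _ [] /=.
by rewrite zz' scale1r.
Qed.

Fact coordV_nz : (1 : coordV) != 0.
Proof.
by apply: (pres_nz (@valVP k^o 0 0 1 1 _ _)); rewrite ?mul0r ?mul1r.
Qed.
HB.instance Definition _ :=
  GRing.PzSemiRing_isNonZero.Build coordV coordV_nz.
HB.instance Definition _ :=
  GRing.Lmodule_isLalgebra.Build k coordV (@pres_scalerAl k genV _).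
HB.instance Definition _ :=
  GRing.Lalgebra_isAlgebra.Build k coordV (@pres_scalerAr k genV _).

Fact coordW_nz : (1 : coordW) != 0.
Proof. by apply: (pres_nz (@valWP k^o 0 1 1 _)); rewrite mul1r. Qed.
HB.instance Definition _ :=
  GRing.PzSemiRing_isNonZero.Build coordW coordW_nz.
HB.instance Definition _ :=
  GRing.Lmodule_isLalgebra.Build k coordW (@pres_scalerAl k genW _).
HB.instance Definition _ :=
  GRing.Lalgebra_isAlgebra.Build k coordW (@pres_scalerAr k genW _).

End Coordinates.

Section Localization.
Variables (R : comNzRingType) (P : prime_idealr R).

(* the local ring R_P; the fraction a / b is the class of the pair (a, b) *)
Definition frac_pre := {p : R * R | p.2 \notin P}.
Implicit Types p q r : frac_pre.
Local Notation num p := (val p).1.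
Local Notation den p := (val p).2.

Lemma denP p : den p \notin P. Proof. by case: p. Qed.
Lemma mem1P : (1 : R) \notin P. Proof. by rewrite idealr1. Qed.
Lemma memMP a b : a \notin P -> b \notin P -> a * b \notin P.
Proof. by move=> ha hb; rewrite prime_idealrM negb_or ha. Qed.
Hint Resolve denP mem1P memMP : core.

Definition mkfrac a b (hb : b \notin P) : frac_pre := exist _ (a, b) hb.

Definition frac_equiv p q : bool :=
  `[< exists2 u, u \notin P & u * (num p * den q - num q * den p) = 0 >].
Lemma frac_refl : reflexive frac_equiv.
Proof. by move=> p; apply/asboolP; exists 1 => //; rewrite subrr mulr0. Qed.
Lemma frac_sym : symmetric frac_equiv.
Proof.
move=> p q; apply/asboolP/asboolP => -[u hu h]; exists u => //;
  by rewrite -[RHS]oppr0 -h; ring.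
Qed.
Lemma frac_trans : transitive frac_equiv.
Proof.
move=> q p r /asboolP[u hu h] /asboolP[v hv h']; apply/asboolP.
exists (u * v * den q); first by auto.
suff -> : u * v * den q * (num p * den r - num r * den p) =
  v * den r * (u * (num p * den q - num q * den p)) +
  u * den p * (v * (num q * den r - num r * den q)).
  by rewrite h h' !mulr0 addr0.
by ring.
Qed.
Canonical frac_equiv_rel := EquivRel frac_equiv frac_refl frac_sym frac_trans.

Definition loc := {eq_quot frac_equiv}.
HB.instance Definition _ := Choice.on loc.
HB.instance Definition _ := EqQuotient.on loc.

Definition frc p : loc := \pi_loc p.
Lemma frcP p q : frc p = frc q <->
  exists2 u, u \notin P & u * (num p * den q - num q * den p) = 0.
Proof.
split=> [/eqP|h]; first by rewrite /frc eqmodE => /asboolP.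
by apply/eqP; rewrite /frc eqmodE; apply/asboolP.
Qed.
Lemma loc_ind (Q : loc -> Prop) : (forall p, Q (frc p)) -> forall x, Q x.
Proof. by move=> h x; rewrite -[x]reprK; apply: h. Qed.

Definition to_loc (a : R) : loc := frc (mkfrac a mem1P).

Definition fadd p q :=
  mkfrac (num p * den q + num q * den p) (memMP (denP p) (denP q)).
Definition fmul p q := mkfrac (num p * num q) (memMP (denP p) (denP q)).
Definition fopp p := mkfrac (- num p) (denP p).
Definition loc_add (x y : loc) := frc (fadd (repr x) (repr y)).
Definition loc_mul (x y : loc) := frc (fmul (repr x) (repr y)).
Definition loc_opp (x : loc) := frc (fopp (repr x)).

Lemma repr_frc p :
  exists2 u, u \notin P &
    u * (num (repr (frc p)) * den p - num p * den (repr (frc p))) = 0.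
Proof. by apply/frcP; rewrite /frc reprK. Qed.

Lemma frcD p q : loc_add (frc p) (frc q) = frc (fadd p q).
Proof.
have [u hu h] := repr_frc p; have [v hv h'] := repr_frc q.
apply/frcP; exists (u * v); first by auto.
move: (repr (frc p)) (repr (frc q)) h h' => p' q' h h' /=.
rewrite (_ : _ * _ = v * den q * den q' *
    (u * (num p' * den p - num p * den p')) +
  u * den p * den p' * (v * (num q' * den q - num q * den q'))); last by ring.
by rewrite h h' !mulr0 addr0.
Qed.
Lemma frcM p q : loc_mul (frc p) (frc q) = frc (fmul p q).
Proof.
have [u hu h] := repr_frc p; have [v hv h'] := repr_frc q.
apply/frcP; exists (u * v); first by auto.
move: (repr (frc p)) (repr (frc q)) h h' => p' q' h h' /=.
rewrite (_ : _ * _ = v * den q * num q' *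
    (u * (num p' * den p - num p * den p')) +
  u * num p * den p' * (v * (num q' * den q - num q * den q'))); last by ring.
by rewrite h h' !mulr0 addr0.
Qed.
Lemma frcN p : loc_opp (frc p) = frc (fopp p).
Proof.
have [u hu h] := repr_frc p; apply/frcP; exists u => //.
move: (repr _) h => p' h /=.
by rewrite -[RHS]oppr0 -h; ring.
Qed.

Fact loc_addA : associative loc_add.
Proof.
elim/loc_ind=> p; elim/loc_ind=> q; elim/loc_ind=> r; rewrite !frcD.
by apply/frcP; exists 1 => //=; ring.
Qed.
Fact loc_addC : commutative loc_add.
Proof.
elim/loc_ind=> p; elim/loc_ind=> q; rewrite !frcD.
by apply/frcP; exists 1 => //=; ring.
Qed.
Fact loc_add0 : left_id (to_loc 0) loc_add.
Proof.
by elim/loc_ind=> p; rewrite frcD; apply/frcP; exists 1 => //=; ring.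
Qed.
Fact loc_addN : left_inverse (to_loc 0) loc_opp loc_add.
Proof.
by elim/loc_ind=> p; rewrite frcN frcD; apply/frcP; exists 1 => //=; ring.
Qed.
HB.instance Definition _ :=
  GRing.isZmodule.Build loc loc_addA loc_addC loc_add0 loc_addN.

Fact loc_mulA : associative loc_mul.
Proof.
elim/loc_ind=> p; elim/loc_ind=> q; elim/loc_ind=> r; rewrite !frcM.
by apply/frcP; exists 1 => //=; ring.
Qed.
Fact loc_mulC : commutative loc_mul.
Proof.
elim/loc_ind=> p; elim/loc_ind=> q; rewrite !frcM.
by apply/frcP; exists 1 => //=; ring.
Qed.
Fact loc_mul1 : left_id (to_loc 1) loc_mul.
Proof.
by elim/loc_ind=> p; rewrite frcM; apply/frcP; exists 1 => //=; ring.
Qed.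
Fact loc_mulDl : left_distributive loc_mul +%R.
Proof.
elim/loc_ind=> p; elim/loc_ind=> q; elim/loc_ind=> r.
rewrite -[frc p + frc q]/(loc_add _ _) -[_ + _]/(loc_add _ _) !(frcD, frcM).
by apply/frcP; exists 1 => //=; ring.
Qed.
Fact loc_nz : to_loc 1 != 0.
Proof.
apply/eqP => /frcP[u hu /=]; rewrite mul1r mul0r subr0 mulr1 => u0.
by rewrite u0 idealr0 in hu.
Qed.
HB.instance Definition _ := GRing.Zmodule_isComNzRing.Build loc
  loc_mulA loc_mulC loc_mul1 loc_mulDl loc_nz.

Lemma to_locD a b : to_loc (a + b) = to_loc a + to_loc b.
Proof. apply: etrans (esym (frcD _ _)); apply/frcP; exists 1 => //=; ring. Qed.
Lemma to_locM a b : to_loc (a * b) = to_loc a * to_loc b.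
Proof. apply: etrans (esym (frcM _ _)); apply/frcP; exists 1 => //=; ring. Qed.
End Localization.

Section Corner.
Variables (k : comNzRingType) (A : algType k).

Record cidem := CIdem {
  idem : A;
  idem_idem : idem * idem = idem;
  idem_central : forall a, idem * a = a * idem;
  idem_neq0 : idem != 0 }.

Variable e : cidem.
Local Notation ie := (idem e).

(* the algebra A e, with unit e *)
Record corner := Corner { cval : A; _ : cval * ie == cval }.
HB.instance Definition _ := [isSub for cval].
HB.instance Definition _ := [Choice of corner by <:].

Lemma cvalP (x : corner) : cval x * ie = cval x.
Proof. by case: x => a /= /eqP. Qed.

Fact cproj_subproof a : (a * ie) * ie == a * ie.
Proof. by rewrite -mulrA idem_idem. Qed.
Definition cproj a : corner := Corner (cproj_subproof a).

Fact corner_submod : submod_closed (fun a : A => a * ie == a).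
Proof.
split=> [|c a b]; rewrite !unfold_in ?mul0r //.
by move=> /eqP ha /eqP hb; rewrite mulrDl -scalerAl ha hb.
Qed.
HB.instance Definition _ :=
  GRing.SubChoice_isSubLmodule.Build k A (fun a : A => a * ie == a) corner
    (GRing.submod_closed_semi corner_submod).

Definition corner_mul (x y : corner) : corner := cproj (cval x * cval y).
Definition corner_one : corner := cproj 1.
Lemma cval_mul x y : cval (corner_mul x y) = cval x * cval y.
Proof. by rewrite /= -mulrA cvalP. Qed.
Lemma cval_one : cval corner_one = ie.
Proof. exact: mul1r. Qed.
Lemma cval_idem x : ie * cval x = cval x.
Proof. by rewrite idem_central cvalP. Qed.

Fact corner_mulA : associative corner_mul.
Proof. by move=> x y z; apply: val_inj; rewrite [LHS]cval_mul [RHS]cval_mul !cval_mul mulrA. Qed.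
Fact corner_mul1 : left_id corner_one corner_mul.
Proof.
by move=> x; apply: val_inj; rewrite [LHS]cval_mul cval_one cval_idem.
Qed.
Fact corner_1mul : right_id corner_one corner_mul.
Proof. by move=> x; apply: val_inj; rewrite [LHS]cval_mul cval_one cvalP. Qed.
Fact corner_mulDl : left_distributive corner_mul +%R.
Proof. by move=> x y z; apply: val_inj; rewrite /= !mulrDl. Qed.
Fact corner_mulDr : right_distributive corner_mul +%R.
Proof. by move=> x y z; apply: val_inj; rewrite /= mulrDr mulrDl. Qed.
Fact corner_nz : corner_one != 0.
Proof.
apply/eqP => /(congr1 (@cval)); rewrite cval_one /= => /eqP.
by apply/negP/idem_neq0.
Qed.
HB.instance Definition _ := GRing.Zmodule_isNzRing.Build corner
  corner_mulA corner_mul1 corner_1mul corner_mulDl corner_mulDr corner_nz.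

Fact corner_scalerAl (c : k) (x y : corner) : c *: (x * y) = (c *: x) * y.
Proof. by apply: val_inj; rewrite /= !scalerAl. Qed.
Fact corner_scalerAr (c : k) (x y : corner) : c *: (x * y) = x * (c *: y).
Proof. by apply: val_inj; rewrite /= -scalerAr !scalerAl. Qed.
HB.instance Definition _ :=
  GRing.Lmodule_isLalgebra.Build k corner corner_scalerAl.
HB.instance Definition _ :=
  GRing.Lalgebra_isAlgebra.Build k corner corner_scalerAr.
End Corner.

Section TorusCharacters.
Variable F : finFieldType.

Definition torus : finGroupType := ({unit F} * {unit F})%type.
Definition swap (t : torus) : torus := (t.2, t.1).

Variable k : fieldType.

(* Hom(T, k^x); values are nonzero because T is a group *)
Definition is_torus_char (f : {ffun torus -> k}) : bool :=
  (f 1%g == 1) && [forall t, forall u, f (t * u)%g == f t * f u].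
Record torus_char := TorusChar {
  torus_fun :> {ffun torus -> k}; _ : is_torus_char torus_fun }.
HB.instance Definition _ := [isSub for torus_fun].
HB.instance Definition _ := [Choice of torus_char by <:].

Implicit Types lam mu : torus_char.

Lemma torus_char1 lam : lam 1%g = 1.
Proof. by case: lam => f /= /andP[/eqP]. Qed.
Lemma torus_charM lam t u : lam (t * u)%g = lam t * lam u.
Proof. by case: lam => f /= /andP[_ /forallP/(_ t)/forallP/(_ u)/eqP]. Qed.
Lemma torus_char_neq0 lam t : lam t != 0.
Proof.
apply/eqP => h; have := torus_char1 lam.
by rewrite -(mulgV t) torus_charM h mul0r => /eqP; rewrite eq_sym oner_eq0.
Qed.
Lemma torus_charV lam t : lam t^-1%g = (lam t)^-1.
Proof.
apply: (mulfI (torus_char_neq0 lam t)).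
by rewrite -torus_charM mulgV torus_char1 divff // torus_char_neq0.
Qed.

Lemma swapM t u : swap (t * u)%g = (swap t * swap u)%g. Proof. by []. Qed.
Lemma swapK : involutive swap. Proof. by case. Qed.

Fact swap_char_subproof lam : is_torus_char [ffun t => lam (swap t)].
Proof.
apply/andP; split; first by rewrite ffunE [swap _](_ : _ = 1%g) // torus_char1.
by apply/forallP => t; apply/forallP => u; rewrite !ffunE swapM torus_charM.
Qed.
Definition swap_char lam := TorusChar (swap_char_subproof lam).
Lemma swap_charE lam t : swap_char lam t = lam (swap t).
Proof. by rewrite ffunE. Qed.

Lemma char_orth lam mu :
  \sum_t (lam t)^-1 * mu t = if lam == mu then #|torus|%:R else 0.
Proof.
case: eqP => [->|/eqP nlm].
  rewrite (eq_bigr (fun=> 1)) ?sumr_const // => t _.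
  by rewrite mulVf // torus_char_neq0.
have [u hu] : exists u, lam u != mu u.
  apply/existsP; apply: contraR nlm; rewrite negb_exists => /forallP h.
  by apply/eqP/val_inj/ffunP => u; apply/eqP; rewrite -[_ == _]negbK; apply: h.
set S := \sum_t _.
have hS : S = (lam u)^-1 * mu u * S.
  rewrite {1}/S (reindex_inj (mulgI u)) big_distrr /=; apply: eq_bigr => t _.
  by rewrite !torus_charM invfM; ring.
have : (1 - (lam u)^-1 * mu u) * S = 0 by rewrite mulrBl mul1r -hS subrr.
move/eqP; rewrite mulf_eq0 subr_eq0 => /orP[/eqP h|/eqP //].
case/eqP: hu; apply: (mulfI (invr_neq0 (torus_char_neq0 lam u))).
by rewrite -h mulVf // torus_char_neq0.
Qed.
End TorusCharacters.

Section HeckeAlgebra.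
Variables (F : finFieldType) (k : fieldType).
Local Notation T := (torus F).

Variant genH := gT of T | gS | gU | gUinv.
Local Notation tT t := (Gen (gT t)).
Local Notation tS := (Gen gS).
Local Notation tU := (Gen gU).
Local Notation tU' := (Gen gUinv).

Definition cs_expr : expr k genH :=
  foldr (@Add k genH) (Cst 0)
    [seq tT ((a, a^-1)%g : T) | a <- enum {: {unit F}}].

Variant relH : expr k genH -> expr k genH -> Prop :=
| relH_TT t u : relH (Mul (tT t) (tT u)) (tT (t * u)%g)
| relH_T1 : relH (tT 1%g) (Cst 1)
| relH_ST t : relH (Mul tS (tT t)) (Mul (tT (swap t)) tS)
| relH_UT t : relH (Mul tU (tT t)) (Mul (tT (swap t)) tU)
| relH_UU' : relH (Mul tU tU') (Cst 1)
| relH_U'U : relH (Mul tU' tU) (Cst 1)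
| relH_UUS : relH (Mul (Mul tU tU) tS) (Mul tS (Mul tU tU))
| relH_SS : relH (Mul tS tS) (Mul cs_expr tS).

(* the mod p pro-p Iwahori-Hecke algebra of GL_2, with q = #|F|: the quadratic
   relation is that of the generic algebra with its parameter set to q = 0 *)
Definition hecke := pres relH.
HB.instance Definition _ := Choice.on hecke.
HB.instance Definition _ := GRing.PzRing.on hecke.
HB.instance Definition _ := GRing.Lmodule.on hecke.

(* a representation on k^2 in which S acts by 0; it is only used to see that
   the algebra and its components are nonzero *)
Definition rep2 (lam : torus_char F k) (g : genH) : 'M[k]_2 :=
  match g with
  | gT t => diag_mx (\row_i if i == 0 then lam t else lam (swap t))
  | gS => 0
  | _ => perm_mx (tperm 0 1)
  end.

Lemma rep2P lam a b : relH a b -> expr_eval (rep2 lam) a = expr_eval (rep2 lam) b.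
Proof.
have hp : perm_mx (tperm 0 1) * perm_mx (tperm 0 1) = 1 :> 'M[k]_2.
  by rewrite -[LHS]/(_ *m _) -perm_mxM tperm2 perm_mx1.
case=> [t u||t|t||||] /=.
- rewrite -[LHS]/(_ *m _) mulmx_diag; congr diag_mx; apply/rowP => i.
  by rewrite !mxE; case: eqP => _; rewrite ?swapM torus_charM.
- rewrite scale1r; apply/matrixP => i j; rewrite !mxE.
  by rewrite [swap _](_ : _ = 1%g) // torus_char1 if_same.
- by rewrite mul0r mulr0.
- apply/matrixP => i j; rewrite -[LHS]/((_ *m _) i j) -[RHS]/((_ *m _) i j).
  rewrite !mxE !big_ord_recl !big_ord0 !mxE swapK /=.
  by case: i => -[|[|//]] hi; case: j => -[|[|//]] hj;
     rewrite !permE /= ?mul0r ?mulr0 ?add0r ?addr0 ?mul1r ?mulr1.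
- by rewrite hp scale1r.
- by rewrite hp scale1r.
- by rewrite mulr0 mul0r.
- by rewrite mul0r mulr0.
Qed.

Fact triv_char_subproof : is_torus_char [ffun t : T => 1 : k].
Proof.
rewrite /is_torus_char ffunE eqxx /=.
by apply/forallP => t; apply/forallP => u; rewrite !ffunE mul1r.
Qed.

Fact hecke_nz : (1 : hecke) != 0.
Proof. exact: pres_nz (@rep2P (TorusChar triv_char_subproof)). Qed.
HB.instance Definition _ := GRing.PzSemiRing_isNonZero.Build hecke hecke_nz.
HB.instance Definition _ :=
  GRing.Lmodule_isLalgebra.Build k hecke (@pres_scalerAl k genH _).
HB.instance Definition _ :=
  GRing.Lalgebra_isAlgebra.Build k hecke (@pres_scalerAr k genH _).

Definition hT (t : T) : hecke := cls (tT t).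
Definition hS : hecke := cls tS.
Definition hU : hecke := cls tU.
Definition hUinv : hecke := cls tU'.

Implicit Types lam mu : torus_char F k.

Definition eps lam : hecke := (#|T|%:R)^-1 *: \sum_t (lam t)^-1 *: hT t.

(* the sum over the W_0-orbit of lam *)
Definition eps_orbit lam : hecke :=
  \sum_(mu <- undup [:: lam; swap_char lam]) eps mu.
End HeckeAlgebra.

Section HeckeComponent.
Variables (F : finFieldType) (k : fieldType) (iota : {rmorphism F -> k}).
Local Notation T := (torus F).
Local Notation H := (hecke F k).
Implicit Types lam mu : torus_char F k.

Fact card_torus_neq0 : (#|T|%:R : k) != 0.
Proof.
have [p pp cF] := finPcharP F.
have hq : (#|F|%:R : k) = 0.
  have cFE : #|F| = (p ^ logn p #|F|)%N by apply: (card_pprimeChar cF).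
  move: cFE (finNzRing_gt1 F); move: (logn _ _) => [|n] cardF gt1; first by rewrite cardF expn0 in gt1.
  by rewrite -(rmorph_nat iota) cardF natrX (pcharf0 cF) expr0n rmorph0.
have -> : (#|T| = #|F|.-1 * #|F|.-1)%N.
  by rewrite -(card_finField_unit F) cardsT; apply: card_prod.
have -> : (#|F|.-1 * #|F|.-1)%:R = 1 :> k.
  have h : (#|F|.-1)%:R = -1 :> k.
    apply/eqP; rewrite -subr_eq0 opprK natr1 prednK ?hq //.
    by apply: ltnW; apply: finNzRing_gt1.
  by rewrite natrM h mulrNN mulr1.
exact: oner_neq0.
Qed.
Local Notation N := (#|T|%:R : k).

Lemma hTM t u : hT k (t * u)%g = hT k t * hT k u :> H.
Proof. by rewrite /hT -cls_mulE; apply/esym/cls_eq/cong_rel/relH_TT. Qed.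
Lemma hST t : hS F k * hT k t = hT k (swap t) * hS F k.
Proof. by rewrite -!cls_mulE; apply/cls_eq/cong_rel/relH_ST. Qed.
Lemma hUT t : hU F k * hT k t = hT k (swap t) * hU F k.
Proof. by rewrite -!cls_mulE; apply/cls_eq/cong_rel/relH_UT. Qed.
Lemma hUV : hU F k * hUinv F k = 1.
Proof. by rewrite -!cls_mulE; apply/cls_eq/cong_rel/relH_UU'. Qed.
Lemma hVU : hUinv F k * hU F k = 1.
Proof. by rewrite -!cls_mulE; apply/cls_eq/cong_rel/relH_U'U. Qed.

Lemma eps_mul lam mu : eps lam * eps mu = if lam == mu then eps mu else 0.
Proof.
rewrite /eps -scalerAl -scalerAr scalerA.
have -> : (\sum_t (lam t)^-1 *: hT k t) * (\sum_t (mu t)^-1 *: hT k t) =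
   (\sum_t (lam t)^-1 * mu t) *: \sum_t (mu t)^-1 *: hT k t.
  rewrite big_distrl scaler_suml; apply: eq_bigr => t _ /=.
  rewrite big_distrr scaler_sumr (reindex_inj (mulgI t^-1%g)).
  apply: eq_bigr => u _ /=.
  rewrite -scalerAl -scalerAr -hTM mulgA mulgV mul1g !scalerA.
  by rewrite torus_charM torus_charV invfM invrK mulrA.
rewrite char_orth; case: ifP => _; last by rewrite scale0r scaler0.
by rewrite scalerA -mulrA mulVf ?mulr1 // card_torus_neq0.
Qed.

Lemma swap_eps (x : H) lam : (forall t, x * hT k t = hT k (swap t) * x) ->
  x * eps lam = eps (swap_char lam) * x.
Proof.
move=> hx; rewrite /eps -scalerAr -scalerAl; congr (_ *: _).
rewrite big_distrr big_distrl (reindex_inj (inv_inj (@swapK F))).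
apply: eq_bigr => t _ /=.
by rewrite -scalerAr hx -scalerAl swapK swap_charE.
Qed.
Lemma hT_eps t lam : hT k t * eps lam = eps lam * hT k t.
Proof.
rewrite /eps -scalerAr -scalerAl; congr (_ *: _).
rewrite big_distrr big_distrl; apply: eq_bigr => u _ /=.
rewrite -scalerAr -scalerAl -!hTM; congr (_ *: hT k _).
by case: t u => [t1 t2] [u1 u2]; congr (_, _); apply: val_inj; apply: mulrC.
Qed.

Lemma swap_charK lam : swap_char (swap_char lam) = lam.
Proof. by apply/val_inj/ffunP => t; rewrite !swap_charE swapK. Qed.

Lemma eps_orbitE lam : eps_orbit lam =
  if swap_char lam == lam then eps lam else eps lam + eps (swap_char lam).
Proof.
rewrite /eps_orbit /= inE eq_sym; case: eqP => h.
  by rewrite big_seq1 h.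
by rewrite big_cons big_seq1.
Qed.

Lemma eps_orbit_swap (x : H) lam : (forall t, x * hT k t = hT k (swap t) * x) ->
  x * eps_orbit lam = eps_orbit lam * x.
Proof.
move=> hx; rewrite eps_orbitE; case: eqP => h; first by rewrite swap_eps // h.
by rewrite mulrDr mulrDl !swap_eps // swap_charK addrC.
Qed.

Fact eps_orbit_idem lam : eps_orbit lam * eps_orbit lam = eps_orbit lam.
Proof.
rewrite eps_orbitE; case: eqP => h; first by rewrite eps_mul eqxx.
rewrite mulrDl !mulrDr !eps_mul !eqxx [lam == _]eq_sym.
by case: eqP => // _; rewrite addr0 add0r.
Qed.
Fact eps_orbit_central lam a : eps_orbit lam * a = a * eps_orbit lam.
Proof.
have hu : hU F k * eps_orbit lam = eps_orbit lam * hU F k.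
  by apply: eps_orbit_swap; apply: hUT.
elim/pres_ind: a; elim=> [[t|||]|x|a ha b hb|a ha b hb].
- rewrite eps_orbitE -/(hT k t); case: eqP => _; first by rewrite hT_eps.
  by rewrite mulrDl mulrDr !hT_eps.
- by apply/esym/eps_orbit_swap/hST.
- exact/esym.
- rewrite -/(hUinv F k) -[LHS]mul1r -hVU -!mulrA [_ * (eps_orbit _ * _)]mulrA hu.
  by rewrite -!mulrA hUV mulr1.
- by rewrite cls_cst mulr_algl mulr_algr.
- by rewrite cls_addE mulrDl mulrDr ha hb.
- by rewrite cls_mulE mulrA ha -mulrA hb mulrA.
Qed.
Fact eps_orbit_neq0 lam : eps_orbit lam != 0.
Proof.
pose ev := pres_eval (rep2 lam) : H -> 'M[k]_2.
have evD : {morph ev : x y / x + y} := pres_evalD (@rep2P F k lam).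
have ev0 : ev 0 = 0 := pres_eval0 (@rep2P F k lam).
have evZ c x : ev (c *: x) = c *: ev x := pres_evalZ (@rep2P F k lam) c x.
have ev_eps mu : ev (eps mu) 0 0 = (mu == lam)%:R.
  rewrite /eps evZ (big_morph ev evD ev0) mxE summxE.
  rewrite (eq_bigr (fun t => (mu t)^-1 * lam t)) => [|t _]; last first.
    by rewrite evZ mxE /ev /hT pres_eval_gen ?mxE //; apply: rep2P.
  by rewrite char_orth; case: eqP => _; rewrite ?mulr0 ?mulVf ?card_torus_neq0.
apply/eqP => h; have := congr1 (fun x => ev x 0 0) h.
rewrite ev0 mxE eps_orbitE; case: eqP => e; rewrite ?evD ?mxE !ev_eps eqxx.
  by apply/eqP/oner_neq0.
by case: eqP => // _; rewrite addr0; apply/eqP/oner_neq0.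
Qed.

Definition eps_cidem lam : cidem H :=
  CIdem (eps_orbit_idem lam) (eps_orbit_central lam) (eps_orbit_neq0 lam).
End HeckeComponent.

(* The correspondence f (a map whose values are only determined up to eqv)
   induces a bijection from D onto the set of eqv-classes of elements of E. *)
Definition bij_classes (X Y : Type) (D : X -> Prop) (E : Y -> Prop)
    (eqv : Y -> Y -> Prop) (f : X -> Y -> Prop) : Prop :=
  [/\ forall x, D x -> exists y, f x y,
      forall x y, D x -> f x y -> E y,
      forall x x' y y', D x -> D x' -> f x y -> f x' y' -> (x = x' <-> eqv y y')
    & forall y, E y -> exists x y', [/\ D x, f x y' & eqv y' y]].

Section Modules.
Variables (k : fieldType) (A : algType k).
Implicit Types L M N : lmodType A.

Definition isomorphic M N : Prop := exists f : {linear M -> N}, bijective f.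

Definition simple M : Prop :=
  (exists m : M, m != 0) /\
  forall N : {pred M}, submod_closed N -> {in N, forall m, m = 0} \/ N =i predT.

Definition is_kbasis M n (b : 'I_n -> M) : Prop :=
  forall m, exists! c : {ffun 'I_n -> k}, m = \sum_i (c i)%:A *: b i.
Definition has_kdim M (n : nat) : Prop := exists b : 'I_n -> M, is_kbasis b.
Definition finite_dimensional M : Prop := exists n, has_kdim M n.

(* [jordan_holder M s]: s is the list of factors of a composition series of M *)
Inductive jordan_holder : lmodType A -> seq (lmodType A) -> Prop :=
| jh_nil M : (forall m : M, m = 0) -> jordan_holder M [::]
| jh_cons M N L s (f : {linear N -> M}) (g : {linear M -> L}) :
    injective f -> (forall l, exists m, g m = l) ->
    (forall m, g m = 0 <-> exists n, f n = m) ->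
    simple L -> jordan_holder N s -> jordan_holder M (L :: s).

Definition affords L (chi : {lrmorphism A -> k^o}) : Prop :=
  has_kdim L 1 /\ forall a (l : L), a *: l = (chi a : k)%:A *: l.

Definition generated_by (G : seq A) (a : A) : Prop :=
  forall P : {pred A}, GRing.subalg_closed P -> {subset G <= P} -> a \in P.

Definition central (z : A) : Prop := forall a, z * a = a * z.

Definition central_character M (theta : A -> k) : Prop :=
  forall z (m : M), central z -> z *: m = (theta z)%:A *: m.

(* M is the quotient of N by I N.  When Z/I is identified with k by a
   character theta of Z with kernel I, this is the tensor product of N with k
   over (Z, theta). *)
Definition is_quotient_by (I : A -> Prop) N M : Prop :=
  exists f : {linear N -> M},
    (forall m, exists n, f n = m) /\
    forall n, f n = 0 <->
      exists p (z : 'I_p -> A) (x : 'I_p -> N),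
        (forall i, I (z i)) /\ n = \sum_i z i *: x i.
End Modules.

Section Spectrum.
Variable R : comNzRingType.

Definition prime_chain n (c : 'I_n.+1 -> prime_idealr R) : Prop :=
  forall i j : 'I_n.+1, (i < j)%N ->
    {subset (c i : pred R) <= (c j : pred R)} /\
    exists2 a, a \in c j & a \notin c i.

Definition krull_dim (n : nat) : Prop :=
  (exists c, @prime_chain n c) /\ forall m c, @prime_chain m c -> (m <= n)%N.

(* To be used for Noetherian R: the nonunits form an ideal, generated by dim R
   elements. *)
Definition regular_local : Prop :=
  exists n, krull_dim n /\
  exists g : 'I_n -> R, forall a,
    (~ exists b, a * b = 1) <-> exists c : 'I_n -> R, a = \sum_i c i * g i.
End Spectrum.

Definition singular (R : comNzRingType) (P : prime_idealr R) : Prop :=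
  ~ regular_local (loc P).

Section Ramification.
Variables (B R : comNzRingType) (phi : B -> R).

(* The stalk at P of the module of Kaehler differentials of R over B vanishes:
   it represents the B-derivations of R into modules over the local ring R_P *)
Definition unramified (P : prime_idealr R) : Prop :=
  forall (N : lmodType (loc P)) (D : R -> N),
    {morph D : a b / a + b} ->
    (forall a b, D (a * b) = to_loc P a *: D b + to_loc P b *: D a) ->
    (forall b, D (phi b) = 0) ->
    forall a, D a = 0.

Definition branch_locus (p : prime_idealr B) : Prop :=
  exists P : prime_idealr R,
    (forall b, (b \in p) = (phi b \in P)) /\ ~ unramified P.
End Ramification.

Section Points.
Variable k : fieldType.

Definition cX : coordV k := cls (Gen gX).
Definition cY : coordV k := cls (Gen gY).
Definition cZ : coordV k := cls (Gen gZ).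
Definition cZinv : coordV k := cls (Gen gZinv).
Definition cW1 : coordW k := cls (Gen gW1).
Definition cW2 : coordW k := cls (Gen gW2).

Definition swapV : coordV k -> coordV k := pres_eval (valV cY cX cZ cZinv).
Definition covering : coordW k -> coordV k :=
  pres_eval (valW (cX + cY) cZ cZinv).

(* The k-points are given by their coordinates (x, y, z2) and (z1, z2). *)
Definition ptsV (v : k * k * k) : Prop := v.1.1 * v.1.2 = 0 /\ v.2 != 0.
Definition ptsW (v : k * k) : Prop := v.2 != 0.
Definition atV (v : k * k * k) : coordV k -> k :=
  pres_eval (@valV k k^o v.1.1 v.1.2 v.2 v.2^-1).
Definition atW (v : k * k) : coordW k -> k :=
  pres_eval (@valW k k^o v.1 v.2 v.2^-1).

(* a k-point lies in the subset C of the spectrum when the maximal ideal of the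
   functions vanishing at it does *)
Definition kptsV (C : prime_idealr (coordV k) -> Prop) (v : k * k * k) : Prop :=
  ptsV v /\ exists P, C P /\ forall f, (f \in P) = (atV v f == 0).
Definition kptsW (C : prime_idealr (coordW k) -> Prop) (v : k * k) : Prop :=
  ptsW v /\ exists P, C P /\ forall f, (f \in P) = (atW v f == 0).

Definition D1 (P : prime_idealr (coordW k)) : Prop := cW2 - cW1 ^+ 2 \in P.
Definition D2 (P : prime_idealr (coordW k)) : Prop := ~ D1 P.
End Points.
Arguments cX {k}. Arguments cY {k}. Arguments cW1 {k}. Arguments cW2 {k}.

Section Spherical.
Variables (F : finFieldType) (k : fieldType) (iota : {rmorphism F -> k}).
Variable lam : torus_char F k.

Definition hecke_comp : algType k := corner (eps_cidem iota lam).
Local Notation H := hecke_comp.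
Local Notation pr := (@cproj _ _ (eps_cidem iota lam) : hecke F k -> H).

Definition cS : H := pr (hS F k).
Definition cU : H := pr (hU F k).
Definition cUinv : H := pr (hUinv F k).
Definition ceps (mu : torus_char F k) : H := pr (eps mu).
Definition cz2 : H := cU * cU.
Definition cz2inv : H := cUinv * cUinv.
Definition Yh : H := cS * cU.

(* The element X is defined differently for regular orbits, where X = U S and
   S ^ 2 = 0, and for non-regular ones, where X = U (S + 1) and S ^ 2 = - S. *)
Definition Xreg : H := cU * cS.
Definition Xnon : H := cU * (cS + 1).

Implicit Types M N : lmodType H.

(* j identifies N with the subspace A of H, transporting to A a structure of
   left H-module for which the elements of A act by multiplication *)
Definition on_subalgebra (A : H -> Prop) N (j : N -> H) : Prop :=
  [/\ {morph j : m n / m + n}, injective j,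
      forall a, A a <-> exists n, j n = a
    & forall a n, A a -> j (a *: n) = a * j n].

Definition linear_over (Z : H -> Prop) N (h : H) : Prop :=
  forall z (n : N), Z z -> h *: (z *: n) = z *: (h *: n).

(* An ordering (lam, s lam) of the orbit is given by the choice of lam. *)
Section Regular.
Local Notation e1 := (ceps lam).
Local Notation e2 := (ceps (swap_char lam)).
Definition inHV (a : coordV k) : H := pres_eval (valV Xreg Yh cz2 cz2inv) a.

Definition A_reg : H -> Prop :=
  generated_by [:: e1; e2; Xreg; Yh; cz2; cz2inv].

(* the elements a e1 + s(a) e2 of the center, mapped by theta_v to a(v) *)
Definition Z_elt_reg (a : coordV k) : H := inHV a * e1 + inHV (swapV a) * e2.
Definition Z_reg (z : H) : Prop := exists a, z = Z_elt_reg a.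
Definition ker_theta_reg v (z : H) : Prop :=
  exists2 a, z = Z_elt_reg a & atV v a = 0.

Definition spherical_action_reg N (j : N -> H) : Prop :=
  [/\ on_subalgebra A_reg j,
      linear_over Z_reg N cS /\ linear_over Z_reg N cU,
      forall n, j n = e1 -> j (cS *: n) = cz2inv * Yh * e2,
      forall n, j n = e2 -> j (cS *: n) = Yh * e1
    & (forall n, j n = e1 -> j (cU *: n) = e2) /\
      (forall n, j n = e2 -> j (cU *: n) = cz2 * e1)].

(* M is (isomorphic to) Sph(v) *)
Definition Sph_reg (v : k * k * k) M : Prop :=
  exists N (j : N -> H),
    spherical_action_reg j /\ is_quotient_by (ker_theta_reg v) N M.

Definition supersingular_reg M : Prop :=
  simple M /\
  exists theta : H -> k, central_character M theta /\ theta (Xreg + Yh) = 0.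
End Regular.

Section NonRegular.
Definition cz1 : H := Xnon + Yh.
Definition inHW (b : coordW k) : H := pres_eval (valW cz1 cz2 cz2inv) b.

Definition A_non : H -> Prop := generated_by [:: Xnon; Yh; cz2; cz2inv].

Definition Z_non (z : H) : Prop := exists b, z = inHW b.
Definition ker_theta_non v (z : H) : Prop := exists2 b, z = inHW b & atW v b = 0.

Definition spherical_action_non N (j : N -> H) : Prop :=
  [/\ on_subalgebra A_non j,
      linear_over Z_non N cS /\ linear_over Z_non N cU,
      forall n, j n = 1 -> j (cS *: n) = 0 /\ j (cU *: n) = cz1 - Yh
    & forall n, j n = Yh ->
        j (cS *: n) = - Yh /\ j (cU *: n) = (cz1 ^+ 2 - cz2) - cz1 * Yh].

Definition Sph_non (v : k * k) M : Prop :=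
  exists N (j : N -> H),
    spherical_action_non j /\ is_quotient_by (ker_theta_non v) N M.

Definition standard_module (a b : k) M : Prop :=
  exists m : M,
  [/\ is_kbasis (fun i : 'I_2 => if i == 0 then m else cU *: m),
      cS *: m = - m, cS *: (cU *: m) = a%:A *: m
    & cU *: (cU *: m) = b%:A *: m].

Definition supersingular_non M : Prop :=
  simple M /\ exists2 b : k, b != 0 & standard_module 0 b M.

(* Unordered pairs; isomorphic characters are equal as functions on H. *)
Definition char_pair (chi chi' : {lrmorphism H -> k^o}) : set (H -> k) :=
  [set (chi : H -> k); (chi' : H -> k)]%classic.

Definition spherical_pair (p : set (H -> k)) : Prop :=
  exists2 a : k, a != 0 &
  exists chi chi' : {lrmorphism H -> k^o},
    [/\ p = char_pair chi chi', chi cS = 0, chi cU = a,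
        chi' cS = -1 & chi' cU = - a].

Definition Sph1_non (v : k * k) (p : set (H -> k)) : Prop :=
  exists M L L' (chi chi' : {lrmorphism H -> k^o}),
    [/\ Sph_non v M, jordan_holder M [:: L; L'],
        affords L chi, affords L' chi' & p = char_pair chi chi'].
End NonRegular.
End Spherical.

(* Main.v *)
(** The spherical action identifies each component with matrices of size two over
    its coordinate ring, and Sph(v) is the module of columns of the specialization
    of these matrices at v.  On a simple finite dimensional module z2 and X + Y
    have eigenvectors, hence act by scalars; a vector fixed by e1 and killed by
    X or Y (regular case), or killed by S (non-regular case), then gives a basis
    in which the generators act by the matrices at a point, and this point is
    read off the scalars.  On the parabola the matrices become triangular.

    For the singular locus, the prime chains of k[X, Y, z2, 1/z2]/(XY) are bounded by
    hand.  Where T = X or Y is invertible the local ring is that of the plane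
    with coordinates T, z2, and generators of the maximal ideal are explicit.  At
    X = Y = 0 derivations into the residue field show that the maximal ideal
    needs more generators than the dimension. *)

From Pilot Require Import Defs.
From mathcomp Require Import all_boot all_order all_algebra all_fingroup all_field.
From HB Require Import structures.
From mathcomp Require Import boolp ring.

Import GRing.Theory.
Local Open Scope ring_scope.

Set Implicit Arguments.
Unset Strict Implicit.
Unset Printing Implicit Defensive.

(** * Algebras and modules *)

(** [Sph_reg] and [Sph_non] quantify over all realizations of the spherical module and of its
    quotient, so each needs existence and uniqueness. Both pass through [models]: a basis m1, m2
    over k in which the algebra acts by the matrices at v. The columns over the coordinate ring give
    existence, and every realization yields such a basis. The delicate point is independence in the
    quotient: a relation between the two vectors is a sum of multiples of central elements vanishing
    at v, and applying the matrices at v to this identity in the algebra shows that its coefficients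
    are zero. The same matrices, taken over the coordinate ring itself, embed that ring in the
    algebra, so no normal form of Hecke elements is computed.

    The singular and branch loci are subsets of the whole spectrum, so nonclosed points are treated
    too. At such a point of X = Y = 0 the local ring has dimension at most 1, and d/dX and d/dY
    alone already exceed it. The bound on chains rests on k being algebraically closed: a prime
    containing a nonzero polynomial in one variable contains a linear factor of it. *)

Lemma ord2 (i : 'I_2) : i = 0 \/ i = 1.
Proof. by case: i => -[|[|//]] hi; [left|right]; apply: val_inj. Qed.

(** * Two by two matrices as an algebra over k *)

Section Mx2.
Variables (k : fieldType) (R : comAlgType k).

(** An alias that carries the k-algebra structure obtained by restricting scalars along k -> R,
    beside the structure of R-algebra of the matrix type. *)
Definition mxalg := 'M[R]_2.
HB.instance Definition _ := GRing.NzRing.on mxalg.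

Definition mxalg_scale (c : k) (m : mxalg) : mxalg := (c%:A : R) *: (m : 'M[R]_2).

Fact mxalg_scaleA c d m : mxalg_scale c (mxalg_scale d m) = mxalg_scale (c * d) m.
Proof. by rewrite /mxalg_scale scalerA mulr_algl scalerA. Qed.
Fact mxalg_scale1 : left_id 1 mxalg_scale.
Proof. by move=> m; rewrite /mxalg_scale !scale1r. Qed.
Fact mxalg_scaleDr : right_distributive mxalg_scale +%R.
Proof. by move=> c m n; apply: scalerDr. Qed.
Fact mxalg_scaleDl m : {morph mxalg_scale^~ m : c d / c + d}.
Proof. by move=> c d; rewrite /mxalg_scale !scalerDl. Qed.
HB.instance Definition _ := GRing.Zmodule_isLmodule.Build k mxalg
  mxalg_scaleA mxalg_scale1 mxalg_scaleDr mxalg_scaleDl.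

Fact mxalg_scalerAl (c : k) (m n : mxalg) : c *: (m * n) = (c *: m) * n.
Proof. exact: (@scalerAl R 'M[R]_2). Qed.
HB.instance Definition _ := GRing.Lmodule_isLalgebra.Build k mxalg mxalg_scalerAl.
Fact mxalg_scalerAr (c : k) (m n : mxalg) : c *: (m * n) = m * (c *: n).
Proof. exact: (@scalerAr R 'M[R]_2). Qed.
HB.instance Definition _ := GRing.Lalgebra_isAlgebra.Build k mxalg mxalg_scalerAr.

Definition mx2 (a b c d : R) : mxalg :=
  \matrix_(i, j) if i == 0 then if j == 0 then a else b
                 else if j == 0 then c else d.

Lemma mx2P (m n : mxalg) :
  m 0 0 = n 0 0 -> m 0 1 = n 0 1 -> m 1 0 = n 1 0 -> m 1 1 = n 1 1 -> m = n.
Proof.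
move=> h00 h01 h10 h11; apply/matrixP => i j.
by case: (ord2 i) => ->; case: (ord2 j) => ->.
Qed.

Lemma mx2E00 a b c d : mx2 a b c d 0 0 = a. Proof. by rewrite mxE. Qed.
Lemma mx2E01 a b c d : mx2 a b c d 0 1 = b. Proof. by rewrite mxE. Qed.
Lemma mx2E10 a b c d : mx2 a b c d 1 0 = c. Proof. by rewrite mxE. Qed.
Lemma mx2E11 a b c d : mx2 a b c d 1 1 = d. Proof. by rewrite mxE. Qed.
Definition mx2E := (mx2E00, mx2E01, mx2E10, mx2E11).

Lemma mxalgME (m n : mxalg) i j : (m * n) i j = m i 0 * n 0 j + m i 1 * n 1 j.
Proof.
rewrite -[LHS]/((m *m n) i j) mxE big_ord_recl big_ord1.
by congr (_ + m i _ * n _ j); apply: val_inj.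
Qed.
Lemma mxalgDE (m n : mxalg) i j : (m + n) i j = m i j + n i j.
Proof. by rewrite -[LHS]/((m + n : 'M[R]_2) i j) mxE. Qed.
Lemma mxalgZE (c : k) (m : mxalg) i j : (c *: m) i j = c *: m i j.
Proof. by rewrite -[LHS]/(((c%:A : R) *: (m : 'M[R]_2)) i j) mxE mulr_algl. Qed.

Lemma mx2M a b c d a' b' c' d' :
  mx2 a b c d * mx2 a' b' c' d' =
  mx2 (a * a' + b * c') (a * b' + b * d') (c * a' + d * c') (c * b' + d * d').
Proof. by apply: mx2P; rewrite mxalgME !mx2E. Qed.
Lemma mx2D a b c d a' b' c' d' :
  mx2 a b c d + mx2 a' b' c' d' = mx2 (a + a') (b + b') (c + c') (d + d').
Proof. by apply: mx2P; rewrite mxalgDE !mx2E. Qed.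
Lemma mx2Z (x : k) a b c d :
  x *: mx2 a b c d = mx2 (x *: a) (x *: b) (x *: c) (x *: d).
Proof. by apply: mx2P; rewrite mxalgZE !mx2E. Qed.
Lemma mx2_1 : 1 = mx2 1 0 0 1.
Proof. by apply: mx2P; rewrite mx2E -[LHS]/((1%:M : 'M[R]_2) _ _) mxE. Qed.
Lemma mx2_0 : 0 = mx2 0 0 0 0.
Proof. by apply: mx2P; rewrite mx2E -[LHS]/((0 : 'M[R]_2) _ _) mxE. Qed.

Lemma mx2_inj a b c d a' b' c' d' : mx2 a b c d = mx2 a' b' c' d' ->
  [/\ a = a', b = b', c = c' & d = d'].
Proof.
move=> h; split.
- by have := congr1 (fun m : mxalg => m 0 0) h; rewrite !mx2E.
- by have := congr1 (fun m : mxalg => m 0 1) h; rewrite !mx2E.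
- by have := congr1 (fun m : mxalg => m 1 0) h; rewrite !mx2E.
- by have := congr1 (fun m : mxalg => m 1 1) h; rewrite !mx2E.
Qed.
End Mx2.

Section CommutingEvaluation.
Variables (k : fieldType) (G : Type) (A : algType k) (f : G -> A).
Hypothesis f_comm : forall g h, GRing.comm (f g) (f h).

Lemma expr_eval_comm_elt (x : A) : (forall g, GRing.comm x (f g)) ->
  forall a, GRing.comm x (expr_eval f a).
Proof.
move=> hx; elim=> [g|c|a ha b hb|a ha b hb] /=.
- exact: hx.
- by rewrite /GRing.comm mulr_algl mulr_algr.
- exact: commrD.
- exact: commrM.
Qed.

(** Lets a commutative presented ring be evaluated in a noncommutative algebra, such as a Hecke
    component or matrices: if the images of the generators commute pairwise, so do the values of all
    expressions. *)
Lemma com_rel_comm rel :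
  (forall a b, rel a b -> expr_eval f a = expr_eval f b) ->
  forall a b, com_rel rel a b -> expr_eval f a = expr_eval f b.
Proof.
move=> h _ _ [a b /h//|a b] /=.
apply: expr_eval_comm_elt => g; apply: commr_sym.
exact: expr_eval_comm_elt.
Qed.
End CommutingEvaluation.

Section EvaluationMorphisms.
Variable k : fieldType.

Definition respects (G : Type) (rel : expr k G -> expr k G -> Prop)
    (A : algType k) (f : G -> A) : Prop :=
  forall a b, rel a b -> expr_eval f a = expr_eval f b.

Lemma pres_eval_linear G (rel : expr k G -> expr k G -> Prop) (A : algType k)
  (f : G -> A) : respects rel f -> linear (pres_eval f : pres rel -> A).
Proof. by move=> h c u v; rewrite (pres_evalD h) (pres_evalZ h). Qed.

Lemma pres_eval_monoid G (rel : expr k G -> expr k G -> Prop) (A : algType k)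
  (f : G -> A) : respects rel f -> monoid_morphism (pres_eval f : pres rel -> A).
Proof. by move=> h; split=> [|u v]; rewrite ?(pres_eval1 h) ?(pres_evalM h). Qed.

(** The proof [h] is an argument so that the morphism instances can be attached to the term. *)
Definition evalV (A : algType k) (f : Defs.genV -> A)
  (h : respects (com_rel (@relV k)) f) (u : coordV k) : A := pres_eval f u.
HB.instance Definition _ (A : algType k) (f : Defs.genV -> A)
  (h : respects (com_rel (@relV k)) f) :=
  GRing.isLinear.Build k (coordV k) A *:%R (@evalV A f h) (pres_eval_linear h).
HB.instance Definition _ (A : algType k) (f : Defs.genV -> A)
  (h : respects (com_rel (@relV k)) f) :=
  GRing.isMonoidMorphism.Build (coordV k) A (@evalV A f h) (pres_eval_monoid h).

Definition evalW (A : algType k) (f : genW -> A)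
  (h : respects (com_rel (@relW k)) f) (u : coordW k) : A := pres_eval f u.
HB.instance Definition _ (A : algType k) (f : genW -> A)
  (h : respects (com_rel (@relW k)) f) :=
  GRing.isLinear.Build k (coordW k) A *:%R (@evalW A f h) (pres_eval_linear h).
HB.instance Definition _ (A : algType k) (f : genW -> A)
  (h : respects (com_rel (@relW k)) f) :=
  GRing.isMonoidMorphism.Build (coordW k) A (@evalW A f h) (pres_eval_monoid h).

Definition evalH (F : finFieldType) (A : algType k) (f : genH F -> A)
  (h : respects (@relH F k) f) (u : hecke F k) : A := pres_eval f u.
HB.instance Definition _ (F : finFieldType) (A : algType k) (f : genH F -> A)
  (h : respects (@relH F k) f) :=
  GRing.isLinear.Build k (hecke F k) A *:%R (@evalH F A f h) (pres_eval_linear h).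
HB.instance Definition _ (F : finFieldType) (A : algType k) (f : genH F -> A)
  (h : respects (@relH F k) f) :=
  GRing.isMonoidMorphism.Build (hecke F k) A (@evalH F A f h) (pres_eval_monoid h).

Lemma coordV_ind (P : coordV k -> Prop) :
  P cX -> P cY -> P (cZ k) -> P (cZinv k) -> (forall c : k, P c%:A) ->
  (forall a b, P a -> P b -> P (a + b)) ->
  (forall a b, P a -> P b -> P (a * b)) -> forall a, P a.
Proof.
move=> hX hY hZ hZ' hc hD hM; elim/pres_ind; elim=> [[]|c|a ha b hb|a ha b hb] //.
- by rewrite cls_cst; apply: hc.
- by rewrite cls_addE; apply: hD.
- by rewrite cls_mulE; apply: hM.
Qed.

Definition cW2inv : coordW k := cls (Gen gW2inv).

Lemma coordW_ind (P : coordW k -> Prop) :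
  P cW1 -> P cW2 -> P cW2inv -> (forall c : k, P c%:A) ->
  (forall a b, P a -> P b -> P (a + b)) ->
  (forall a b, P a -> P b -> P (a * b)) -> forall a, P a.
Proof.
move=> h1 h2 h2' hc hD hM; elim/pres_ind; elim=> [[]|c|a ha b hb|a ha b hb] //.
- by rewrite cls_cst; apply: hc.
- by rewrite cls_addE; apply: hD.
- by rewrite cls_mulE; apply: hM.
Qed.

Lemma cXY : cX * cY = 0 :> coordV k.
Proof.
rewrite /cX /cY -cls_mulE; apply: cls_eq.
exact/cong_rel/com_rel_rel/relV_XY.
Qed.
Lemma cZV : cZ k * cZinv k = 1.
Proof.
rewrite /cZ /cZinv -cls_mulE; apply: cls_eq.
exact/cong_rel/com_rel_rel/relV_Z.
Qed.
Lemma cW2V : cW2 * cW2inv = 1.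
Proof.
rewrite /cW2 /cW2inv -cls_mulE; apply: cls_eq.
exact/cong_rel/com_rel_rel/relW_Z.
Qed.
End EvaluationMorphisms.
Arguments cW2inv {k}.

(** * Modules from ring actions and from matrices *)

Section Action.
Variables (A : pzRingType) (V : zmodType).

(** A module structure as a term: [acted_on] is an alias of V indexed by it, so one group can carry
    several actions. *)
Record ring_action := RingAction {
  act :> A -> V -> V;
  actM : forall a b v, act a (act b v) = act (a * b) v;
  act1 : left_id 1 act;
  actDr : right_distributive act +%R;
  actDl : forall v, {morph act^~ v : a b / a + b} }.

Definition acted_on of ring_action : Type := V.
HB.instance Definition _ t := GRing.Zmodule.on (acted_on t).
HB.instance Definition _ (t : ring_action) := GRing.Zmodule_isLmodule.Build A (acted_on t)
  (@actM t) (@act1 t) (@actDr t) (@actDl t).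
End Action.

Section ColumnModule.
Variables (k : fieldType) (A : algType k) (R : comAlgType k).
Variable rho : {lrmorphism A -> mxalg R}.

Definition col_act (a : A) (v : R * R) : R * R :=
  (rho a 0 0 * v.1 + rho a 0 1 * v.2, rho a 1 0 * v.1 + rho a 1 1 * v.2).

Fact col_actM a b v : col_act a (col_act b v) = col_act (a * b) v.
Proof. by rewrite /col_act /= rmorphM !mxalgME; congr (_, _); ring. Qed.
Fact col_act1 : left_id 1 col_act.
Proof.
by move=> [u v]; rewrite /col_act rmorph1 mx2_1 !mx2E /=; congr (_, _); ring.
Qed.
Fact col_actDr : right_distributive col_act +%R.
Proof. by move=> a u v; rewrite /col_act /=; congr (_, _) => /=; ring. Qed.
Fact col_actDl v : {morph col_act^~ v : a b / a + b}.
Proof. by move=> a b; rewrite /col_act /= raddfD !mxalgDE; congr (_, _) => /=; ring. Qed.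

Definition column_action := RingAction col_actM col_act1 col_actDr col_actDl.
Definition column_module : lmodType A := acted_on column_action.

Lemma column_moduleE a (v : column_module) : a *: v = col_act a v.
Proof. by []. Qed.
End ColumnModule.

Definition mklinear (R : pzRingType) (M N : lmodType R) (f : M -> N)
    (h : linear f) : {linear M -> N} :=
  HB.pack f (GRing.isLinear.Build R M N *:%R f h).

Lemma addr_shuffle (V : nmodType) (a b c d e f : V) :
  a + b + (c + d) + (e + f) = a + c + e + (b + d + f).
Proof. by rewrite (addrACA a b) (addrACA _ _ e). Qed.

(** * Linear algebra over k inside a module *)

Section KModules.
Variables (k : fieldType) (A : algType k).
Implicit Types (M N : lmodType A) (c d : k).

Lemma kscaleC M c (a : A) (m : M) : c%:A *: (a *: m) = a *: (c%:A *: m).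
Proof. by rewrite !scalerA mulr_algl mulr_algr. Qed.
Lemma kscaleA M c d (m : M) : c%:A *: (d%:A *: m) = (c * d)%:A *: m.
Proof. by rewrite scalerA mulr_algl scalerA. Qed.
Lemma kscaleDl M c d (m : M) : (c + d)%:A *: m = c%:A *: m + d%:A *: m.
Proof. by rewrite !scalerDl. Qed.
Lemma kscaleN M c (m : M) : (- c)%:A *: m = - (c%:A *: m).
Proof. by rewrite !scaleNr. Qed.
Lemma kscale0 M (m : M) : (0 : k)%:A *: m = 0.
Proof. by rewrite !scale0r. Qed.
Lemma kscale1 M (m : M) : (1 : k)%:A *: m = m.
Proof. by rewrite !scale1r. Qed.
Lemma kscale_eq0 M c (m : M) : c != 0 -> c%:A *: m = 0 -> m = 0.
Proof.
move=> c0 h; rewrite -[m]kscale1 -(mulVf c0) -kscaleA h scaler0 //.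
Qed.

Lemma kscale_inj M c d (m : M) : m != 0 -> c%:A *: m = d%:A *: m -> c = d.
Proof.
move=> m0 h; apply/eqP; rewrite -subr_eq0; apply: contraNT m0 => n0.
by apply/eqP/(kscale_eq0 n0); rewrite kscaleDl kscaleN h subrr.
Qed.

Lemma isomorphic_sym M N : isomorphic M N -> isomorphic N M.
Proof.
move=> [f [g fK gK]].
have gl : linear g by move=> a u v; rewrite -{1}[u]gK -{1}[v]gK -linearP fK.
by exists (mklinear gl); exists f.
Qed.

Lemma isomorphic_trans M N L : isomorphic M N -> isomorphic N L -> isomorphic M L.
Proof.
move=> [f fb] [g gb].
have gl : linear (g \o f) by move=> a u v /=; rewrite !linearP.
by exists (mklinear gl); apply: bij_comp.
Qed.

(** The vectors satisfying P form a submodule, nonzero by the last hypothesis, hence all of M. *)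
Lemma simple_ind M (P : M -> Prop) : simple M -> P 0 ->
  (forall (a : A) u v, P u -> P v -> P (a *: u + v)) ->
  (exists2 m, m != 0 & P m) -> forall m, P m.
Proof.
move=> [_ sM] P0 Pl [m m0 Pm] n.
have cl : submod_closed [pred x | `[< P x >]].
  split=> [|a u v]; rewrite !inE; first exact/asboolP.
  by move=> /asboolP pu /asboolP pv; apply/asboolP/Pl.
case: (sM _ cl) => h; last by have := h n; rewrite !inE => /asboolP.
by case/eqP: m0; apply: h; rewrite inE; apply/asboolP.
Qed.

(** An eigenspace of a central element is a submodule. *)
Lemma schur_scalar M (z : A) c : simple M -> central z ->
  (exists2 m : M, m != 0 & z *: m = c%:A *: m) -> forall m : M, z *: m = c%:A *: m.
Proof.
move=> sM cz h; apply: simple_ind => // [|a u v hu hv]; first by rewrite !scaler0.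
by rewrite !scalerDr scalerA cz -scalerA hu hv kscaleC.
Qed.

Definition kspan2 M (m1 m2 : M) : Prop :=
  forall m, exists c d, m = c%:A *: m1 + d%:A *: m2.
Definition kfree2 M (m1 m2 : M) : Prop :=
  forall c d, c%:A *: m1 + d%:A *: m2 = 0 -> c = 0 /\ d = 0.
Definition pair2 (T : Type) (x y : T) (i : 'I_2) : T := if i == 0 then x else y.

Lemma sum2E (V : nmodType) (F : 'I_2 -> V) : \sum_i F i = F 0 + F 1.
Proof. by rewrite big_ord_recl big_ord1; congr (_ + F _); apply: val_inj. Qed.

Lemma kbasis2I M (m1 m2 : M) :
  kspan2 m1 m2 -> kfree2 m1 m2 -> is_kbasis (pair2 m1 m2).
Proof.
move=> hs hf m; have [c [d ->]] := hs m.
exists [ffun i => pair2 c d i]; split; first by rewrite sum2E !ffunE.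
move=> c'; rewrite sum2E /= => h; apply/ffunP => i.
have [h0 h1] : c' 0 - c = 0 /\ c' 1 - d = 0.
  apply: hf; rewrite !kscaleDl !kscaleN addrACA -h -opprD subrr //.
by rewrite ffunE; case: (ord2 i) => ->; rewrite /pair2 /=; apply/esym/eqP;
  rewrite -subr_eq0 ?h0 ?h1.
Qed.

Lemma kbasis2P M (m1 m2 : M) :
  is_kbasis (pair2 m1 m2) -> kspan2 m1 m2 /\ kfree2 m1 m2.
Proof.
move=> h; split=> [m|c d hcd].
  by have [c [-> _]] := h m; exists (c 0), (c 1); rewrite sum2E.
have [c' [_ hu]] := h 0.
have := hu [ffun i => pair2 c d i]; rewrite sum2E !ffunE => /(_ (esym hcd)) e1.
have := hu [ffun i => 0]; rewrite sum2E !ffunE !kscale0 addr0 => /(_ erefl) e2.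
move: e1; rewrite e2 => /ffunP e.
by have := e 0; have := e 1; rewrite !ffunE.
Qed.

Lemma simple_dim2N1 M : has_kdim M 2 -> forall m : M, ~ (forall n, exists c, n = c%:A *: m).
Proof.
move=> [b hb] m hm.
have e : b = pair2 (b 0) (b 1).
  by apply: functional_extensionality_dep => i; case: (ord2 i) => ->.
rewrite e in hb; have [_ hf] := kbasis2P hb.
have [c hc] := hm (b 0); have [d hd] := hm (b 1).
have [|d0 /eqP c0] := hf d (- c).
  by rewrite hc hd !kscaleA mulNr kscaleN mulrC subrr.
move: c0; rewrite oppr_eq0 => /eqP c0.
have [|/eqP] := hf 1 0; last by rewrite oner_eq0.
by rewrite hc c0 !kscale0 scaler0 addr0.
Qed.

Section Models.
Variable rho : {lrmorphism A -> mxalg k^o}.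

(** Column convention: the columns of [rho a] are the coordinates of the images of m1 and m2.
    Independence of m1 and m2 is not part of it, so the property passes to sums and products and can
    be checked on generators. *)
Definition acts_by M (m1 m2 : M) (a : A) : Prop :=
  a *: m1 = (rho a 0 0 : k)%:A *: m1 + (rho a 1 0 : k)%:A *: m2 /\
  a *: m2 = (rho a 0 1 : k)%:A *: m1 + (rho a 1 1 : k)%:A *: m2.

Lemma acts_by_cst M (m1 m2 : M) c : acts_by m1 m2 c%:A.
Proof.
rewrite /acts_by linearZ /= rmorph1 mx2_1 mx2Z !mx2E.
by rewrite ![_ *: (_ : k^o)]mulr1 ![_ *: (_ : k^o)]mulr0 !kscale0 addr0 add0r.
Qed.

Lemma acts_by_add M (m1 m2 : M) a b :
  acts_by m1 m2 a -> acts_by m1 m2 b -> acts_by m1 m2 (a + b).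
Proof.
move=> [ha1 ha2] [hb1 hb2]; rewrite /acts_by raddfD !mxalgDE.
by rewrite !kscaleDl !scalerDl ha1 ha2 hb1 hb2; split; rewrite addrACA.
Qed.

Lemma acts_by_mul M (m1 m2 : M) a b :
  acts_by m1 m2 a -> acts_by m1 m2 b -> acts_by m1 m2 (a * b).
Proof.
move=> [ha1 ha2] [hb1 hb2]; rewrite /acts_by rmorphM !mxalgME.
rewrite -!scalerA hb1 hb2 !scalerDr -!kscaleC ha1 ha2.
rewrite !scalerDr !kscaleA !kscaleDl.
by split; rewrite addrACA; congr (_ + _ + (_ + _)); rewrite mulrC.
Qed.

(** The common ground of all comparisons: Sph(v) and the simple modules are both shown to have such
    a basis, for the matrices at a point. *)
Definition models M (m1 m2 : M) : Prop :=
  [/\ kspan2 m1 m2, kfree2 m1 m2 & forall a, acts_by m1 m2 a].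

Lemma models_kbasis M (m1 m2 : M) : models m1 m2 -> has_kdim M 2.
Proof. by case=> h1 h2 _; exists (pair2 m1 m2); apply: kbasis2I. Qed.

(** The matrices make the span of m1 and m2 stable under A, so it is a nonzero submodule. *)
Lemma simple_kspan2 M (m1 m2 : M) : simple M -> m1 != 0 ->
  (forall a, acts_by m1 m2 a) -> kspan2 m1 m2.
Proof.
move=> sM m0 h; apply: simple_ind => //.
- by exists 0, 0; rewrite !kscale0 addr0.
- move=> a _ _ [c [d ->]] [c' [d' ->]]; have [h1 h2] := h a.
  exists (c * (rho a 0 0 : k) + d * (rho a 0 1 : k) + c').
  exists (c * (rho a 1 0 : k) + d * (rho a 1 1 : k) + d').
  rewrite !scalerDr -!kscaleC h1 h2 !scalerDr !kscaleA !kscaleDl.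
  exact: addr_shuffle.
- by exists m1 => //; exists 1, 0; rewrite kscale1 kscale0 addr0.
Qed.

Lemma models_iso M (m1 m2 : M) : models m1 m2 -> isomorphic (column_module rho) M.
Proof.
move=> [hs hf ha].
pose f (u : column_module rho) : M := u.1%:A *: m1 + u.2%:A *: m2.
have fl : linear f.
  move=> a u v; rewrite /f column_moduleE /col_act /=; have [h1 h2] := ha a.
  rewrite !scalerDr -!kscaleC h1 h2 !scalerDr !kscaleA !kscaleDl.
  rewrite ![_ * u.1]mulrC ![_ * u.2]mulrC.
  exact/esym/addr_shuffle.
have [g gK] : exists g : M -> column_module rho, cancel g f.
  have /choice[g hg] : forall m, exists u, f u = m.
    by move=> m; have [c [d ->]] := hs m; exists (c, d).
  by exists g.
exists (mklinear fl); exists g => // u.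
have h : f (g (f u) - u) = 0 by rewrite -[f]/(mklinear fl : _ -> _) linearB /= gK subrr.
by have [h1 h2] := hf _ _ h; apply/eqP; rewrite -subr_eq0; apply/eqP; apply/pair_equal_spec.
Qed.
End Models.
End KModules.

Lemma finite_dimensional_eigenvector (k : closedFieldType) (A : algType k)
    (M : lmodType A) (a : A) : finite_dimensional M -> (exists m : M, m != 0) ->
  exists c : k, exists2 m : M, m != 0 & a *: m = c%:A *: m.
Proof.
move=> [n [b hb]] [m m0].
have /choice[Z hZ] : forall i, exists c : {ffun 'I_n -> k},
    a *: b i = \sum_j (c j)%:A *: b j.
  by move=> i; have [c [hc _]] := hb (a *: b i); exists c.
(* Row i holds the coordinates of a b_i, so a left eigenvector of g, which is what [eigenvalue]
   provides, lists the coordinates of an eigenvector of a. *)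
pose g : 'M[k]_n := \matrix_(i, j) Z i j.
have n_gt0 : (0 < n)%N.
  case: n b hb {Z hZ g} => // b hb; have [c [hm _]] := hb m.
  by rewrite big_ord0 in hm; rewrite hm eqxx in m0.
have /closed_rootP[c hc] : size (char_poly g) != 1.
  by rewrite size_char_poly eqSS -lt0n.
rewrite -eigenvalue_root_char in hc; have /eigenvalueP[v hv v0] := hc.
exists c; exists (\sum_i (v 0 i)%:A *: b i).
  apply: contraNneq v0 => h0; have [c' [_ hu]] := hb 0.
  have e1 := hu [ffun i => v 0 i]; have e2 := hu [ffun i => 0].
  apply/eqP/rowP => i; rewrite mxE.
  have : [ffun i => v 0 i] = [ffun i => 0] :> {ffun 'I_n -> k}.
    rewrite -e1 ?e2 //.
      by rewrite big1 // => j _; rewrite ffunE kscale0.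
    by rewrite -[LHS]h0; apply: eq_bigr => j _; rewrite ffunE.
  by move/ffunP => /(_ i); rewrite !ffunE.
rewrite !scaler_sumr.
transitivity (\sum_j \sum_i (v 0 i * Z i j)%:A *: b j).
  rewrite exchange_big; apply: eq_bigr => i _.
  rewrite -kscaleC hZ scaler_sumr; apply: eq_bigr => j _.
  by rewrite kscaleA.
apply: eq_bigr => j _; rewrite kscaleA.
move/rowP: hv => /(_ j); rewrite !mxE => <-.
by rewrite !scaler_suml; apply: eq_bigr => i _; rewrite mxE.
Qed.

(** * Components of the Hecke algebra *)

Section CornerProjection.
Variables (k : comNzRingType) (A : algType k) (e : cidem A).

Fact cproj_linear : linear (@cproj k A e).
Proof. by move=> c a b; apply: val_inj; rewrite /= mulrDl scalerAl. Qed.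
HB.instance Definition _ :=
  GRing.isLinear.Build k A (corner e) *:%R (@cproj k A e) cproj_linear.

Fact cproj_monoid : monoid_morphism (@cproj k A e).
Proof.
split=> // a b; apply: val_inj; rewrite [RHS]cval_mul /=.
by rewrite -!mulrA; congr (a * _); rewrite mulrA idem_central -mulrA idem_idem.
Qed.
HB.instance Definition _ :=
  GRing.isMonoidMorphism.Build A (corner e) (@cproj k A e) cproj_monoid.

Lemma cprojZ c a : cproj e (c *: a) = c *: cproj e a.
Proof. by apply: val_inj; rewrite /= scalerAl. Qed.

Lemma cvalK : cancel (@cval k A e) (@cproj k A e).
Proof. by move=> x; apply: val_inj; apply: cvalP. Qed.

Section CornerMorphism.
Variables (B : algType k) (phi : {lrmorphism A -> B}).
Hypothesis phi1 : phi (idem e) = 1.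

(** The unit of the corner is the idempotent, so the restriction of phi is unital because phi sends
    it to 1; this proof is an argument to which the morphism instances are attached. *)
Definition corner_map of phi (idem e) = 1 := fun x : corner e => phi (cval x).

Fact corner_map_linear : linear (corner_map phi1).
Proof. by move=> c x y; rewrite /corner_map /= linearP. Qed.
HB.instance Definition _ :=
  GRing.isLinear.Build k (corner e) B *:%R (corner_map phi1) corner_map_linear.
Fact corner_map_monoid : monoid_morphism (corner_map phi1).
Proof.
rewrite /corner_map; split=> [|x y]; first by rewrite cval_one.
by rewrite cval_mul rmorphM.
Qed.
HB.instance Definition _ :=
  GRing.isMonoidMorphism.Build (corner e) B (corner_map phi1) corner_map_monoid.

Lemma corner_mapE a : corner_map phi1 (cproj e a) = phi a.
Proof. by rewrite -[RHS]mulr1 -phi1 -rmorphM. Qed.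
End CornerMorphism.
End CornerProjection.

(** * Character sums over the torus *)

Section TorusSums.
Variables (F : finFieldType) (k : fieldType) (iota : {rmorphism F -> k}).
Implicit Types lam : torus_char F k.

Lemma unit_mulC (a b : {unit F}) : (a * b)%g = (b * a)%g.
Proof. by apply: val_inj; apply: mulrC. Qed.

(** Regularity makes a -> lam(a, 1/a) a nontrivial character, whose sum vanishes by translation.
    Hence c_s acts by 0 on a regular component, and S^2 = 0 there. *)
Lemma torus_sum_regular lam : swap_char lam != lam ->
  \sum_(a : {unit F}) lam (a, a^-1)%g = 0.
Proof.
move=> nl.
have [[a b] hab] : exists t, lam (swap t) != lam t.
  apply/existsP; apply: contraR nl; rewrite negb_exists => /forallP h.
  apply/eqP/val_inj/ffunP => t; rewrite swap_charE.
  by apply/eqP; rewrite -[_ == _]negbK; apply: h.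
(* With c = a/b one has (a, b) = (c, 1/c) (b, a), so lam(c, 1/c) differs from 1 as soon as lam
   separates (a, b) from (b, a). *)
set S := \sum__ _; pose c := (a * b^-1)%g.
have hc : lam (c, c^-1)%g != 1.
  apply: contraNneq hab => h.
  have E : ((a, b) = (c, c^-1) * swap (a, b))%g.
    by congr (_, _); rewrite /= /c ?mulgKV // invMg invgK mulgKV.
  by rewrite {2}E torus_charM h mul1r.
have hS : S = lam (c, c^-1)%g * S.
  rewrite {1}/S (reindex_inj (mulgI c)) big_distrr /=; apply: eq_bigr => u _.
  rewrite -torus_charM; congr (lam (_, _)); rewrite invMg; exact: unit_mulC.
have /eqP : (1 - lam (c, c^-1)%g) * S = 0 by rewrite mulrBl mul1r -hS subrr.
by rewrite mulf_eq0 subr_eq0 eq_sym (negPf hc) => /eqP.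
Qed.

(** There are q - 1 units, and q = 0 in k because [iota] gives k the characteristic of F. *)
Lemma natr_card_unit : (#|{: {unit F}}|%:R : k) = -1.
Proof.
have [p pp cF] := finPcharP F.
have hq : (#|F|%:R : k) = 0.
  have cFE : #|F| = (p ^ logn p #|F|)%N by apply: (card_pprimeChar cF).
  move: cFE (finNzRing_gt1 F); move: (logn _ _) => [|n] cardF gt1.
    by rewrite cardF expn0 in gt1.
  by rewrite -(rmorph_nat iota) cardF natrX (pcharf0 cF) expr0n rmorph0.
apply/eqP; rewrite -subr_eq0 opprK -cardsT card_finField_unit natr1.
by rewrite prednK ?hq //; apply: ltnW; apply: finNzRing_gt1.
Qed.

(** Symmetry gives lam(a, 1/a) = lam(a, 1) lam(1/a, 1) = 1, so the sum is q - 1. Hence c_s acts by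
    -1 and S^2 = -S. *)
Lemma torus_sum_nonregular lam : swap_char lam = lam ->
  \sum_(a : {unit F}) lam (a, a^-1)%g = -1.
Proof.
move=> sl; rewrite -natr_card_unit -sum1_card natr_sum; apply: eq_bigr => a _.
have -> : ((a, a^-1) = (a, 1) * (1, a^-1) :> torus F)%g.
  by congr (_, _); rewrite /= ?mulg1 ?mul1g.
rewrite torus_charM -{2}sl swap_charE -torus_charM.
by rewrite -(torus_char1 lam); congr (lam (_, _)); rewrite /= ?mulgV ?mulg1.
Qed.
End TorusSums.

Section HeckeComponentTheory.
Variables (F : finFieldType) (k : fieldType) (iota : {rmorphism F -> k}).
Variable lam : torus_char F k.
Local Notation T := (torus F).
Local Notation H := (hecke_comp iota lam).
Local Notation e := (eps_cidem iota lam).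
Local Notation pr := (@cproj k (hecke F k) e).
Local Notation S := (cS iota lam).
Local Notation U := (cU iota lam).
Local Notation U' := (cUinv iota lam).

Definition cT (t : T) : H := pr (hT k t).

Lemma hecke_comp_ind (P : H -> Prop) :
  (forall t, P (cT t)) -> P S -> P U -> P U' ->
  (forall c : k, P c%:A) -> (forall a b, P a -> P b -> P (a + b)) ->
  (forall a b, P a -> P b -> P (a * b)) -> forall a, P a.
Proof.
move=> hT hS hU hU' hc hD hM a; rewrite -[a]cvalK.
elim/pres_ind: (cval a); elim=> [[t|||]|c|b hb d hd|b hb d hd] //.
- exact: hT.
- by rewrite cls_cst linearZ rmorph1; apply: hc.
- by rewrite cls_addE raddfD; apply: hD.
- by rewrite cls_mulE rmorphM; apply: hM.
Qed.

Section Representation.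
Variables (B : algType k) (f : genH F -> B).
Hypothesis f_rel : respects (@relH F k) f.
Hypothesis f1 : evalH f_rel (eps_orbit lam) = 1.

Definition hecke_comp_rep : {lrmorphism H -> B} := @corner_map _ _ e _ (evalH f_rel) f1.

Lemma hecke_comp_repE g : hecke_comp_rep (pr (cls (Gen g))) = f g.
Proof. by apply: etrans (corner_mapE _ _) _; apply: pres_eval_gen. Qed.
End Representation.

Lemma hT_eps_scale t (mu : torus_char F k) : hT k t * eps mu = mu t *: eps mu.
Proof.
rewrite /eps -scalerAr scalerA mulrC -scalerA; congr (_ *: _).
rewrite big_distrr scaler_sumr [RHS](reindex_inj (mulgI t)); apply: eq_bigr => u _ /=.
rewrite -scalerAr -hTM scalerA torus_charM invfM mulrA mulfV ?mul1r //.
exact: torus_char_neq0.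
Qed.

Lemma cls_cs : cls (cs_expr F k) = \sum_(a : {unit F}) hT k (a, a^-1)%g.
Proof.
rewrite /cs_expr -big_enum /=; elim: (enum _) => [|a s ih] /=.
  by rewrite big_nil.
by rewrite cls_addE ih big_cons.
Qed.

Lemma expr_eval_cs (B : algType k) (f : genH F -> B) :
  expr_eval f (cs_expr F k) = \sum_(a : {unit F}) f (gT (a, a^-1)%g).
Proof.
rewrite /cs_expr -big_enum /=; elim: (enum _) => [|a s ih] /=.
  by rewrite big_nil scale0r.
by rewrite ih big_cons.
Qed.

Lemma cs_eps (mu : torus_char F k) : cls (cs_expr F k) * eps mu =
  (\sum_(a : {unit F}) mu (a, a^-1)%g) *: eps mu :> hecke F k.
Proof.
rewrite cls_cs big_distrl scaler_suml; apply: eq_bigr => a _.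
exact: hT_eps_scale.
Qed.

Lemma hSS : hS F k * hS F k = cls (cs_expr F k) * hS F k.
Proof. by rewrite -!cls_mulE; apply/cls_eq/cong_rel/relH_SS. Qed.
Lemma hUUS : hU F k * hU F k * hS F k = hS F k * (hU F k * hU F k).
Proof. by have := cls_eq (cong_rel (@relH_UUS F k)); rewrite !cls_mulE. Qed.

Lemma cUV : U * U' = 1.
Proof. by rewrite /cU /cUinv -rmorphM hUV rmorph1. Qed.
Lemma cVU : U' * U = 1.
Proof. by rewrite /cU /cUinv -rmorphM hVU rmorph1. Qed.
Lemma cUUS : U * U * S = S * (U * U).
Proof. by have := congr1 pr hUUS; rewrite !rmorphM. Qed.
Lemma cz2V : cz2 iota lam * cz2inv iota lam = 1.
Proof. by rewrite /cz2 /cz2inv mulrA -(mulrA U U U') cUV mulr1 cUV. Qed.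
Lemma cz2VV : cz2inv iota lam * cz2 iota lam = 1.
Proof. by rewrite /cz2 /cz2inv mulrA -(mulrA U' U' U) cVU mulr1 cVU. Qed.

Lemma comp1E : (1 : H) = pr (eps_orbit lam).
Proof. by apply: val_inj; rewrite /= mul1r eps_orbit_idem. Qed.

Lemma cUT t : U * cT t = cT (swap t) * U.
Proof. by rewrite /cT /cU -!rmorphM hUT. Qed.

Lemma cz2_central : central (cz2 iota lam).
Proof.
rewrite /central /cz2; apply: hecke_comp_ind => [t||||c|a b ha hb|a b ha hb].
- by rewrite -mulrA cUT mulrA cUT swapK mulrA.
- exact: cUUS.
- by rewrite mulrA.
- by rewrite -mulrA cUV mulr1 mulrA cVU mul1r.
- by rewrite mulr_algl mulr_algr.
- by rewrite mulrDl mulrDr ha hb.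
- by rewrite mulrA ha -mulrA hb mulrA.
Qed.
End HeckeComponentTheory.

Lemma comm_inv (R : pzRingType) (x x' a : R) :
  x' * x = 1 -> x * x' = 1 -> x * a = a * x -> x' * a = a * x'.
Proof.
move=> h h' c; rewrite -[LHS]mulr1 -h' -mulrA [a * _]mulrA -c -mulrA mulrA h.
by rewrite mul1r.
Qed.

Lemma orth_idem_mul (R : pzRingType) (e f a b c d : R) :
  e * e = e -> f * f = f -> e * f = 0 -> f * e = 0 ->
  c * e = e * c -> d * f = f * d ->
  (a * e + b * f) * (c * e + d * f) = a * c * e + b * d * f.
Proof.
move=> ee ff ef fe ce df; rewrite mulrDl !mulrDr ce df -!mulrA.
rewrite [e * (f * _)]mulrA [f * (e * _)]mulrA ef fe !mul0r !mulr0 addr0 add0r.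
by rewrite [e * (e * _)]mulrA [f * (f * _)]mulrA ee ff -ce -df.
Qed.

Lemma mx2_sum (k : fieldType) (R : comAlgType k) (I : Type) (r : seq I)
    (a b c d : I -> R) :
  \sum_(i <- r) mx2 (a i) (b i) (c i) (d i) =
  mx2 (\sum_(i <- r) a i) (\sum_(i <- r) b i) (\sum_(i <- r) c i) (\sum_(i <- r) d i).
Proof.
elim: r => [|i r ih]; first by rewrite !big_nil mx2_0.
by rewrite !big_cons ih mx2D.
Qed.

(** * Regular orbits *)

Section CoordinateMorphisms.
Variable k : fieldType.

Fact swapVP : respects (com_rel (@relV k))
  (valV cY cX (cZ k) (cZinv k)).
Proof. by apply: valVP; rewrite ?cZV // mulrC cXY. Qed.
(* Morphisms are hidden behind opaque sigma types: otherwise simplification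
   unfolds them to pres_eval and the morphism lemmas no longer apply. *)
Lemma swapVm_subproof : {f : {lrmorphism coordV k -> coordV k} | f =1 @swapV k}.
Proof. by exists (evalV swapVP). Qed.
Definition swapVm := sval swapVm_subproof.
Lemma swapVmE : swapVm =1 @swapV k. Proof. exact: (svalP swapVm_subproof). Qed.

Lemma lrmorphV_eq (A : algType k) (f g : {lrmorphism coordV k -> A}) :
  f cX = g cX -> f cY = g cY -> f (cZ k) = g (cZ k) ->
  f (cZinv k) = g (cZinv k) -> f =1 g.
Proof.
move=> hX hY hZ hZ'; apply: coordV_ind => // [c|a b ha hb|a b ha hb].
- by rewrite !linearZ /= !rmorph1.
- by rewrite !raddfD /= ha hb.
- by rewrite !rmorphM /= ha hb.
Qed.

Lemma swapVE : (swapVm cX = cY) * (swapVm cY = cX) *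
  (swapVm (cZ k) = cZ k) * (swapVm (cZinv k) = cZinv k).
Proof. by rewrite !swapVmE; do !split; apply: (pres_eval_gen swapVP). Qed.

Lemma swapVK : involutive swapVm.
Proof.
move=> a; apply: (lrmorphV_eq (f := swapVm \o swapVm) (g := idfun)) => /=;
  by rewrite !swapVE.
Qed.

Section At.
Variables (v : k * k * k) (hv : ptsV v).
Fact atVP : respects (com_rel (@relV k)) (@valV k k^o v.1.1 v.1.2 v.2 v.2^-1).
Proof. by apply: valVP; case: hv => // _ h; rewrite mulfV. Qed.
Lemma atVm_subproof : {f : {lrmorphism coordV k -> k^o} | f =1 atV v}.
Proof. by exists (evalV atVP). Qed.
Definition atVm := sval atVm_subproof.
Lemma atVmE : atVm =1 atV v. Proof. exact: (svalP atVm_subproof). Qed.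

Lemma atVE : (atVm cX = v.1.1) * (atVm cY = v.1.2) * (atVm (cZ k) = v.2) *
  (atVm (cZinv k) = v.2^-1).
Proof. by rewrite !atVmE; do !split; apply: (pres_eval_gen atVP). Qed.
End At.

End CoordinateMorphisms.
Arguments swapVm {k}.
Arguments atVm {k v}.

Section RegularComponent.
Variables (F : finFieldType) (k : fieldType) (iota : {rmorphism F -> k}).
Variable lam : torus_char F k.
Hypothesis nl : swap_char lam != lam.
Local Notation H := (hecke_comp iota lam).
Local Notation e := (eps_cidem iota lam).
Local Notation pr := (@cproj k (hecke F k) e).
Local Notation S := (cS iota lam).
Local Notation U := (cU iota lam).
Local Notation U' := (cUinv iota lam).
Local Notation z := (cz2 iota lam).
Local Notation z' := (cz2inv iota lam).
Local Notation X := (Xreg iota lam).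
Local Notation Y := (Yh iota lam).
Local Notation e1 := (ceps iota lam lam).
Local Notation e2 := (ceps iota lam (swap_char lam)).

Lemma eps12 : e1 + e2 = 1.
Proof. by rewrite comp1E eps_orbitE (negPf nl) raddfD. Qed.
Lemma e11 : e1 * e1 = e1.
Proof. by rewrite /ceps -rmorphM (eps_mul iota) eqxx. Qed.
Lemma e22 : e2 * e2 = e2.
Proof. by rewrite /ceps -rmorphM (eps_mul iota) eqxx. Qed.
Lemma e12 : e1 * e2 = 0.
Proof. by rewrite /ceps -rmorphM (eps_mul iota) eq_sym (negPf nl) raddf0. Qed.
Lemma e21 : e2 * e1 = 0.
Proof. by rewrite /ceps -rmorphM (eps_mul iota) (negPf nl) raddf0. Qed.
Definition eE := (e11, e22, e12, e21).

Lemma Se1 : S * e1 = e2 * S.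
Proof. by rewrite /ceps -!rmorphM (swap_eps _ (@hST F k)). Qed.
Lemma Se2 : S * e2 = e1 * S.
Proof. by rewrite /ceps -!rmorphM (swap_eps _ (@hST F k)) swap_charK. Qed.
Lemma Ue1 : U * e1 = e2 * U.
Proof. by rewrite /ceps -!rmorphM (swap_eps _ (@hUT F k)). Qed.
Lemma Ue2 : U * e2 = e1 * U.
Proof. by rewrite /ceps -!rmorphM (swap_eps _ (@hUT F k)) swap_charK. Qed.

Lemma cTE t : cT iota lam t = lam t *: e1 + lam (swap t) *: e2.
Proof.
rewrite -[LHS]mulr1 -eps12 mulrDr /cT /ceps -!rmorphM !hT_eps_scale.
by rewrite swap_charE; congr (_ + _); apply: cprojZ.
Qed.

Lemma cSS : S * S = 0.
Proof.
have -> : S * S = pr (cls (cs_expr F k)) * S.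
  by have := congr1 pr (@hSS F k); rewrite !rmorphM.
have h mu : swap_char mu != mu -> pr (cls (cs_expr F k)) * ceps iota lam mu = 0.
  by move=> hmu; rewrite /ceps -rmorphM cs_eps torus_sum_regular // scale0r raddf0.
rewrite -[pr (cls _)]mulr1 -eps12 mulrDr !h ?addr0 ?mul0r //.
by rewrite swap_charK eq_sym.
Qed.

(** On a regular component T_t is lam(t) e1 + lam(s t) e2, so the two idempotents replace the torus
    among the generators. *)
Lemma reg_ind (P : H -> Prop) :
  P e1 -> P e2 -> P S -> P U -> P U' ->
  (forall c : k, P c%:A) -> (forall a b, P a -> P b -> P (a + b)) ->
  (forall a b, P a -> P b -> P (a * b)) -> forall a, P a.
Proof.
move=> h1 h2 hS hU hU' hc hD hM; apply: hecke_comp_ind => // t.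
have hZ (c : k) a : P a -> P (c *: a) by rewrite -mulr_algl; apply: hM.
by rewrite cTE; apply: hD; apply: hZ.
Qed.

Lemma XY0 : X * Y = 0.
Proof. by rewrite /Xreg /Yh mulrA -(mulrA U) cSS mulr0 mul0r. Qed.
Lemma YX0 : Y * X = 0.
Proof. by rewrite /Xreg /Yh mulrA -(mulrA S) -cUUS -[_ * S]mulrA cSS mulr0. Qed.
Lemma Xe1 : X * e1 = e1 * X.
Proof. by rewrite /Xreg -mulrA Se1 mulrA Ue2 mulrA. Qed.
Lemma Xe2 : X * e2 = e2 * X.
Proof. by rewrite /Xreg -mulrA Se2 mulrA Ue1 mulrA. Qed.
Lemma Ye1 : Y * e1 = e1 * Y.
Proof. by rewrite /Yh -mulrA Ue1 mulrA Se2 mulrA. Qed.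
Lemma Ye2 : Y * e2 = e2 * Y.
Proof. by rewrite /Yh -mulrA Ue2 mulrA Se1 mulrA. Qed.

Lemma cz2inv_central : central z'.
Proof.
by move=> a; apply: comm_inv (cz2VV _ _) (cz2V _ _) (cz2_central _).
Qed.

Lemma XY_central : central (X + Y).
Proof.
have hS : (X + Y) * S = S * (X + Y).
  rewrite /Xreg /Yh mulrDl mulrDr -mulrA cSS mulr0 add0r.
  by rewrite [S * (S * U)]mulrA cSS mul0r addr0 mulrA.
have hU : (X + Y) * U = U * (X + Y).
  rewrite /Xreg /Yh mulrDl mulrDr -[S * U * U]mulrA -cUUS addrC.
  by rewrite !mulrA.
rewrite /central; apply: reg_ind => // [|||c|a b ha hb|a b ha hb].
- by rewrite mulrDl mulrDr Xe1 Ye1.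
- by rewrite mulrDl mulrDr Xe2 Ye2.
- exact/esym/(comm_inv (cVU _ _) (cUV _ _))/esym.
- by rewrite mulr_algl mulr_algr.
- by rewrite mulrDr ha hb mulrDl.
- by rewrite mulrA ha -mulrA hb mulrA.
Qed.

Lemma inHVP : respects (com_rel (@relV k)) (valV X Y z z').
Proof.
apply: com_rel_comm; last first.
  move=> _ _ [] /=; first by rewrite XY0 scale0r.
  by rewrite cz2V scale1r.
have hXY : GRing.comm X Y by rewrite /GRing.comm XY0 YX0.
case; case => //=; rewrite /GRing.comm;
  try exact: cz2_central; try exact: cz2inv_central;
  try (by rewrite cz2_central); try (by rewrite cz2inv_central).
Qed.
Lemma inHVm_subproof : {f : {lrmorphism coordV k -> H} | f =1 @inHV _ _ iota lam}.
Proof. by exists (evalV inHVP). Qed.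
Definition inHVm := sval inHVm_subproof.
Lemma inHVmK : inHVm =1 @inHV _ _ iota lam.
Proof. exact: (svalP inHVm_subproof). Qed.

Lemma inHVmE : (inHVm cX = X) * (inHVm cY = Y) * (inHVm (cZ k) = z) *
  (inHVm (cZinv k) = z').
Proof. by rewrite !inHVmK; do !split; apply: (pres_eval_gen inHVP). Qed.

Lemma inHV_e (a : coordV k) :
  inHVm a * e1 = e1 * inHVm a /\ inHVm a * e2 = e2 * inHVm a.
Proof.
elim/coordV_ind: a => [||||c|a b [ha1 ha2] [hb1 hb2]|a b [ha1 ha2] [hb1 hb2]].
- by rewrite !inHVmE Xe1 Xe2.
- by rewrite !inHVmE Ye1 Ye2.
- by rewrite !inHVmE !cz2_central.
- by rewrite !inHVmE !cz2inv_central.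
- by rewrite linearZ rmorph1 /= !mulr_algl !mulr_algr.
- by rewrite raddfD /= !mulrDl !mulrDr ha1 ha2 hb1 hb2.
- by rewrite rmorphM /= -!mulrA hb1 hb2 !mulrA ha1 ha2.
Qed.

(* The swap turns the central elements into the diagonal pairs (a, a). *)
Definition A_reg_elt (n : coordV k * coordV k) : H :=
  inHVm n.1 * e1 + inHVm (swapVm n.2) * e2.
Local Notation inA := A_reg_elt.

Lemma Z_elt_regE a : Z_elt_reg iota lam a = A_reg_elt (a, a).
Proof. by rewrite /A_reg_elt !inHVmK swapVmE. Qed.

Lemma inAD m n : inA (m + n) = inA m + inA n.
Proof. by rewrite /A_reg_elt /= !raddfD /= !mulrDl addrACA. Qed.
Lemma inAM m n : inA (m.1 * n.1, m.2 * n.2) = inA m * inA n.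
Proof.
rewrite /A_reg_elt /= !rmorphM /= orth_idem_mul ?eE //.
  exact: (inHV_e _).1.
exact: (inHV_e _).2.
Qed.

Section Representation.
Variables (R : comAlgType k) (psi : {lrmorphism coordV k -> R}).

(* The spherical action on A in its basis e1, e2 over the center. *)
Definition reg_gen (g : genH F) : mxalg R :=
  match g with
  | gT t => mx2 (lam t)%:A 0 0 (lam (swap t))%:A
  | gS => mx2 0 (psi cY) (psi (cZinv k) * psi cX) 0
  | gU => mx2 0 (psi (cZ k)) 1 0
  | gUinv => mx2 0 1 (psi (cZinv k)) 0
  end.

Let xy0 : psi cX * psi cY = 0. Proof. by rewrite -rmorphM cXY rmorph0. Qed.
Let zz1 : psi (cZ k) * psi (cZinv k) = 1.
Proof. by rewrite -rmorphM cZV rmorph1. Qed.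

Lemma sum_unit_char (mu : torus_char F k) : swap_char mu != mu ->
  \sum_(a : {unit F}) (mu (a, a^-1)%g)%:A = 0 :> R.
Proof. by move=> h; rewrite -scaler_suml torus_sum_regular // scale0r. Qed.

Fact reg_gen_respects : respects (@relH F k) reg_gen.
Proof.
move=> _ _ [t u||t|t||||] /=.
- by rewrite mx2M swapM !torus_charM; congr mx2;
    rewrite ?mulr0 ?mul0r ?addr0 ?add0r // mulr_algl scalerA.
- by rewrite !torus_char1 !scale1r mx2_1.
- by rewrite !mx2M swapK; congr mx2; rewrite ?mulr0 ?mul0r ?addr0 ?add0r // mulrC.
- by rewrite !mx2M swapK; congr mx2; rewrite ?mulr0 ?mul0r ?addr0 ?add0r // mulrC.
- by rewrite mx2M scale1r mx2_1; congr mx2;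
    rewrite ?mulr0 ?mul0r ?addr0 ?add0r ?mulr1 ?mul1r.
- by rewrite mx2M scale1r mx2_1; congr mx2;
    rewrite ?mulr0 ?mul0r ?addr0 ?add0r ?mulr1 ?mul1r // mulrC.
- by rewrite !mx2M; congr mx2; ring.
- rewrite expr_eval_cs /= mx2_sum (sum_unit_char nl).
  have -> : \sum_(a : {unit F}) (lam (swap (a, a^-1)%g))%:A = 0 :> R.
    have h : swap_char (swap_char lam) != swap_char lam by rewrite swap_charK eq_sym.
    by rewrite -[RHS](sum_unit_char h); apply: eq_bigr => a _; rewrite swap_charE.
  rewrite !mx2M !big1 //; congr mx2; rewrite ?mulr0 ?mul0r ?addr0 ?add0r //.
    by rewrite mulrCA [psi cY * _]mulrC xy0 mulr0.
  by rewrite -mulrA xy0 mulr0.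
Qed.

Lemma reg_gen_eps mu : evalH reg_gen_respects (eps mu) =
  mx2 (mu == lam)%:R 0 0 (mu == swap_char lam)%:R.
Proof.
rewrite /eps linearZ linear_sum /=.
under eq_bigr => t _ do rewrite linearZ /= /evalH (pres_eval_gen reg_gen_respects)
  /= mx2Z !scaler0 !scalerA -swap_charE.
rewrite mx2_sum mx2Z -!scaler_suml !char_orth !big1 // !scaler0.
have hN := card_torus_neq0 iota.
by congr mx2; rewrite scalerA; case: eqP => _;
  rewrite ?mulVf ?mulr0 ?scale1r ?scale0r.
Qed.

Fact reg_gen_unit : evalH reg_gen_respects (eps_orbit lam) = 1.
Proof.
rewrite eps_orbitE (negPf nl) raddfD /= !reg_gen_eps mx2D mx2_1 !eqxx.
by rewrite [lam == _]eq_sym (negPf nl) !addr0 add0r.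
Qed.

Lemma reg_rep_subproof : {rho : {lrmorphism H -> mxalg R} |
  [/\ rho S = mx2 0 (psi cY) (psi (cZinv k) * psi cX) 0,
      rho U = mx2 0 (psi (cZ k)) 1 0, rho U' = mx2 0 1 (psi (cZinv k)) 0,
      rho e1 = mx2 1 0 0 0 & rho e2 = mx2 0 0 0 1]}.
Proof.
exists (hecke_comp_rep iota reg_gen_unit); split; try exact: hecke_comp_repE.
- apply: etrans (corner_mapE _ _) _; apply: etrans (reg_gen_eps _) _.
  by rewrite eqxx eq_sym (negPf nl).
- apply: etrans (corner_mapE _ _) _; apply: etrans (reg_gen_eps _) _.
  by rewrite eqxx (negPf nl).
Qed.
Definition reg_rep := sval reg_rep_subproof.

Lemma reg_repE :
  (reg_rep S = mx2 0 (psi cY) (psi (cZinv k) * psi cX) 0) *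
  (reg_rep U = mx2 0 (psi (cZ k)) 1 0) * (reg_rep U' = mx2 0 1 (psi (cZinv k)) 0) *
  (reg_rep e1 = mx2 1 0 0 0) * (reg_rep e2 = mx2 0 0 0 1).
Proof. by have [] := svalP reg_rep_subproof. Qed.

Lemma reg_rep_inHV a : reg_rep (inHVm a) = mx2 (psi a) 0 0 (psi (swapVm a)).
Proof.
elim/coordV_ind: a => [||||c|a b ha hb|a b ha hb].
- rewrite inHVmE /Xreg rmorphM /= !reg_repE mx2M swapVE.
  congr mx2; rewrite ?mulr0 ?mul0r ?addr0 ?add0r ?mul1r //.
  by rewrite mulrA zz1 mul1r.
- rewrite inHVmE /Yh rmorphM /= !reg_repE mx2M swapVE.
  congr mx2; rewrite ?mulr0 ?mul0r ?addr0 ?add0r ?mulr1 //.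
  by rewrite mulrC mulrA zz1 mul1r.
- rewrite inHVmE /cz2 rmorphM /= !reg_repE mx2M swapVE.
  by congr mx2; rewrite ?mulr0 ?mul0r ?addr0 ?add0r ?mulr1 ?mul1r.
- rewrite inHVmE /cz2inv rmorphM /= !reg_repE mx2M swapVE.
  by congr mx2; rewrite ?mulr0 ?mul0r ?addr0 ?add0r ?mulr1 ?mul1r.
- by rewrite !linearZ /= !rmorph1 mx2_1 mx2Z !scaler0.
- by rewrite !raddfD /= ha hb mx2D !addr0.
- rewrite !rmorphM /= ha hb mx2M.
  by congr mx2; rewrite ?mulr0 ?mul0r ?addr0 ?add0r.
Qed.

Lemma reg_rep_inA n : reg_rep (inA n) = mx2 (psi n.1) 0 0 (psi n.2).
Proof.
rewrite /A_reg_elt rmorphD !rmorphM /= !reg_rep_inHV !reg_repE !mx2M mx2D swapVK.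
by congr mx2; rewrite ?mulr0 ?mul0r ?mulr1 ?addr0 ?add0r.
Qed.
End Representation.

(** The representation over the coordinate ring itself, with psi the identity, sends [inA n] to the
    diagonal matrix of n. This is how the absence of further relations among the generators of A is
    established. *)
Lemma inA_inj : injective inA.
Proof.
move=> [a b] [c d] /(congr1 (reg_rep (idfun : {lrmorphism coordV k -> coordV k}))).
by rewrite !reg_rep_inA => /mx2_inj[/= -> _ _ ->].
Qed.
End RegularComponent.

Lemma acts_byI (k : fieldType) (A : algType k) (rho : {lrmorphism A -> mxalg k^o})
    (M : lmodType A) (m1 m2 : M) (a : A) (p q r s : k) :
  rho a = mx2 (p : k^o) q r s ->
  a *: m1 = p%:A *: m1 + r%:A *: m2 -> a *: m2 = q%:A *: m1 + s%:A *: m2 ->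
  acts_by rho m1 m2 a.
Proof. by move=> h h1 h2; rewrite /acts_by h !mx2E. Qed.

Lemma acts_byE (k : fieldType) (A : algType k) (rho : {lrmorphism A -> mxalg k^o})
    (M : lmodType A) (m1 m2 : M) (a : A) (p q r s : k) :
  rho a = mx2 (p : k^o) q r s -> acts_by rho m1 m2 a ->
  a *: m1 = p%:A *: m1 + r%:A *: m2 /\ a *: m2 = q%:A *: m1 + s%:A *: m2.
Proof. by move=> h; rewrite /acts_by h !mx2E. Qed.

Lemma kfree2_neq0 (k : fieldType) (A : algType k) (M : lmodType A) (m1 m2 : M) :
  kfree2 m1 m2 -> m1 != 0 /\ m2 != 0.
Proof.
move=> hf; split; apply/eqP => h0.
  have [|/eqP] := hf 1 0; last by rewrite oner_eq0.
  by rewrite h0 scaler0 kscale0 addr0.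
have [|_ /eqP] := hf 0 1; last by rewrite oner_eq0.
by rewrite h0 scaler0 kscale0 addr0.
Qed.

(** * The spherical modules of a regular orbit *)

Section RegularModules.
Variables (F : finFieldType) (k : fieldType) (iota : {rmorphism F -> k}).
Variable lam : torus_char F k.
Hypothesis nl : swap_char lam != lam.
Local Notation H := (hecke_comp iota lam).
Local Notation S := (cS iota lam).
Local Notation U := (cU iota lam).
Local Notation U' := (cUinv iota lam).
Local Notation e1 := (ceps iota lam lam).
Local Notation e2 := (ceps iota lam (swap_char lam)).
Local Notation rep := (reg_rep iota nl).
Local Notation inA := (A_reg_elt iota nl).
Local Notation inHVm := (inHVm iota nl).

Lemma reg_acts (v : k * k * k) (hv : ptsV v) (M : lmodType H) (m1 m2 : M) :
  e1 *: m1 = m1 -> e2 *: m2 = m2 ->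
  S *: m1 = (v.2^-1 * v.1.1)%:A *: m2 -> S *: m2 = (v.1.2)%:A *: m1 ->
  U *: m1 = m2 -> U *: m2 = (v.2)%:A *: m1 ->
  forall a, acts_by (rep (atVm hv)) m1 m2 a.
Proof.
move=> h1 h2 hS1 hS2 hU1 hU2.
have h12 : e1 *: m2 = 0 by rewrite -h2 scalerA (e12 _ nl) scale0r.
have h21 : e2 *: m1 = 0 by rewrite -h1 scalerA (e21 _ nl) scale0r.
have UV (m : M) : U' *: (U *: m) = m by rewrite scalerA cVU scale1r.
have v2 : v.2 != 0 by case: hv.
apply: (reg_ind nl).
- apply: (acts_byI (p := 1) (q := 0) (r := 0) (s := 0)).
  + by rewrite reg_repE.
  + by rewrite h1 kscale0 kscale1 addr0.
  + by rewrite h12 !kscale0 addr0.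
- apply: (acts_byI (p := 0) (q := 0) (r := 0) (s := 1)).
  + by rewrite reg_repE.
  + by rewrite h21 !kscale0 addr0.
  + by rewrite h2 kscale0 kscale1 add0r.
- apply: (acts_byI (p := 0) (q := v.1.2) (r := v.2^-1 * v.1.1) (s := 0)).
  + by rewrite reg_repE !atVE.
  + by rewrite hS1 kscale0 add0r.
  + by rewrite hS2 kscale0 addr0.
- apply: (acts_byI (p := 0) (q := v.2) (r := 1) (s := 0)).
  + by rewrite reg_repE !atVE.
  + by rewrite hU1 kscale0 kscale1 add0r.
  + by rewrite hU2 kscale0 addr0.
- apply: (acts_byI (p := 0) (q := 1) (r := v.2^-1) (s := 0)).
  + by rewrite reg_repE !atVE.
  + rewrite kscale0 add0r -[m1]kscale1 -(mulVf v2) -kscaleA -hU2 -kscaleC UV.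
    by [].
  + by rewrite -{1}hU1 UV kscale0 kscale1 addr0.
- exact: acts_by_cst.
- by move=> a b; apply: acts_by_add.
- by move=> a b; apply: acts_by_mul.
Qed.

Lemma reg_acts_inHV (v : k * k * k) (hv : ptsV v) (M : lmodType H) (m1 m2 : M) a :
  acts_by (rep (atVm hv)) m1 m2 (inHVm a) -> inHVm a *: m1 = (atV v a)%:A *: m1.
Proof.
move=> h; have [-> _] := acts_byE (reg_rep_inHV iota nl (atVm hv) a) h.
by rewrite kscale0 addr0 atVmE.
Qed.

Lemma e1E : inA (1, 0) = e1.
Proof. by rewrite /A_reg_elt /= raddf0 !rmorph1 rmorph0 mul0r mul1r addr0. Qed.
Lemma e2E : inA (0, 1) = e2.
Proof. by rewrite /A_reg_elt /= rmorph0 !rmorph1 mul0r mul1r add0r. Qed.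
Lemma inA_inHV a : inA (a, swapVm a) = inHVm a.
Proof. by rewrite /A_reg_elt /= swapVK -mulrDr (eps12 _ nl) mulr1. Qed.

(** [A_reg] is an intersection of subalgebras: one direction tests it on the image of [inA], the
    other builds [inA n] from the generators inside an arbitrary subalgebra. *)
Lemma A_regP a : @A_reg _ _ iota lam a <-> exists n, inA n = a.
Proof.
split=> [h|[n <-]].
  have /asboolP : a \in [pred a | `[< exists n, inA n = a >]]; last by [].
  apply: h.
    split=> [|c u v|u v]; rewrite !inE.
    - by apply/asboolP; exists (1, swapVm 1); rewrite inA_inHV rmorph1.
    - move=> /asboolP[m <-] /asboolP[n <-]; apply/asboolP.
      exists ((c%:A * m.1, swapVm c%:A * m.2) + n).
      by rewrite inAD (inAM _ _ (_, _)) inA_inHV linearZ rmorph1 /= mulr_algl.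
    - move=> /asboolP[m <-] /asboolP[n <-]; apply/asboolP.
      by exists (m.1 * n.1, m.2 * n.2); rewrite inAM.
  move=> b; rewrite !inE => /or4P[/eqP->|/eqP->|/eqP->|]; last (case/or3P => /eqP->);
    apply/asboolP.
  - by exists (1, 0); apply: e1E.
  - by exists (0, 1); apply: e2E.
  - by exists (cX, swapVm cX); rewrite inA_inHV inHVmE.
  - by exists (cY, swapVm cY); rewrite inA_inHV inHVmE.
  - by exists (cZ k, swapVm (cZ k)); rewrite inA_inHV inHVmE.
  - by exists (cZinv k, swapVm (cZinv k)); rewrite inA_inHV inHVmE.
move=> P [P1 Pl PM] PG.
have P0 : 0 \in P by rewrite -(subrr 1) -scaleN1r addrC Pl.
have PZ c u : u \in P -> c *: u \in P by move=> hu; rewrite -[_ *: _]addr0 Pl.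
have PD u v : u \in P -> v \in P -> u + v \in P.
  by move=> hu hv; rewrite -[u]scale1r Pl.
have PV b : inHVm b \in P.
  elim/coordV_ind: b => [||||c|b d hb hd|b d hb hd].
  - by rewrite inHVmE PG // !inE eqxx ?orbT.
  - by rewrite inHVmE PG // !inE eqxx ?orbT.
  - by rewrite inHVmE PG // !inE eqxx ?orbT.
  - by rewrite inHVmE PG // !inE eqxx ?orbT.
  - by rewrite linearZ rmorph1 /= PZ.
  - by rewrite raddfD PD.
  - by rewrite rmorphM PM.
by rewrite /A_reg_elt PD // PM // PG // !inE eqxx ?orbT.
Qed.

Lemma Z_elt_reg_A a : @A_reg _ _ iota lam (Z_elt_reg iota lam a).
Proof. by apply/A_regP; exists (a, a); rewrite -Z_elt_regE. Qed.

(** Exhibits e1, e2 as generators of A over the center; the twist by the swap in [inA] is chosen so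
    that both coefficients are the central elements of the coordinates of n. *)
Lemma inAE n : inA n = Z_elt_reg iota lam n.1 * e1 + Z_elt_reg iota lam n.2 * e2.
Proof.
rewrite !(Z_elt_regE _ nl) -e1E -e2E -!inAM -inAD; congr inA => /=.
by case: n => a b; congr (_, _) => /=; ring.
Qed.

Section Quotient.
Variables (v : k * k * k) (hv : ptsV v) (N M : lmodType H) (j : N -> H).
Variable f : {linear N -> M}.
Hypothesis hj : spherical_action_reg j.
Hypothesis f_surj : forall m, exists n, f n = m.
Hypothesis f_ker : forall n, f n = 0 <->
  exists p (c : 'I_p -> H) (x : 'I_p -> N),
    (forall i, ker_theta_reg v (c i)) /\ n = \sum_i c i *: x i.

Let jD : {morph j : m n / m + n}. Proof. by case: hj => -[]. Qed.
Let j_inj : injective j. Proof. by case: hj => -[]. Qed.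
Let jA a : @A_reg _ _ iota lam a <-> exists n, j n = a. Proof. by case: hj => -[]. Qed.
Let jM a n : @A_reg _ _ iota lam a -> j (a *: n) = a * j n.
Proof. by case: hj => -[_ _ _ h] _ _ _ _; apply: h. Qed.

(** The central element of a - a(v) lies in the kernel of theta_v, so f kills its multiples. *)
Lemma reg_theta a n : f (Z_elt_reg iota lam a *: n) = (atV v a)%:A *: f n.
Proof.
pose c := atV v a.
have hc : Z_elt_reg iota lam (a - c%:A) = Z_elt_reg iota lam a - c%:A.
  rewrite !(Z_elt_regE _ nl) (_ : (a - _, _) = (a, a) + (- c%:A, - c%:A)) //.
  rewrite inAD; congr (_ + _).
  have h : (- c)%:A = swapVm (- c)%:A by rewrite linearZ rmorph1.
  rewrite -!scaleNr {2}h inA_inHV linearZ rmorph1 /= //.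
apply/eqP; rewrite -subr_eq0 -linearZ -linearB -scalerBl -hc; apply/eqP/f_ker.
exists 1%N, (fun=> Z_elt_reg iota lam (a - c%:A)), (fun=> n); split=> [_|].
  exists (a - c%:A) => //; rewrite -(atVmE hv) linearB linearZ rmorph1 /= atVmE.
  by rewrite [_ *: (_ : k^o)]mulr1 subrr.
by rewrite big_ord1.
Qed.
Lemma Z_elt_e1 a : Z_elt_reg iota lam a * e1 = inHVm a * e1.
Proof.
by rewrite (Z_elt_regE _ nl) /A_reg_elt mulrDl -!mulrA (e11 iota lam) (e21 _ nl) mulr0 addr0.
Qed.
Lemma Z_elt_e2 a : Z_elt_reg iota lam a * e2 = inHVm (swapVm a) * e2.
Proof.
by rewrite (Z_elt_regE _ nl) /A_reg_elt mulrDl -!mulrA (e22 iota lam) (e12 _ nl) mulr0 add0r.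
Qed.

(** The basis consists of the images of e1 and e2. It spans because A is generated by e1 and e2 over
    the center, which acts through theta_v; the matrices are the defining formulas of the spherical
    action specialized at v. *)
Lemma reg_quotient_models : exists m1 m2 : M, models (rep (atVm hv)) m1 m2.
Proof.
have [_ _ hS1 hS2 [hU1 hU2]] := hj.
have [n1 jn1] : exists n, j n = e1 by apply/jA/A_regP; exists (1, 0); apply: e1E.
have [n2 jn2] : exists n, j n = e2 by apply/jA/A_regP; exists (0, 1); apply: e2E.
have jZ a n : j (Z_elt_reg iota lam a *: n) = Z_elt_reg iota lam a * j n.
  by apply: jM; apply: Z_elt_reg_A.
have Ae1 : @A_reg _ _ iota lam e1 by apply/jA; exists n1.
have Ae2 : @A_reg _ _ iota lam e2 by apply/jA; exists n2.
have Ac (c : k) : @A_reg _ _ iota lam c%:A.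
  by apply/A_regP; exists (c%:A, swapVm c%:A); rewrite inA_inHV linearZ rmorph1.
have en1 : e1 *: n1 = n1 by apply: j_inj; rewrite jM // jn1 (e11 iota lam).
have en2 : e2 *: n2 = n2 by apply: j_inj; rewrite jM // jn2 (e22 iota lam).
have Sn1 : S *: n1 = Z_elt_reg iota lam (cZinv k * cX) *: n2.
  apply: j_inj; rewrite jZ jn2 (hS1 _ jn1) Z_elt_e2 !rmorphM /=.
  by rewrite !swapVE !inHVmE.
have Sn2 : S *: n2 = Z_elt_reg iota lam cY *: n1.
  by apply: j_inj; rewrite jZ jn1 (hS2 _ jn2) Z_elt_e1 inHVmE.
have Un1 : U *: n1 = n2 by apply: j_inj; rewrite (hU1 _ jn1) jn2.
have Un2 : U *: n2 = Z_elt_reg iota lam (cZ k) *: n1.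
  by apply: j_inj; rewrite jZ jn1 (hU2 _ jn2) Z_elt_e1 inHVmE.
have fZ a n : a *: f n = f (a *: n) by rewrite linearZ.
exists (f n1), (f n2).
have acts := @reg_acts v hv M (f n1) (f n2); split.
- move=> m; have [n <-] := f_surj m.
  have [[a b] hab] : exists n0, inA n0 = j n by apply/A_regP/jA; exists n.
  have -> : n = Z_elt_reg iota lam a *: n1 + Z_elt_reg iota lam b *: n2.
    by apply: j_inj; rewrite jD !jZ jn1 jn2 -hab inAE.
  by exists (atV v a), (atV v b); rewrite linearD !reg_theta.
- move=> c d; rewrite !fZ -raddfD => /f_ker[p [cs [xs [hcs /(congr1 j)]]]].
  have jsum (s : seq 'I_p) : j (\sum_(i <- s) cs i *: xs i) =
      \sum_(i <- s) cs i * j (xs i).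
    elim: s => [|i s ih]; last first.
      rewrite !big_cons jD ih; congr (_ + _).
      by have [a -> _] := hcs i; apply: jZ.
    rewrite !big_nil; apply: (addrI (j 0)); rewrite -jD !addr0.
    by [].
  (* Independence: c e1 + d e2 is a sum of multiples of elements of the kernel of theta_v, which the
     matrices at v send to 0, while the left side becomes the diagonal matrix of c and d. *)
  rewrite jD !jM // jn1 jn2 jsum => /(congr1 (rep (atVm hv))).
  rewrite !mulr_algl raddfD /= !linearZ /= !reg_repE !mx2Z mx2D.
  rewrite rmorph_sum big1 => [|i _]; last first.
    have [a -> ha] := hcs i; rewrite rmorphM /= (Z_elt_regE _ nl) reg_rep_inA.
    by rewrite /= atVmE ha -mx2_0 mul0r.
  rewrite !scaler0 !addr0 !add0r mx2_0 => /mx2_inj[].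
  by rewrite ![_ *: (_ : k^o)]mulr1.
- apply: acts.
  + by rewrite fZ en1.
  + by rewrite fZ en2.
  + by rewrite fZ Sn1 reg_theta -(atVmE hv) rmorphM /= !atVE.
  + by rewrite fZ Sn2 reg_theta -(atVmE hv) atVE.
  + by rewrite fZ Un1.
  + by rewrite fZ Un2 reg_theta -(atVmE hv) atVE.
Qed.
End Quotient.

Local Notation N0 := (column_module (rep (idfun : {lrmorphism coordV k -> coordV k}))).

Lemma column_inA (n : coordV k * coordV k) (u : N0) :
  inA n *: u = (n.1 * u.1, n.2 * u.2) :> N0.
Proof.
rewrite column_moduleE /col_act reg_rep_inA !mx2E /=.
by rewrite !mul0r addr0 add0r.
Qed.

Lemma column_ZE a (u : N0) : Z_elt_reg iota lam a *: u = (a * u.1, a * u.2) :> N0.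
Proof. by rewrite (Z_elt_regE _ nl) column_inA. Qed.

Lemma column_S (u : N0) : S *: u = (cY * u.2, cZinv k * cX * u.1) :> N0.
Proof. by rewrite column_moduleE /col_act reg_repE !mx2E !mul0r addr0 add0r. Qed.
Lemma column_U (u : N0) : U *: u = (cZ k * u.2, u.1) :> N0.
Proof.
by rewrite column_moduleE /col_act reg_repE !mx2E !mul0r addr0 add0r mul1r.
Qed.

(** The columns over the coordinate ring are A in coordinates: the column (a, b) stands for
    [inA (a, b)], with e1 = (1, 0) and e2 = (0, 1). *)
Lemma spherical_action_inA : @spherical_action_reg _ _ iota lam N0 inA.
Proof.
split.
- split; first exact: inAD.
  + exact: inA_inj.
  + exact: A_regP.
  + by move=> a u /A_regP[n <-]; rewrite column_inA inAM.
- split=> _ u [a ->].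
    rewrite !column_ZE !column_S /=; congr (_, _) => /=; ring.
  rewrite !column_ZE !column_U /=; congr (_, _) => /=; ring.
- move=> n; rewrite -e1E => /(@inA_inj _ _ iota _ nl)->.
  rewrite column_S /= mulr0 mulr1 /A_reg_elt /= rmorph0 mul0r add0r.
  by rewrite !rmorphM /= !swapVE !inHVmE.
- move=> n; rewrite -e2E => /(@inA_inj _ _ iota _ nl)->.
  rewrite column_S /= mulr0 mulr1 /A_reg_elt /= !rmorph0 mul0r addr0.
  by rewrite inHVmE.
- split=> n.
    rewrite -e1E => /(@inA_inj _ _ iota _ nl)->.
    by rewrite column_U /= mulr0 e2E.
  rewrite -e2E => /(@inA_inj _ _ iota _ nl)->.
  by rewrite column_U /= mulr1 /A_reg_elt /= !rmorph0 mul0r addr0 inHVmE.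
Qed.

Section Specialization.
Variables (v : k * k * k) (hv : ptsV v).
Local Notation M0 := (column_module (rep (atVm hv))).

Lemma reg_rep_specialize a :
  rep (atVm hv) a = mx2 (atVm hv (rep idfun a 0 0)) (atVm hv (rep idfun a 0 1))
                        (atVm hv (rep idfun a 1 0)) (atVm hv (rep idfun a 1 1)).
Proof.
elim/(@reg_ind _ _ iota _ nl): a => [|||||c|a b ha hb|a b ha hb].
- by rewrite !reg_repE !mx2E !rmorph0 !rmorph1.
- by rewrite !reg_repE !mx2E !rmorph0 !rmorph1.
- by rewrite !reg_repE !mx2E !rmorph0 !rmorphM.
- by rewrite !reg_repE !mx2E !rmorph0 !rmorph1.
- by rewrite !reg_repE !mx2E !rmorph0 !rmorph1.
- have h (R : comAlgType k) (psi : {lrmorphism coordV k -> R}) :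
      rep psi c%:A = mx2 c%:A 0 0 c%:A.
    by rewrite linearZ rmorph1 /= mx2_1 mx2Z !scaler0.
  by rewrite !h !mx2E linearZ rmorph1 rmorph0.
- by rewrite !rmorphD /= ha hb mx2D !mxalgDE !rmorphD.
- by rewrite !rmorphM /= ha hb mx2M !mxalgME !rmorphD !rmorphM.
Qed.

Definition specialize (u : N0) : M0 := (atVm hv u.1, atVm hv u.2).

Fact specialize_linear : linear specialize.
Proof.
move=> a u w; rewrite /specialize !column_moduleE /col_act /= reg_rep_specialize !mx2E.
by rewrite !rmorphD !rmorphM.
Qed.

Lemma Sph_reg_column : Sph_reg v M0.
Proof.
exists N0, inA; split; first exact: spherical_action_inA.
exists (mklinear specialize_linear); split=> [[c d]|[a b]] /=.
  exists ((c : k)%:A, (d : k)%:A); rewrite /specialize !linearZ !rmorph1 /=.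
  by rewrite ![_ *: (_ : k^o)]mulr1.
split=> [[ha hb]|[p [c [x [hc ->]]]]].
  (* A column (a, b) vanishing at v is the sum of the central element of a applied to (1, 0) and
     that of b applied to (0, 1), both taken from the kernel of theta_v. *)
  exists 2%N, (fun i => if i == 0 then Z_elt_reg iota lam a else Z_elt_reg iota lam b).
  exists (fun i => if i == 0 then (1, 0) : N0 else (0, 1) : N0); split.
    by move=> i; case: ifP => _; [exists a|exists b] => //; rewrite -(atVmE hv).
  rewrite sum2E /= !column_ZE /= !mulr0 !mulr1.
  by congr (_, _); rewrite /= ?addr0 ?add0r.
rewrite -[specialize]/(mklinear specialize_linear : _ -> _) linear_sum big1 // => i _.
have [a' -> ha'] := hc i.
rewrite /= column_ZE /specialize /= !rmorphM /= atVmE ha' !mul0r //.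
Qed.
End Specialization.
End RegularModules.

Lemma kscale_coef0 (k : fieldType) (A : algType k) (M : lmodType A) (c : k) (m : M) :
  m != 0 -> c%:A *: m = 0 -> c = 0.
Proof. by move=> m0 h; apply: (kscale_inj m0); rewrite h kscale0. Qed.

Section SubmoduleClosure.
Variables (k : fieldType) (A : algType k) (M : lmodType A) (N : {pred M}).
Hypothesis N_sub : submod_closed N.

Lemma submodZ a m : m \in N -> a *: m \in N.
Proof. by move=> h; case: N_sub => N0 Nl; rewrite -[_ *: _]addr0 Nl. Qed.
Lemma submodD m n : m \in N -> n \in N -> m + n \in N.
Proof. by move=> hm hn; case: N_sub => N0 Nl; rewrite -[m]scale1r Nl. Qed.
Lemma submodKZ (c : k) m : c != 0 -> c%:A *: m \in N -> m \in N.
Proof.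
by move=> c0 h; rewrite -[m]kscale1 -(mulVf c0) -kscaleA; apply: submodZ.
Qed.
End SubmoduleClosure.

Lemma simpleI (k : fieldType) (A : algType k) (M : lmodType A) (m1 m2 : M) :
  kspan2 m1 m2 -> kfree2 m1 m2 ->
  (forall N : {pred M}, submod_closed N -> forall c d : k, (c != 0) || (d != 0) ->
    c%:A *: m1 + d%:A *: m2 \in N -> m1 \in N /\ m2 \in N) ->
  simple M.
Proof.
move=> hs hf h; split; first by exists m1; case: (kfree2_neq0 hf).
move=> N Nsub; have [all0|] := pselect {in N, forall m, m = 0}; first by left.
move=> n0; right => m; rewrite inE.
have [n [nN n_neq0]] : exists n, n \in N /\ n != 0.
  have /existsNP[n /not_implyP[nN hn]] := n0.
  by exists n; split=> //; apply/eqP.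
have [c [d e]] := hs n.
have [|m1N m2N] := h N Nsub c d _ ltac:(by rewrite -e).
  apply: contraNT n_neq0; rewrite negb_or !negbK => /andP[/eqP c0 /eqP d0].
  by rewrite e c0 d0 !kscale0 addr0.
have [c' [d' ->]] := hs m.
by apply: submodD => //; apply: submodZ.
Qed.

(** * Simple modules for a regular orbit *)

Section RegularClassification.
Variables (F : finFieldType) (k : fieldType) (iota : {rmorphism F -> k}).
Variable lam : torus_char F k.
Hypothesis nl : swap_char lam != lam.
Local Notation H := (hecke_comp iota lam).
Local Notation U := (cU iota lam).
Local Notation U' := (cUinv iota lam).
Local Notation z := (cz2 iota lam).
Local Notation X := (Xreg iota lam).
Local Notation Y := (Yh iota lam).
Local Notation e1 := (ceps iota lam lam).
Local Notation e2 := (ceps iota lam (swap_char lam)).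
Local Notation rep := (reg_rep iota nl).
Local Notation inHVm := (inHVm iota nl).

Section OneModel.
Variables (v : k * k * k) (hv : ptsV v) (M : lmodType H) (m1 m2 : M).
Hypothesis hm : models (rep (atVm hv)) m1 m2.

Lemma reg_models_act : [/\ e1 *: m1 = m1, e1 *: m2 = 0, e2 *: m1 = 0 & e2 *: m2 = m2] /\
  (U *: m1 = m2 /\ U *: m2 = (v.2)%:A *: m1).
Proof.
have [_ _ ha] := hm; have [Ee1 Ee2] : rep (atVm hv) e1 = mx2 1 0 0 0 /\
  rep (atVm hv) e2 = mx2 0 0 0 1 by rewrite !reg_repE.
have EU : rep (atVm hv) U = mx2 0 (v.2 : k^o) 1 0 by rewrite reg_repE atVE.
have [-> ->] := acts_byE Ee1 (ha _); have [-> ->] := acts_byE Ee2 (ha _).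
have [-> ->] := acts_byE EU (ha _).
by rewrite !kscale0 !kscale1 !addr0 !add0r.
Qed.

(** The idempotents separate the two coordinates of a vector of a submodule, and U exchanges the
    basis vectors up to the unit z2. *)
Lemma reg_models_simple : simple M.
Proof.
have [hs hf _] := hm; have [[h11 h12 h21 h22] [hU1 hU2]] := reg_models_act.
have v2 : v.2 != 0 by case: hv.
apply: (simpleI hs hf) => N Nsub c d hcd hN.
have hc : c%:A *: m1 \in N.
  have := submodZ Nsub e1 hN.
  by rewrite scalerDr -!kscaleC h11 h12 scaler0 addr0.
have hd : d%:A *: m2 \in N.
  have := submodZ Nsub e2 hN.
  by rewrite scalerDr -!kscaleC h21 h22 scaler0 add0r.
case/orP: hcd => h0.
  have m1N := submodKZ Nsub h0 hc; split=> //.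
  by rewrite -hU1; apply: submodZ.
have m2N := submodKZ Nsub h0 hd; split=> //.
by apply: (submodKZ Nsub v2); rewrite -hU2; apply: submodZ.
Qed.

Lemma reg_models_central_character :
  exists theta : H -> k, central_character M theta /\ theta (X + Y) = v.1.1 + v.1.2.
Proof.
have [hs hf ha] := hm; have [[h11 h12 h21 h22] [hU1 hU2]] := reg_models_act.
(* The upper left entry of the matrix is defined on all of H. For central h, the vector h m1 is
   fixed by e1, hence lies on the line of m1, and U carries the scalar over to m2. *)
exists (fun h => rep (atVm hv) h 0 0 : k); split; last first.
  have -> : X + Y = inHVm (cX + cY) by rewrite raddfD /= !inHVmE.
  by rewrite reg_rep_inHV mx2E raddfD /= !atVE.
move=> h m ch; pose c : k := rep (atVm hv) h 0 0.
rewrite -[LHS]/(h *: m) -[RHS]/(c%:A *: m).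
have e1h : h *: m1 = c%:A *: m1.
  have hh : h *: m1 = c%:A *: m1 + (rep (atVm hv) h 1 0 : k)%:A *: m2 := (ha h).1.
  have : e1 *: (h *: m1) = h *: m1 by rewrite scalerA -ch -scalerA h11.
  rewrite hh scalerDr -!kscaleC h11 h12 scaler0 addr0 -[LHS]addr0.
  by move/addrI <-; rewrite addr0.
have e2h : h *: m2 = c%:A *: m2 by rewrite -hU1 scalerA ch -scalerA e1h kscaleC.
have [a [b ->]] := hs m.
rewrite (scalerDr h) (scalerDr c%:A) -(kscaleC a h) -(kscaleC b h) e1h e2h.
by rewrite (kscaleC a) (kscaleC b).
Qed.
End OneModel.

(** An isomorphism respects the image of e1, the line of the first basis vector, on which X, Y and
    z2 act by the coordinates of the point. *)
Lemma reg_models_point v v' (hv : ptsV v) (hv' : ptsV v') (M M' : lmodType H)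
    (m1 m2 : M) (m1' m2' : M') :
  models (rep (atVm hv)) m1 m2 -> models (rep (atVm hv')) m1' m2' ->
  isomorphic M M' -> v = v'.
Proof.
move=> hm hm' [f /bij_inj finj].
have [_ hf ha] := hm; have [hs' _ ha'] := hm'.
have [[h11 _ _ _] _] := reg_models_act hm.
have [[h11' h12' _ _] _] := reg_models_act hm'.
have [c [d fm1]] := hs' (f m1).
have {}fm1 : f m1 = c%:A *: m1'.
  rewrite -[in LHS]h11 linearZ /= fm1 scalerDr -!kscaleC h11' h12'.
  by rewrite scaler0 addr0.
have fm0 : f m1 != 0.
  by rewrite -(linear0 f) (inj_eq finj); case: (kfree2_neq0 hf).
have h a : atV v a = atV v' a.
  apply: (kscale_inj fm0); have fZ b : b *: f m1 = f (b *: m1) by rewrite linearZ.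
  rewrite fZ -(reg_acts_inHV (ha _)) -fZ fm1 -(kscaleC c (inHVm a)).
  by rewrite (reg_acts_inHV (ha' _)) (kscaleC c).
have := h cX; have := h cY; have := h (cZ k).
rewrite -!(atVmE hv) -!(atVmE hv') !atVE.
by case: v v' {h hv hv' hm hm' ha ha'} => [[? ?] ?] [[? ?] ?] /= -> -> ->.
Qed.

Lemma reg_classify (M : lmodType H) (c d : k) : simple M ->
  (forall m : M, z *: m = c%:A *: m) -> (forall m : M, (X + Y) *: m = d%:A *: m) ->
  exists v (hv : ptsV v) (m1 m2 : M),
    v.1.1 + v.1.2 = d /\ models (rep (atVm hv)) m1 m2.
Proof.
move=> sM hz hd; have [m m0] := sM.1.
have UV (n : M) : U' *: (U *: n) = n by rewrite scalerA cVU scale1r.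
have U_neq0 (n : M) : n != 0 -> U *: n != 0.
  by apply: contra => /eqP h; rewrite -(UV n) h scaler0.
have c0 : c != 0.
  apply: contra m0 => /eqP c0; rewrite -[m]scale1r -(cz2VV iota lam) -scalerA.
  by rewrite hz c0 kscale0 scaler0.
(* If e1 kills m then e2 fixes m, and U m is fixed by e1. *)
have [n n0 hn] : exists2 n : M, n != 0 & e1 *: n = n.
  have [h1|h1] := eqVneq (e1 *: m) 0; last first.
    by exists (e1 *: m) => //; rewrite scalerA (e11 iota lam).
  exists (U *: m); first exact: U_neq0.
  have h2 : e2 *: m = m.
    by rewrite -[RHS]scale1r -(eps12 iota nl) scalerDl h1 add0r.
  by rewrite scalerA -(Ue2 iota lam) -scalerA h2.
have key (x y : k) (m1 : M) : m1 != 0 -> e1 *: m1 = m1 -> X *: m1 = x%:A *: m1 ->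
    Y *: m1 = y%:A *: m1 -> x * y = 0 -> x + y = d ->
  exists v (hv : ptsV v) (m1 m2 : M),
    v.1.1 + v.1.2 = d /\ models (rep (atVm hv)) m1 m2.
  move=> m10 he1 hX hY xy0 xyd.
  have hv : ptsV (x, y, c) by split.
  exists (x, y, c), hv, m1, (U *: m1); split=> //.
  have e2U : e2 *: (U *: m1) = U *: m1 by rewrite scalerA -(Ue1 iota lam) -scalerA he1.
  have acts : forall a, acts_by (rep (atVm hv)) m1 (U *: m1) a.
    apply: reg_acts => //=.
    (* The value of S m1 is found by applying the injective U: U S m1 = X m1 = x m1, and U^2 = c. *)
    - apply: (can_inj UV); rewrite scalerA -/(Xreg iota lam) hX.
      rewrite -kscaleC [U *: (U *: _)]scalerA hz kscaleA.
      by rewrite mulrAC mulVf // mul1r.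
    - by rewrite scalerA hY.
    - by rewrite scalerA hz.
  split=> //; first exact: simple_kspan2 sM m10 acts.
  move=> p q hpq; split; apply/eqP.
    have := congr1 (fun m => e1 *: m) hpq.
    rewrite scaler0 scalerDr -!kscaleC he1 -e2U [e1 *: (e2 *: _)]scalerA.
    rewrite (e12 iota nl) scale0r scaler0 addr0.
    by move/(kscale_coef0 m10) ->.
  have := congr1 (fun m => e2 *: m) hpq.
  rewrite scaler0 scalerDr -!kscaleC e2U -he1 [e2 *: (e1 *: _)]scalerA.
  rewrite (e21 iota nl) scale0r scaler0 add0r he1.
  by move/(kscale_coef0 (U_neq0 _ m10)) ->.
have hXY (m' : M) : X *: m' + Y *: m' = d%:A *: m' by rewrite -scalerDl hd.
(* If X n = 0 the point is (0, d, c), with basis vector n. Otherwise Y kills X n because Y X = 0,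
   and the point is (d, 0, c), with basis vector X n. *)
have [hX|hX] := eqVneq (X *: n) 0.
  apply: (key 0 d n) => //; rewrite ?mul0r ?add0r ?kscale0 //.
  by have := hXY n; rewrite hX add0r.
have YX : Y *: (X *: n) = 0 by rewrite scalerA (YX0 iota nl) scale0r.
apply: (key d 0 (X *: n)) => //; rewrite ?mulr0 ?addr0 ?kscale0 //.
- by rewrite scalerA -(Xe1 iota lam) -scalerA hn.
- by have := hXY (X *: n); rewrite YX addr0.
Qed.
End RegularClassification.

Section RegularBijections.
Variables (F : finFieldType) (k : closedFieldType) (iota : {rmorphism F -> k}).
Variable lam : torus_char F k.
Hypothesis nl : swap_char lam != lam.
Local Notation H := (hecke_comp iota lam).
Local Notation rep := (reg_rep iota nl).

Lemma Sph_reg_models v (hv : ptsV v) (M : lmodType H) : Sph_reg v M ->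
  exists m1 m2 : M, models (rep (atVm hv)) m1 m2.
Proof. by case=> N [j [hj [f [fs fk]]]]; apply: reg_quotient_models hj fs fk. Qed.

Lemma Sph_reg_eq v v' (M M' : lmodType H) : ptsV v -> ptsV v' ->
  Sph_reg v M -> Sph_reg v' M' -> (v = v' <-> isomorphic M M').
Proof.
move=> hv hv' /(Sph_reg_models hv)[m1 [m2 hm]] /(Sph_reg_models hv')[m1' [m2' hm']].
split=> [e|]; last exact: reg_models_point hm hm'.
move: hv' hm'; rewrite -e => hv' hm'.
(* The matrices at v depend on the proof that v is a point, so two such proofs have to be
   identified. *)
rewrite (Prop_irrelevance hv' hv) in hm'.
exact: isomorphic_trans (isomorphic_sym (models_iso hm)) (models_iso hm').
Qed.

Theorem Sph_reg_bijective :
  bij_classes (@ptsV k)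
    (fun M : lmodType H => simple M /\ finite_dimensional M)
    (@isomorphic k H) (@Sph_reg F k iota lam).
Proof.
split.
- by move=> v hv; exists (column_module (rep (atVm hv))); apply: Sph_reg_column.
- move=> v M hv /(Sph_reg_models hv)[m1 [m2 hm]]; split.
    exact: reg_models_simple hm.
  by exists 2%N; apply: models_kbasis hm.
- by move=> v v' M M' hv hv' hM hM'; apply: Sph_reg_eq.
- move=> M [sM fM].
  have [c hc] := finite_dimensional_eigenvector (cz2 iota lam) fM sM.1.
  have [d hd] := finite_dimensional_eigenvector (Xreg iota lam + Yh iota lam) fM sM.1.
  have := reg_classify nl sM (schur_scalar sM (@cz2_central _ _ _ _) hc)
    (schur_scalar sM (@XY_central _ _ iota _ nl) hd).
  move=> [v [hv [m1 [m2 [_ hm]]]]].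
  exists v, (column_module (rep (atVm hv))); split=> //; first exact: Sph_reg_column.
  exact: models_iso hm.
Qed.

(** The scalars of z2 and X + Y are read off the given central character, and x + y = 0 together
    with x y = 0 forces x = y = 0. *)
Theorem Sph_reg_supersingular :
  bij_classes (fun v : k * k * k => ptsV v /\ (v.1.1 = 0 /\ v.1.2 = 0))
    (@supersingular_reg F k iota lam) (@isomorphic k H) (@Sph_reg F k iota lam).
Proof.
split.
- by move=> v [hv _]; exists (column_module (rep (atVm hv))); apply: Sph_reg_column.
- move=> v M [hv [x0 y0]] /(Sph_reg_models hv)[m1 [m2 hm]]; split.
    exact: reg_models_simple hm.
  have [theta [h1 h2]] := reg_models_central_character hm.
  by exists theta; split=> //; rewrite h2 x0 y0 addr0.
- by move=> v v' M M' [hv _] [hv' _] hM hM'; apply: Sph_reg_eq.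
- move=> M [sM [theta [h1 h2]]].
  have [v [hv [m1 [m2 [hd hm]]]]] := reg_classify nl sM
    (fun m => h1 _ m (@cz2_central _ _ _ _)) (fun m => h1 _ m (@XY_central _ _ iota _ nl)).
  exists v, (column_module (rep (atVm hv))); split=> //; last exact: models_iso hm.
    split=> //; rewrite h2 in hd; have [/eqP xy _] := hv.
    move: xy; rewrite mulf_eq0 => /orP[]/eqP h; move: hd; rewrite h.
      by rewrite add0r.
    by rewrite addr0.
  exact: Sph_reg_column.
Qed.
End RegularBijections.

(** * Non-regular orbits *)

Lemma quadratic_mul (R : pzRingType) (a b c d y t : R) :
  y * y = t * y -> (forall x, t * x = x * t) -> (forall x, c * x = x * c) ->
  (forall x, d * x = x * d) ->
  a * c + (a * d + b * c + t * b * d) * y = (a + b * y) * (c + d * y).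
Proof.
move=> hy ht hc hd; rewrite mulrDl !mulrDr !mulrDl -!addrA; congr (_ + _).
have -> : b * y * c = b * c * y by rewrite -!mulrA hc.
have -> : b * y * (d * y) = t * b * d * y.
  rewrite -mulrA [y * (d * y)]mulrA -hd -mulrA hy !mulrA.
  by rewrite -(ht (b * d)) !mulrA.
by rewrite addrCA !mulrA.
Qed.

Section AtW.
Variables (k : fieldType) (v : k * k) (hv : ptsW v).
Fact atWP : respects (com_rel (@relW k)) (@valW k k^o v.1 v.2 v.2^-1).
Proof. by apply: valWP; rewrite mulfV. Qed.
Lemma atWm_subproof : {f : {lrmorphism coordW k -> k^o} | f =1 atW v}.
Proof. by exists (evalW atWP). Qed.
Definition atWm := sval atWm_subproof.
Lemma atWmE : atWm =1 atW v. Proof. exact: (svalP atWm_subproof). Qed.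
Lemma atWE : (atWm cW1 = v.1) * (atWm cW2 = v.2) * (atWm cW2inv = v.2^-1).
Proof. by rewrite !atWmE; do !split; apply: (pres_eval_gen atWP). Qed.
End AtW.
Arguments atWm {k v}.

Section NonregularComponent.
Variables (F : finFieldType) (k : fieldType) (iota : {rmorphism F -> k}).
Variable lam : torus_char F k.
Hypothesis sl : swap_char lam = lam.
Local Notation H := (hecke_comp iota lam).
Local Notation e := (eps_cidem iota lam).
Local Notation pr := (@cproj k (hecke F k) e).
Local Notation S := (cS iota lam).
Local Notation U := (cU iota lam).
Local Notation U' := (cUinv iota lam).
Local Notation z := (cz2 iota lam).
Local Notation z' := (cz2inv iota lam).
Local Notation z1 := (cz1 iota lam).
Local Notation X := (Xnon iota lam).
Local Notation Y := (Yh iota lam).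

Lemma comp1_eps : (1 : H) = pr (eps lam).
Proof. by rewrite comp1E eps_orbitE sl eqxx. Qed.

Lemma cT_non t : cT iota lam t = (lam t)%:A.
Proof.
by rewrite -[LHS]mulr1 comp1_eps /cT -rmorphM hT_eps_scale; apply: cprojZ.
Qed.

Lemma cSS_non : S * S = - S.
Proof.
have -> : S * S = pr (cls (cs_expr F k)) * S.
  by have := congr1 pr (@hSS F k); rewrite !rmorphM.
have -> : pr (cls (cs_expr F k)) = -1.
  rewrite -[LHS]mulr1 comp1_eps -rmorphM cs_eps (torus_sum_nonregular iota sl).
  exact: etrans (cprojZ _ _ _) (scaleN1r _).
by rewrite mulN1r.
Qed.

Lemma non_ind (P : H -> Prop) :
  P S -> P U -> P U' ->
  (forall c : k, P c%:A) -> (forall a b, P a -> P b -> P (a + b)) ->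
  (forall a b, P a -> P b -> P (a * b)) -> forall a, P a.
Proof.
move=> hS hU hU' hc hD hM; apply: hecke_comp_ind => // t.
by rewrite cT_non.
Qed.

Lemma XY0_non : X * Y = 0.
Proof.
by rewrite /Xnon /Yh mulrA -(mulrA U) mulrDl cSS_non mul1r addNr mulr0 mul0r.
Qed.

Lemma z1E : z1 = U * S + U + S * U.
Proof. by rewrite /cz1 /Xnon /Yh mulrDr mulr1. Qed.

(** Both products of z1 with S reduce to S U S because S^2 = -S; those with U agree because U^2
    commutes with S. *)
Lemma z1_central : central z1.
Proof.
have hS : z1 * S = S * z1.
  rewrite z1E !mulrDl !mulrDr [S * (S * U)]mulrA -[U * S * S]mulrA cSS_non mulrN mulNr.
  by rewrite addNr add0r -addrA subrr addr0 mulrA.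
have hU : z1 * U = U * z1.
  rewrite z1E !mulrDl !mulrDr [U * (U * S)]mulrA cUUS -!mulrA.
  by rewrite addrC addrA addrAC [S * _ + _]addrC -!addrA [S * _ + _]addrC.
rewrite /central; apply: non_ind => // [|c|a b ha hb|a b ha hb].
- exact/esym/(comm_inv (cVU _ _) (cUV _ _))/esym.
- by rewrite mulr_algl mulr_algr.
- by rewrite mulrDr ha hb mulrDl.
- by rewrite mulrA ha -mulrA hb mulrA.
Qed.

Lemma YY_non : Y * Y = z1 * Y.
Proof. by rewrite /cz1 mulrDl XY0_non add0r. Qed.

Lemma inHWP : respects (com_rel (@relW k)) (valW z1 z z').
Proof.
apply: com_rel_comm; last by move=> _ _ [] /=; rewrite cz2V scale1r.
by case; case => //=; rewrite /GRing.comm;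
  first [exact: z1_central | exact: cz2_central | exact: cz2inv_central].
Qed.
Lemma inHWm_subproof : {f : {lrmorphism coordW k -> H} | f =1 @inHW _ _ iota lam}.
Proof. by exists (evalW inHWP). Qed.
Definition inHWm := sval inHWm_subproof.
Lemma inHWmK : inHWm =1 @inHW _ _ iota lam.
Proof. exact: (svalP inHWm_subproof). Qed.
Lemma inHWmE : (inHWm cW1 = z1) * (inHWm cW2 = z) * (inHWm cW2inv = z').
Proof. by rewrite !inHWmK; do !split; apply: (pres_eval_gen inHWP). Qed.

Lemma inHW_central a : central (inHWm a).
Proof.
elim/coordW_ind: a => [|||c|a b ha hb|a b ha hb] h.
- by rewrite inHWmE z1_central.
- by rewrite inHWmE cz2_central.
- by rewrite inHWmE cz2inv_central.
- by rewrite linearZ rmorph1 /= mulr_algl mulr_algr.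
- by rewrite raddfD /= mulrDl mulrDr ha hb.
- by rewrite rmorphM /= -mulrA hb mulrA ha mulrA.
Qed.

Definition A_non_elt (n : coordW k * coordW k) : H := inHWm n.1 + inHWm n.2 * Y.
Local Notation inB := A_non_elt.

Lemma inBD m n : inB (m + n) = inB m + inB n.
Proof. by rewrite /A_non_elt /= !raddfD /= mulrDl addrACA. Qed.
(** This is multiplication in Z + Z Y under Y^2 = z1 Y, itself a consequence of X Y = 0. *)
Lemma inBM m n : inB (m.1 * n.1, m.1 * n.2 + m.2 * n.1 + cW1 * m.2 * n.2) = inB m * inB n.
Proof.
rewrite /A_non_elt /= !raddfD /= !rmorphM /= inHWmE.
apply: quadratic_mul; [exact: YY_non|exact: z1_central|exact: inHW_central..].
Qed.

Section Representation.
Variables (R : comAlgType k) (psi : {lrmorphism coordW k -> R}).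
Local Notation w1 := (psi cW1).
Local Notation w2 := (psi cW2).
Local Notation w2' := (psi cW2inv).

(* The spherical action on A in its basis 1, Y over the center. *)
Definition non_gen (g : genH F) : mxalg R :=
  match g with
  | gT t => mx2 (lam t)%:A 0 0 (lam t)%:A
  | gS => mx2 0 0 0 (-1)
  | gU => mx2 w1 (w1 ^+ 2 - w2) (-1) (- w1)
  | gUinv => mx2 (w2' * w1) (w2' * (w1 ^+ 2 - w2)) (- w2') (- (w2' * w1))
  end.

Let ww1 : w2 * w2' = 1. Proof. by rewrite -rmorphM cW2V rmorph1. Qed.

Fact non_gen_respects : respects (@relH F k) non_gen.
Proof.
have hs t : lam (swap t) = lam t by rewrite -[in RHS]sl swap_charE.
move=> _ _ [t u||t|t||||] /=.
- by rewrite mx2M !torus_charM; congr mx2;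
    rewrite ?mulr0 ?mul0r ?addr0 ?add0r // mulr_algl scalerA.
- by rewrite !torus_char1 !scale1r mx2_1.
- by rewrite !mx2M hs; congr mx2; ring.
- by rewrite !mx2M hs; congr mx2; ring.
(* The matrix of U has square w2, so its inverse is w2' times itself; the diagonal entries of the
   product are w2 * w2' = 1. *)
- rewrite mx2M scale1r mx2_1; congr mx2.
  + by rewrite -[RHS]ww1; ring.
  + by ring.
  + by ring.
  + by rewrite -[RHS]ww1; ring.
- rewrite mx2M scale1r mx2_1; congr mx2.
  + by rewrite -[RHS]ww1; ring.
  + by ring.
  + by ring.
  + by rewrite -[RHS]ww1; ring.
- by rewrite !mx2M; congr mx2; ring.
- rewrite expr_eval_cs /= mx2_sum -scaler_suml (torus_sum_nonregular iota sl) scaleN1r.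
  by rewrite !mx2M !big1 //; congr mx2; ring.
Qed.

Fact non_gen_unit : evalH non_gen_respects (eps_orbit lam) = 1.
Proof.
rewrite eps_orbitE sl eqxx /eps linearZ linear_sum /=.
under eq_bigr => t _ do rewrite linearZ /= /evalH (pres_eval_gen non_gen_respects)
  /= mx2Z !scaler0 !scalerA.
rewrite mx2_sum mx2Z -!scaler_suml !char_orth !big1 // !scaler0 eqxx mx2_1.
by rewrite scalerA mulVf ?scale1r // (card_torus_neq0 iota).
Qed.

Lemma non_rep_subproof : {rho : {lrmorphism H -> mxalg R} |
  [/\ rho S = mx2 0 0 0 (-1), rho U = mx2 w1 (w1 ^+ 2 - w2) (-1) (- w1) &
   rho U' = mx2 (w2' * w1) (w2' * (w1 ^+ 2 - w2)) (- w2') (- (w2' * w1))]}.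
Proof.
by exists (hecke_comp_rep iota non_gen_unit); split; apply: hecke_comp_repE.
Qed.
Definition non_rep := sval non_rep_subproof.

Lemma non_repE :
  (non_rep S = mx2 0 0 0 (-1)) * (non_rep U = mx2 w1 (w1 ^+ 2 - w2) (-1) (- w1)) *
  (non_rep U' = mx2 (w2' * w1) (w2' * (w1 ^+ 2 - w2)) (- w2') (- (w2' * w1))).
Proof. by have [] := svalP non_rep_subproof. Qed.

Lemma non_rep_cst c : non_rep c%:A = mx2 c%:A 0 0 c%:A.
Proof. by rewrite linearZ rmorph1 /= mx2_1 mx2Z !scaler0. Qed.

Lemma non_repY : non_rep Y = mx2 0 0 1 w1.
Proof. by rewrite /Yh rmorphM /= !non_repE mx2M; congr mx2; ring. Qed.

Lemma non_rep_inHW a : non_rep (inHWm a) = mx2 (psi a) 0 0 (psi a).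
Proof.
elim/coordW_ind: a => [|||c|a b ha hb|a b ha hb].
- rewrite inHWmE z1E !rmorphD !rmorphM /= !non_repE !mx2M !mx2D.
  by congr mx2; ring.
- by rewrite inHWmE /cz2 rmorphM /= !non_repE !mx2M; congr mx2; ring.
- rewrite inHWmE /cz2inv rmorphM /= !non_repE !mx2M; congr mx2.
  + by transitivity (w2 * w2' * w2'); [ring|rewrite ww1 mul1r].
  + by ring.
  + by ring.
  + by transitivity (w2 * w2' * w2'); [ring|rewrite ww1 mul1r].
- by rewrite linearZ rmorph1 /= non_rep_cst linearZ rmorph1.
- by rewrite !raddfD /= ha hb mx2D !addr0.
- by rewrite !rmorphM /= ha hb mx2M; congr mx2; ring.
Qed.

Lemma non_rep_inB n : non_rep (inB n) = mx2 (psi n.1) 0 (psi n.2) (psi n.1 + psi n.2 * w1).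
Proof.
rewrite /A_non_elt rmorphD rmorphM /= !non_rep_inHW non_repY mx2M mx2D.
by congr mx2; ring.
Qed.
End Representation.

Lemma inB_inj : injective inB.
Proof.
move=> [a b] [c d] /(congr1 (non_rep (idfun : {lrmorphism coordW k -> coordW k}))).
by rewrite !non_rep_inB => /mx2_inj[/= -> _ -> _].
Qed.
End NonregularComponent.

Section Combinations.
Variables (k : fieldType) (A : algType k) (M : lmodType A) (m1 m2 : M).

(** Named so that identities between combinations become, through [congr comb], identities in k
    settled by [ring]. *)
Definition comb (c d : k) : M := c%:A *: m1 + d%:A *: m2.

Lemma combD c d c' d' : comb c d + comb c' d' = comb (c + c') (d + d').
Proof. by rewrite /comb !kscaleDl addrACA. Qed.
Lemma combZ x c d : x%:A *: comb c d = comb (x * c) (x * d).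
Proof. by rewrite /comb scalerDr !kscaleA. Qed.
Lemma combN c d : - comb c d = comb (- c) (- d).
Proof. by rewrite /comb !kscaleN opprD. Qed.
Lemma comb10 : comb 1 0 = m1. Proof. by rewrite /comb kscale1 kscale0 addr0. Qed.
Lemma comb01 : comb 0 1 = m2. Proof. by rewrite /comb kscale1 kscale0 add0r. Qed.
Lemma comb00 : comb 0 0 = 0. Proof. by rewrite /comb !kscale0 addr0. Qed.
Lemma comb_k1 c : c%:A *: m1 = comb c 0.
Proof. by rewrite /comb kscale0 addr0. Qed.
Lemma comb_k2 c : c%:A *: m2 = comb 0 c.
Proof. by rewrite /comb kscale0 add0r. Qed.
Lemma comb_lin a c d : a *: comb c d = c%:A *: (a *: m1) + d%:A *: (a *: m2).
Proof. by rewrite /comb scalerDr (kscaleC c) (kscaleC d). Qed.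
Lemma comb_inj c d c' d' : kfree2 m1 m2 -> comb c d = comb c' d' -> c = c' /\ d = d'.
Proof.
move=> hf /eqP; rewrite -subr_eq0 combN combD => /eqP/hf[/eqP h1 /eqP h2].
by move: h1 h2; rewrite !subr_eq0 => /eqP-> /eqP->.
Qed.
End Combinations.

(** * The spherical modules of a non-regular orbit *)

Section NonregularModules.
Variables (F : finFieldType) (k : fieldType) (iota : {rmorphism F -> k}).
Variable lam : torus_char F k.
Hypothesis sl : swap_char lam = lam.
Local Notation H := (hecke_comp iota lam).
Local Notation S := (cS iota lam).
Local Notation U := (cU iota lam).
Local Notation U' := (cUinv iota lam).
Local Notation Y := (Yh iota lam).
Local Notation rep := (non_rep iota sl).
Local Notation inB := (A_non_elt iota sl).
Local Notation inHWm := (inHWm iota sl).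

Lemma non_acts (v : k * k) (hv : ptsW v) (M : lmodType H) (m1 m2 : M) :
  S *: m1 = 0 -> S *: m2 = - m2 ->
  U *: m1 = comb m1 m2 v.1 (-1) -> U *: m2 = comb m1 m2 (v.1 ^+ 2 - v.2) (- v.1) ->
  forall a, acts_by (rep (atWm hv)) m1 m2 a.
Proof.
move=> hS1 hS2 hU1 hU2.
have UV (m : M) : U' *: (U *: m) = m by rewrite scalerA cVU scale1r.
have v2 : v.2 != 0 by [].
apply: (non_ind sl).
- apply: (acts_byI (p := 0) (q := 0) (r := 0) (s := -1)).
  + by rewrite non_repE.
  + by rewrite hS1 !kscale0 addr0.
  + by rewrite hS2 kscaleN kscale0 kscale1 add0r.
- apply: (acts_byI (p := v.1) (q := v.1 ^+ 2 - v.2) (r := -1) (s := - v.1)) => //.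
  by rewrite non_repE !atWE.
- apply: (acts_byI (p := v.2^-1 * v.1) (q := v.2^-1 * (v.1 ^+ 2 - v.2))
      (r := - v.2^-1) (s := - (v.2^-1 * v.1))).
  + by rewrite non_repE !atWE.
  (* Since U^2 acts by v.2 on the span, v.2 m1 = U (U m1); applying the inverse of U gives its value
     on m1, and likewise on m2 below. *)
  + rewrite -[LHS]kscale1 -(mulVf v2) -kscaleA.
    have -> : v.2%:A *: (U' *: m1) = U' *: (v.2%:A *: m1) by rewrite kscaleC.
    have -> : v.2%:A *: m1 = U *: comb m1 m2 v.1 (-1).
      rewrite comb_lin hU1 hU2 !combZ combD -[in LHS](comb10 m1 m2) combZ.
      by congr comb; ring.
    by rewrite UV combZ; congr (_%:A *: _ + _%:A *: _); ring.
  + rewrite -[LHS]kscale1 -(mulVf v2) -kscaleA.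
    have -> : v.2%:A *: (U' *: m2) = U' *: (v.2%:A *: m2) by rewrite kscaleC.
    have -> : v.2%:A *: m2 = U *: comb m1 m2 (v.1 ^+ 2 - v.2) (- v.1).
      rewrite comb_lin hU1 hU2 !combZ combD -[in LHS](comb01 m1 m2) combZ.
      by congr comb; ring.
    by rewrite UV combZ; congr (_%:A *: _ + _%:A *: _); ring.
- exact: acts_by_cst.
- by move=> a b; apply: acts_by_add.
- by move=> a b; apply: acts_by_mul.
Qed.

Lemma inB_inHW a : inB (a, 0) = inHWm a.
Proof. by rewrite /A_non_elt /= rmorph0 mul0r addr0. Qed.
Lemma inB1 : inB (1, 0) = 1. Proof. by rewrite inB_inHW rmorph1. Qed.
Lemma inBY : inB (0, 1) = Y.
Proof. by rewrite /A_non_elt /= rmorph0 rmorph1 mul1r add0r. Qed.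

Lemma A_nonP a : @A_non _ _ iota lam a <-> exists n, inB n = a.
Proof.
split=> [h|[n <-]].
  have /asboolP : a \in [pred a | `[< exists n, inB n = a >]]; last by [].
  apply: h.
    split=> [|c u w|u w]; rewrite !inE.
    - by apply/asboolP; exists (1, 0); apply: inB1.
    - move=> /asboolP[m <-] /asboolP[n <-]; apply/asboolP.
      exists ((c *: m.1, c *: m.2) + n).
      by rewrite inBD; congr (_ + _); rewrite /A_non_elt !linearZ scalerDr scalerAl.
    - move=> /asboolP[m <-] /asboolP[n <-]; apply/asboolP.
      by eexists; apply: inBM.
  move=> b; rewrite !inE => /or4P[]/eqP->; apply/asboolP.
  (* X is z1 - Y. *)
  - exists (cW1, -1); rewrite /A_non_elt /= inHWmE raddfN /= rmorph1 mulN1r.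
    by rewrite /cz1 addrK.
  - by exists (0, 1); apply: inBY.
  - by exists (cW2, 0); rewrite inB_inHW inHWmE.
  - by exists (cW2inv, 0); rewrite inB_inHW inHWmE.
move=> P [P1 Pl PM] PG.
have P0 : 0 \in P by rewrite -(subrr 1) -scaleN1r addrC Pl.
have PZ c u : u \in P -> c *: u \in P by move=> hu; rewrite -[_ *: _]addr0 Pl.
have PD u w : u \in P -> w \in P -> u + w \in P.
  by move=> hu hw; rewrite -[u]scale1r Pl.
have PW b : inHWm b \in P.
  elim/coordW_ind: b => [|||c|b d hb hd|b d hb hd].
  - by rewrite inHWmE /cz1 PD // PG // !inE eqxx ?orbT.
  - by rewrite inHWmE PG // !inE eqxx ?orbT.
  - by rewrite inHWmE PG // !inE eqxx ?orbT.
  - by rewrite linearZ rmorph1 /= PZ.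
  - by rewrite raddfD PD.
  - by rewrite rmorphM PM.
by rewrite /A_non_elt PD // PM // PG // !inE eqxx ?orbT.
Qed.

Lemma inHW_A a : @A_non _ _ iota lam (inHWm a).
Proof. by apply/A_nonP; exists (a, 0); apply: inB_inHW. Qed.

Section Quotient.
Variables (v : k * k) (hv : ptsW v) (N M : lmodType H) (j : N -> H).
Variable f : {linear N -> M}.
Hypothesis hj : spherical_action_non j.
Hypothesis f_surj : forall m, exists n, f n = m.
Hypothesis f_ker : forall n, f n = 0 <->
  exists p (c : 'I_p -> H) (x : 'I_p -> N),
    (forall i, ker_theta_non v (c i)) /\ n = \sum_i c i *: x i.

Let jD : {morph j : m n / m + n}. Proof. by case: hj => -[]. Qed.
Let j_inj : injective j. Proof. by case: hj => -[]. Qed.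
Let jA a : @A_non _ _ iota lam a <-> exists n, j n = a. Proof. by case: hj => -[]. Qed.
Let jM a n : @A_non _ _ iota lam a -> j (a *: n) = a * j n.
Proof. by case: hj => -[_ _ _ h] _ _ _; apply: h. Qed.

Lemma non_theta a n : f (inHWm a *: n) = (atW v a)%:A *: f n.
Proof.
pose c := atW v a.
have hc : inHWm (a - c%:A) = inHWm a - c%:A.
  by rewrite linearB linearZ rmorph1.
apply/eqP; rewrite -subr_eq0 -linearZ -linearB -scalerBl -hc; apply/eqP/f_ker.
exists 1%N, (fun=> inHWm (a - c%:A)), (fun=> n); split=> [_|].
  exists (a - c%:A); first by rewrite inHWmK.
  rewrite -(atWmE hv) linearB linearZ rmorph1 /= atWmE.
  by rewrite [_ *: (_ : k^o)]mulr1 subrr.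
by rewrite big_ord1.
Qed.

(** The basis consists of the images of 1 and Y. Independence is again seen on matrices at v: the
    first column of the matrix of c + d Y is (c, d), and elements of the kernel of theta_v become
    0. *)
Lemma non_quotient_models : exists m1 m2 : M, models (rep (atWm hv)) m1 m2.
Proof.
have [_ _ h1 h2] := hj.
have [n1 jn1] : exists n, j n = 1 by apply/jA/A_nonP; exists (1, 0); apply: inB1.
have [n2 jn2] : exists n, j n = Y by apply/jA/A_nonP; exists (0, 1); apply: inBY.
have jZ a n : j (inHWm a *: n) = inHWm a * j n by apply: jM; apply: inHW_A.
have Ac (c : k) : @A_non _ _ iota lam c%:A.
  by apply/A_nonP; exists (c%:A, 0); rewrite inB_inHW linearZ rmorph1.
have [jS1 jU1] := h1 _ jn1; have [jS2 jU2] := h2 _ jn2.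
have Z1 : inHWm 1 = 1 by rewrite rmorph1.
have j0 : j 0 = 0 by apply: (addrI (j 0)); rewrite -jD !addr0.
have Sn1 : S *: n1 = 0 by apply: j_inj; rewrite jS1 j0.
have Sn2 : S *: n2 = inHWm (-1) *: n2.
  by apply: j_inj; rewrite jZ jS2 jn2 raddfN /= Z1 mulN1r.
have Un1 : U *: n1 = inHWm cW1 *: n1 + inHWm (-1) *: n2.
  by apply: j_inj; rewrite jD !jZ jU1 jn1 jn2 raddfN /= Z1 mulN1r inHWmE mulr1.
have Un2 : U *: n2 = inHWm (cW1 ^+ 2 - cW2) *: n1 + inHWm (- cW1) *: n2.
  apply: j_inj; rewrite jD !jZ jU2 jn1 jn2 mulr1 !raddfN raddfB /= rmorphXn /=.
  by rewrite !inHWmE mulNr.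
have fZ a n : a *: f n = f (a *: n) by rewrite linearZ.
have atWN : atW v (-1) = -1 by rewrite -(atWmE hv) raddfN /= rmorph1.
exists (f n1), (f n2); split.
- move=> m; have [n <-] := f_surj m.
  have [[a b] hab] : exists n0, inB n0 = j n by apply/A_nonP/jA; exists n.
  have -> : n = inHWm a *: n1 + inHWm b *: n2.
    by apply: j_inj; rewrite jD !jZ jn1 jn2 -hab mulr1.
  by exists (atW v a), (atW v b); rewrite linearD !non_theta.
- move=> c d; rewrite !fZ -raddfD => /f_ker[p [cs [xs [hcs /(congr1 j)]]]].
  have jsum (s : seq 'I_p) : j (\sum_(i <- s) cs i *: xs i) =
      \sum_(i <- s) cs i * j (xs i).
    elim: s => [|i s ih]; first by rewrite !big_nil.
    rewrite !big_cons jD ih; congr (_ + _).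
    by have [a -> _] := hcs i; rewrite -inHWmK jZ.
  rewrite jD !jM // jn1 jn2 jsum mulr1 => /(congr1 (rep (atWm hv))).
  rewrite mulr_algl raddfD /= !linearZ /= rmorph1 non_repY mx2_1 !mx2Z mx2D.
  rewrite rmorph_sum big1 => [|i _]; last first.
    have [a -> ha] := hcs i; rewrite rmorphM /= -inHWmK non_rep_inHW.
    by rewrite /= atWmE ha -mx2_0 mul0r.
  rewrite !scaler0 !addr0 !add0r mx2_0 => /mx2_inj[].
  by rewrite ![_ *: (_ : k^o)]mulr1.
- apply: non_acts.
  + by rewrite fZ Sn1 linear0.
  + by rewrite fZ Sn2 non_theta atWN kscaleN kscale1.
  + by rewrite fZ Un1 linearD !non_theta atWN /comb -(atWmE hv) atWE.
  + rewrite fZ Un2 linearD !non_theta /comb -!(atWmE hv) raddfB raddfN /=.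
    by rewrite rmorphXn /= !atWE.
Qed.
End Quotient.

Local Notation N0 := (column_module (rep (idfun : {lrmorphism coordW k -> coordW k}))).

Lemma column_inB (n : coordW k * coordW k) (u : N0) :
  inB n *: u = (n.1 * u.1, n.2 * u.1 + (n.1 + n.2 * cW1) * u.2) :> N0.
Proof.
rewrite column_moduleE /col_act non_rep_inB !mx2E /=.
by rewrite !mul0r addr0.
Qed.

Lemma column_ZW a (u : N0) : inHWm a *: u = (a * u.1, a * u.2) :> N0.
Proof. by rewrite -inB_inHW column_inB /= !mul0r addr0 add0r. Qed.

Lemma column_S_non (u : N0) : S *: u = (0, - u.2) :> N0.
Proof.
by rewrite column_moduleE /col_act non_repE !mx2E !mul0r addr0 add0r mulN1r.
Qed.
Lemma column_U_non (u : N0) :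
  U *: u = (cW1 * u.1 + (cW1 ^+ 2 - cW2) * u.2, - u.1 - cW1 * u.2) :> N0.
Proof.
by rewrite column_moduleE /col_act non_repE !mx2E mulN1r mulNr.
Qed.

Lemma spherical_action_inB : @spherical_action_non _ _ iota lam N0 inB.
Proof.
split.
- split; first exact: inBD.
  + exact: inB_inj.
  + exact: A_nonP.
  + move=> a u /A_nonP[n <-]; rewrite column_inB -inBM; congr (inB (_, _)).
    by rewrite /=; ring.
- split=> _ u [a ->]; rewrite -inHWmK.
    by rewrite !column_ZW !column_S_non /=; congr (_, _) => /=; ring.
  by rewrite !column_ZW !column_U_non /=; congr (_, _) => /=; ring.
- move=> n; rewrite -inB1 => /(@inB_inj _ _ iota _ sl)->.
  rewrite column_S_non column_U_non /= oppr0 !mulr0 mulr1 addr0 subr0.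
  rewrite /A_non_elt /= raddfN /= rmorph0 rmorph1 inHWmE mul0r addr0; split=> //.
  by rewrite mulN1r.
- move=> n; rewrite -[in X in X -> _]inBY => /(@inB_inj _ _ iota _ sl)->.
  rewrite column_S_non column_U_non /= oppr0 !mulr0 !mulr1 !add0r.
  rewrite /A_non_elt /= !raddfN raddfB /= rmorph0 rmorph1 rmorphXn /= !inHWmE.
  by rewrite !mulNr mul1r add0r.
Qed.

Section Specialization.
Variables (v : k * k) (hv : ptsW v).
Local Notation M0 := (column_module (rep (atWm hv))).

Lemma non_rep_specialize a :
  rep (atWm hv) a = mx2 (atWm hv (rep idfun a 0 0)) (atWm hv (rep idfun a 0 1))
                        (atWm hv (rep idfun a 1 0)) (atWm hv (rep idfun a 1 1)).
Proof.
elim/(@non_ind _ _ iota _ sl): a => [|||c|a b ha hb|a b ha hb].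
- by rewrite !non_repE !mx2E raddfN /= rmorph0 rmorph1.
- by rewrite !non_repE !mx2E raddfB !raddfN /= rmorphXn /= rmorph1.
- rewrite !non_repE !mx2E; congr mx2; by rewrite ?raddfN /= ?rmorphM /= ?raddfB /= ?rmorphXn.
- by rewrite !non_rep_cst !mx2E linearZ rmorph1 rmorph0.
- by rewrite !rmorphD /= ha hb mx2D !mxalgDE !rmorphD.
- by rewrite !rmorphM /= ha hb mx2M !mxalgME !rmorphD !rmorphM.
Qed.

Definition specialize_non (u : N0) : M0 := (atWm hv u.1, atWm hv u.2).

Fact specialize_non_linear : linear specialize_non.
Proof.
move=> a u w; rewrite /specialize_non !column_moduleE /col_act /=.
by rewrite non_rep_specialize !mx2E !rmorphD !rmorphM.
Qed.

Lemma Sph_non_column : Sph_non v M0.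
Proof.
exists N0, inB; split; first exact: spherical_action_inB.
exists (mklinear specialize_non_linear); split=> [[c d]|[a b]] /=.
  exists ((c : k)%:A, (d : k)%:A); rewrite /specialize_non !linearZ !rmorph1 /=.
  by rewrite ![_ *: (_ : k^o)]mulr1.
split=> [[ha hb]|[p [c [x [hc ->]]]]].
  exists 2%N, (fun i => if i == 0 then inHWm a else inHWm b).
  exists (fun i => if i == 0 then (1, 0) : N0 else (0, 1) : N0); split.
    by move=> i; case: ifP => _; [exists a|exists b]; rewrite ?inHWmK // -(atWmE hv).
  rewrite sum2E /= !column_ZW /= !mulr0 !mulr1.
  by congr (_, _); rewrite /= ?addr0 ?add0r.
rewrite -[specialize_non]/(mklinear specialize_non_linear : _ -> _) linear_sum.
rewrite big1 // => i _; have [a' -> ha'] := hc i.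
by rewrite -inHWmK /= column_ZW /specialize_non /= !rmorphM /= atWmE ha' !mul0r.
Qed.
End Specialization.
End NonregularModules.

(** * Simple modules and characters for a non-regular orbit *)

Section NonregularClassification.
Variables (F : finFieldType) (k : fieldType) (iota : {rmorphism F -> k}).
Variable lam : torus_char F k.
Hypothesis sl : swap_char lam = lam.
Local Notation H := (hecke_comp iota lam).
Local Notation S := (cS iota lam).
Local Notation U := (cU iota lam).
Local Notation U' := (cUinv iota lam).
Local Notation z := (cz2 iota lam).
Local Notation z1 := (cz1 iota lam).
Local Notation rep := (non_rep iota sl).
Local Notation inHWm := (inHWm iota sl).

Lemma eigen_line (M : lmodType H) (m : M) (s u : k) :
  S *: m = s%:A *: m -> U *: m = u%:A *: m -> forall a, exists c : k, a *: m = c%:A *: m.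
Proof.
move=> hS hU; apply: (non_ind sl) => [||||a b [c ha] [d hb]|a b [c ha] [d hb]].
- by exists s.
- by exists u.
- have UV : U' *: (U *: m) = m by rewrite scalerA cVU scale1r.
  have [u0|u0] := eqVneq u 0.
    by exists 0; rewrite -UV hU u0 kscale0 !scaler0.
  exists u^-1; rewrite -[LHS]kscale1 -(mulVf u0) -kscaleA; congr (_ *: _).
  by rewrite kscaleC -hU.
- by move=> c; exists c.
- by exists (c + d); rewrite scalerDl ha hb kscaleDl.
- by exists (c * d); rewrite -(scalerA a b) hb -kscaleC ha kscaleA mulrC.
Qed.

Lemma simple_line (M : lmodType H) (m : M) (s u : k) : simple M -> m != 0 ->
  S *: m = s%:A *: m -> U *: m = u%:A *: m -> forall n, exists c : k, n = c%:A *: m.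
Proof.
move=> sM m0 hS hU; apply: simple_ind => //.
- by exists 0; rewrite kscale0.
- move=> a _ _ [c ->] [d ->]; have [b hb] := eigen_line hS hU a.
  by exists (c * b + d); rewrite -kscaleC hb kscaleA kscaleDl.
- by exists m => //; exists 1; rewrite kscale1.
Qed.

Section OneModel.
Variables (v : k * k) (hv : ptsW v) (M : lmodType H) (m1 m2 : M).
Hypothesis hm : models (rep (atWm hv)) m1 m2.

Lemma non_models_act : [/\ S *: m1 = 0, S *: m2 = - m2, U *: m1 = comb m1 m2 v.1 (-1) &
  U *: m2 = comb m1 m2 (v.1 ^+ 2 - v.2) (- v.1)].
Proof.
have [_ _ ha] := hm.
have ES : rep (atWm hv) S = mx2 (0 : k^o) 0 0 (-1) by rewrite non_repE.
have EU : rep (atWm hv) U = mx2 (v.1 : k^o) (v.1 ^+ 2 - v.2) (-1) (- v.1).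
  by rewrite non_repE !atWE.
have [-> ->] := acts_byE ES (ha _); have [-> ->] := acts_byE EU (ha _).
by split; rewrite // ?kscale0 ?addr0 ?kscaleN ?kscale1 ?add0r.
Qed.

Lemma non_models_inHW a (m : M) : inHWm a *: m = (atW v a)%:A *: m.
Proof.
have [hs _ ha] := hm; have [c [d ->]] := hs m.
have E : rep (atWm hv) (inHWm a) = mx2 (atW v a : k^o) 0 0 (atW v a).
  by rewrite non_rep_inHW atWmE.
have [h1 h2] := acts_byE E (ha _).
rewrite -!/(comb m1 m2 _ _) comb_lin h1 h2 combZ -!/(comb m1 m2 _ _) !combZ combD.
by congr comb; ring.
Qed.

(** In a submodule, S isolates a nonzero m2 component, and m2 yields U m2 + z1 m2 = (z1^2 - z2) m1,
    a nonzero multiple of m1 off the parabola. Without an m2 component, m1 is present and yields m2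
    = z1 m1 - U m1. *)
Lemma non_models_simple : v.2 != v.1 ^+ 2 -> simple M.
Proof.
move=> hd; have [hs hf _] := hm; have [hS1 hS2 hU1 hU2] := non_models_act.
apply: (simpleI hs hf) => N Nsub c d hcd hN.
have N2 : d != 0 -> m2 \in N.
  move=> d0; have d0' : - d != 0 by rewrite oppr_eq0.
  apply: (submodKZ Nsub d0'); have := submodZ Nsub S hN.
  rewrite scalerDr -(kscaleC c) -(kscaleC d) hS1 hS2 scaler0 add0r scalerN.
  by rewrite kscaleN.
have [d0|d0] := eqVneq d 0.
  rewrite d0 eqxx orbF in hcd; rewrite d0 kscale0 addr0 in hN.
  have m1N := submodKZ Nsub hcd hN; split=> //.
  have -> : m2 = v.1%:A *: m1 + (-1) *: (U *: m1).
    rewrite hU1 scaleN1r combN (comb_k1 m1 m2) combD -[LHS](comb01 m1 m2).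
    by congr comb; ring.
  by apply: submodD => //; do ?apply: submodZ.
have m2N := N2 d0; split=> //.
have h : v.1 ^+ 2 - v.2 != 0 by rewrite subr_eq0 eq_sym.
apply: (submodKZ Nsub h).
have -> : (v.1 ^+ 2 - v.2)%:A *: m1 = U *: m2 + v.1%:A *: m2.
  rewrite hU2 (comb_k1 m1 m2) (comb_k2 m1 m2) combD.
  by congr comb; ring.
by apply: submodD => //; do ?apply: submodZ.
Qed.

(** The generator is m2, an eigenvector of S for -1: at z1 = 0 one has U m2 = - z2 m1, and S kills
    m1. *)
Lemma non_models_standard : v.1 = 0 -> standard_module 0 v.2 M.
Proof.
move=> v10; have [hs hf _] := hm; have [hS1 hS2 hU1 hU2] := non_models_act.
have v2 : v.2 != 0 by [].
exists m2; rewrite hU2 v10 expr0n sub0r oppr0.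
have E : comb m1 m2 (- v.2) 0 = (- v.2)%:A *: m1 by rewrite /comb kscale0 addr0.
rewrite E; split=> //.
- apply: (@kbasis2I _ _ _ m2 ((- v.2)%:A *: m1)) => [m|c d].
    have [c [d ->]] := hs m; exists d, (c * - v.2^-1).
    by rewrite kscaleA mulrN -mulNr mulrN opprK mulfVK // addrC.
  rewrite kscaleA addrC => /hf[/eqP h ->]; split=> //; apply/eqP.
  by move: h; rewrite mulf_eq0 oppr_eq0 (negPf v2) orbF.
- by rewrite -kscaleC hS1 scaler0 kscale0.
- rewrite -kscaleC hU1 v10 combZ -[m2 in RHS](comb01 m1 m2) combZ.
  by congr comb; ring.
Qed.
End OneModel.

Lemma non_models_point v v' (hv : ptsW v) (hv' : ptsW v') (M M' : lmodType H)
    (m1 m2 : M) (m1' m2' : M') :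
  models (rep (atWm hv)) m1 m2 -> models (rep (atWm hv')) m1' m2' ->
  isomorphic M M' -> v = v'.
Proof.
move=> hm hm' [f /bij_inj finj].
have [_ hf ha] := hm.
have fm0 : f m1 != 0.
  by rewrite -(linear0 f) (inj_eq finj); case: (kfree2_neq0 hf).
have h a : atW v a = atW v' a.
  apply: (kscale_inj fm0).
  have fZ b : b *: f m1 = f (b *: m1) by rewrite linearZ.
  by rewrite fZ -(non_models_inHW hm) -fZ (non_models_inHW hm').
have := h cW1; have := h cW2.
rewrite -!(atWmE hv) -!(atWmE hv') !atWE.
by case: v v' {h hv hv' hm hm' ha} => [? ?] [? ?] /= -> ->.
Qed.

(** A vector killed by S plays the role of 1 in A; the rest of the basis is then forced. *)
Lemma non_models_of_kernel (M : lmodType H) (c d : k) (m1 : M) :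
  simple M -> has_kdim M 2 ->
  (forall m : M, z *: m = c%:A *: m) -> (forall m : M, z1 *: m = d%:A *: m) ->
  m1 != 0 -> S *: m1 = 0 ->
  exists (hv : ptsW (d, c)) (m2 : M), models (rep (atWm hv)) m1 m2 /\ c != d ^+ 2.
Proof.
move=> sM dM hz hd m10 hS1.
have c0 : c != 0.
  apply: contra m10 => /eqP c0; rewrite -[m1]scale1r -(cz2VV iota lam) -scalerA.
  by rewrite hz c0 kscale0 scaler0.
have hv : ptsW (d, c) by [].
(* Forced by the formula U 1 = z1 - Y. Since z1 = U S + U + S U and S m1 = 0, this vector is also S
   U m1, whence S m2 = - m2. *)
pose m2 := d%:A *: m1 - U *: m1.
have SU : S *: (U *: m1) = m2.
  rewrite /m2 -hd z1E !scalerDl -!scalerA hS1 scaler0 add0r.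
  by rewrite [in RHS]addrC addKr.
have hS2 : S *: m2 = - m2.
  rewrite {1}/m2 scalerBr -kscaleC hS1 scaler0 sub0r SU //.
have hU1 : U *: m1 = comb m1 m2 d (-1).
  by rewrite /comb kscaleN kscale1 /m2 opprB addrC subrK.
have hU2 : U *: m2 = comb m1 m2 (d ^+ 2 - c) (- d).
  rewrite {1}/m2 scalerBr -kscaleC [U *: (U *: _)]scalerA -/(cz2 iota lam) hz hU1.
  rewrite combZ -[X in c%:A *: X](comb10 m1 m2) combZ combN combD.
  by congr comb; ring.
exists hv, m2.
have acts : forall a, acts_by (rep (atWm hv)) m1 m2 a by apply: non_acts.
have m20 : m2 != 0.
  (* If m2 = 0 then m1 is a common eigenvector of S and U, and M is the line it spans. *)
  apply/eqP => m20; apply: (simple_dim2N1 dM (m := m1)).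
  apply: (@simple_line M m1 0 d) => //; first by rewrite hS1 kscale0.
  by rewrite hU1 /comb m20 scaler0 addr0.
have free : kfree2 m1 m2.
  move=> p q h.
  have q0 : q = 0.
    apply: (kscale_coef0 m20); apply/eqP; rewrite -oppr_eq0 -scalerN -hS2.
    have := congr1 (fun m => S *: m) h.
    by rewrite scaler0 scalerDr -(kscaleC p) hS1 scaler0 add0r -kscaleC => ->.
  split=> //; move: h; rewrite q0 kscale0 addr0; exact: kscale_coef0.
split; first by split=> //; apply: simple_kspan2 sM m10 acts.
(* On the parabola U m2 has no component along m1, so m2 spans a stable line, which by simplicity
   contains m1. *)
apply/eqP => cd.
have [p hp] : exists p : k, m1 = p%:A *: m2.
  apply: (@simple_line M m2 (-1) (- d)) => //.
    by rewrite hS2 kscaleN kscale1.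
  by rewrite hU2 /comb cd subrr kscale0 add0r.
have [|/eqP] := free 1 (- p); last by rewrite oner_eq0.
by rewrite kscale1 kscaleN -hp subrr.
Qed.

(** S (S + 1) = 0, so the image of S + 1 is killed by S. If that image is zero, S acts by -1, hence
    z1 acts as -U; then U is a scalar and M is a line. *)
Lemma non_kernel (M : lmodType H) (d : k) : simple M -> has_kdim M 2 ->
  (forall m : M, z1 *: m = d%:A *: m) -> exists2 m1 : M, m1 != 0 & S *: m1 = 0.
Proof.
move=> sM dM hd.
have [[n hn]|h] := pselect (exists n : M, S *: n + n != 0).
  exists (S *: n + n) => //.
  by rewrite scalerDr scalerA (cSS_non iota sl) scaleNr addNr.
have hS (n : M) : S *: n = - n.
  apply/eqP; rewrite -addr_eq0; apply: contrapT => hn; apply: h; exists n.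
  exact/negP.
have [m m0] := sM.1.
case: (simple_dim2N1 dM (m := m)).
apply: (@simple_line M m (-1) (- d)) => //.
  by rewrite hS kscaleN kscale1.
rewrite kscaleN -hd z1E !scalerDl -!scalerA !hS scalerN addNr add0r opprK //.
Qed.

Section Characters.
Variables (s u : k) (hs : s * s = - s) (hu : u != 0).

Definition char_gen (g : genH F) : k^o :=
  match g with gT t => lam t | gS => s | gU => u | gUinv => u^-1 end.

Fact char_gen_respects : respects (@relH F k) char_gen.
Proof.
have hsw t : lam (swap t) = lam t by rewrite -[in RHS]sl swap_charE.
move=> _ _ [t w||t|t||||] /=.
- by rewrite torus_charM.
- by rewrite torus_char1 [LHS]/1 [RHS]mulr1.
- by rewrite hsw mulrC.
- by rewrite hsw mulrC.
- by rewrite mulfV // [RHS]mulr1.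
- by rewrite mulVf // [RHS]mulr1.
- by rewrite mulrC.
- by rewrite expr_eval_cs /= (torus_sum_nonregular iota sl) hs mulN1r.
Qed.

Fact char_gen_unit : evalH char_gen_respects (eps_orbit lam) = 1.
Proof.
rewrite eps_orbitE sl eqxx /eps linearZ linear_sum /=.
under eq_bigr => t _ do rewrite linearZ /= /evalH (pres_eval_gen char_gen_respects) /=.
have := char_orth lam lam; rewrite eqxx => h.
by rewrite [X in _ *: X]h [LHS]mulVf // (card_torus_neq0 iota).
Qed.

Lemma hecke_char : exists chi : {lrmorphism H -> k^o}, chi S = s /\ chi U = u.
Proof.
by exists (hecke_comp_rep iota char_gen_unit); split; apply: hecke_comp_repE.
Qed.
End Characters.

Lemma hecke_char_eq (chi chi' : {lrmorphism H -> k^o}) :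
  chi S = chi' S -> chi U = chi' U -> chi =1 chi'.
Proof.
move=> hS hU; apply: (non_ind sl) => // [|c|a b ha hb|a b ha hb].
- have h (f : {lrmorphism H -> k^o}) : (f U : k) * f U' = 1.
    by rewrite -[RHS](rmorph1 f) -(cUV iota lam) rmorphM.
  have u0 : (chi U : k) != 0.
    by apply: contra_eq_neq (h chi) => ->; rewrite mul0r eq_sym oner_neq0.
  by apply: (mulfI u0); rewrite [LHS]h hU [RHS]h.
- by rewrite !linearZ !rmorph1.
- by rewrite !raddfD /= ha hb.
- by rewrite !rmorphM /= ha hb.
Qed.
End NonregularClassification.

(** * Modules given by characters, and short composition series *)

Section CharacterModule.
Variables (k : fieldType) (A : algType k) (chi : {lrmorphism A -> k^o}).

Fact char_actM a b (v : k) : (chi a : k) * ((chi b : k) * v) = (chi (a * b) : k) * v.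
Proof. by rewrite rmorphM mulrA. Qed.
Fact char_act1 : left_id 1 (fun a (v : k) => (chi a : k) * v).
Proof. by move=> v /=; rewrite rmorph1 mul1r. Qed.
Fact char_actDr : right_distributive (fun a (v : k) => (chi a : k) * v) +%R.
Proof. by move=> a u v /=; rewrite mulrDr. Qed.
Fact char_actDl v : {morph (fun a => (chi a : k) * v) : a b / a + b}.
Proof. by move=> a b /=; rewrite raddfD mulrDl. Qed.
Definition char_action := RingAction char_actM char_act1 char_actDr char_actDl.
Definition char_module : lmodType A := acted_on char_action.

Lemma char_moduleE a (v : char_module) : a *: v = (chi a : k) * (v : k).
Proof. by []. Qed.

Lemma char_kscale (c : k) (v : char_module) : c%:A *: v = c * (v : k).
Proof. by rewrite char_moduleE linearZ rmorph1 /= [_ *: (_ : k^o)]mulr1. Qed.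

Lemma char_module_simple : simple char_module.
Proof.
split; first by exists (1 : k); apply: oner_neq0.
move=> N Nsub; have [h|] := pselect {in N, forall m, m = 0}; first by left.
move=> n0; right => m; rewrite inE.
have /existsNP[n /not_implyP[nN /eqP hn]] := n0.
have -> : m = ((m : k) / (n : k))%:A *: n by rewrite char_kscale mulfVK.
exact: submodZ.
Qed.

Lemma char_module_affords : affords char_module chi.
Proof.
split=> [|a l]; last by rewrite char_kscale.
exists (fun=> (1 : k)) => m; exists [ffun=> (m : k)]; split.
  by rewrite big_ord1 char_kscale ffunE mulr1.
move=> c; rewrite big_ord1 char_kscale mulr1 => ->.
by apply/ffunP => i; rewrite ffunE (ord1 i).
Qed.

Lemma affords_generator (L : lmodType A) : affords L chi -> exists l : L, l != 0.
Proof.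
move=> [[b hb] _]; exists (b ord0); apply/eqP => b0.
have [c [_ hu]] := hb 0.
have e1 := hu [ffun=> 1]; have e2 := hu [ffun=> 0].
rewrite !big_ord1 !b0 !scaler0 in e1 e2.
have : [ffun=> 1] = [ffun=> 0] :> {ffun 'I_1 -> k} by rewrite -e1 // -e2.
by move/ffunP => /(_ 0); rewrite !ffunE => /eqP; rewrite oner_eq0.
Qed.
End CharacterModule.

Lemma jordan_holder1 (k : fieldType) (A : algType k) (M L : lmodType A) :
  jordan_holder M [:: L] ->
  exists g : {linear M -> L}, injective g /\ forall l, exists m, g m = l.
Proof.
move=> h; inversion h as [|M' N L' s f g finj gsurj gker sL hN]; subst.
inversion hN as [M' N0|]; subst.
exists g; split=> // x y exy.
have /gker[n fn] : g (x - y) = 0 by rewrite linearB /= exy subrr.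
by apply/eqP; rewrite -subr_eq0 -fn (N0 n) linear0.
Qed.

Lemma jordan_holder2 (k : fieldType) (A : algType k) (M L L' : lmodType A) :
  jordan_holder M [:: L; L'] ->
  exists (N : lmodType A) (f : {linear N -> M}) (g : {linear M -> L}),
    [/\ injective f, forall l, exists m, g m = l,
        forall m, g m = 0 <-> exists n, f n = m & jordan_holder N [:: L']].
Proof.
move=> h; inversion h as [|M' N L'' s f g finj gsurj gker sL hN]; subst.
by exists N, f, g.
Qed.

Lemma parabola_neq0 (k : fieldType) (v : k * k) :
  ptsW v -> v.2 = v.1 ^+ 2 -> v.1 != 0.
Proof.
by move=> hv hd; apply: contraTneq hv => v10; rewrite /ptsW hd v10 expr0n eqxx.
Qed.

Section NonregularBijections.
Variables (F : finFieldType) (k : closedFieldType) (iota : {rmorphism F -> k}).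
Variable lam : torus_char F k.
Hypothesis sl : swap_char lam = lam.
Local Notation H := (hecke_comp iota lam).
Local Notation S := (cS iota lam).
Local Notation U := (cU iota lam).
Local Notation rep := (non_rep iota sl).

Lemma Sph_non_models v (hv : ptsW v) (M : lmodType H) : Sph_non v M ->
  exists m1 m2 : M, models (rep (atWm hv)) m1 m2.
Proof. by case=> N [j [hj [f [fs fk]]]]; apply: non_quotient_models hj fs fk. Qed.

Lemma Sph_non_eq v v' (M M' : lmodType H) : ptsW v -> ptsW v' ->
  Sph_non v M -> Sph_non v' M' -> (v = v' <-> isomorphic M M').
Proof.
move=> hv hv' /(Sph_non_models hv)[m1 [m2 hm]] /(Sph_non_models hv')[m1' [m2' hm']].
split=> [e|]; last exact: non_models_point hm hm'.
move: hv' hm'; rewrite -e => hv' hm'.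
rewrite (Prop_irrelevance hv' hv) in hm'.
exact: isomorphic_trans (isomorphic_sym (models_iso hm)) (models_iso hm').
Qed.

Theorem Sph_non_bijective :
  bij_classes (fun v : k * k => ptsW v /\ v.2 != v.1 ^+ 2)
    (fun M : lmodType H => simple M /\ has_kdim M 2)
    (@isomorphic k H) (@Sph_non F k iota lam).
Proof.
split.
- by move=> v [hv _]; exists (column_module (rep (atWm hv))); apply: Sph_non_column.
- move=> v M [hv hd] /(Sph_non_models hv)[m1 [m2 hm]]; split.
    exact: non_models_simple hm hd.
  exact: models_kbasis hm.
- by move=> v v' M M' [hv _] [hv' _] hM hM'; apply: Sph_non_eq.
- move=> M [sM dM]; have fM : finite_dimensional M by exists 2%N.
  have [c hc] := finite_dimensional_eigenvector (cz2 iota lam) fM sM.1.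
  have [d hd] := finite_dimensional_eigenvector (cz1 iota lam) fM sM.1.
  have {}hc := schur_scalar sM (@cz2_central _ _ _ _) hc.
  have {}hd := schur_scalar sM (@z1_central _ _ iota _ sl) hd.
  have [m1 m10 hS1] := non_kernel sl sM dM hd.
  have [hv [m2 [hm hcd]]] := non_models_of_kernel sl sM dM hc hd m10 hS1.
  exists (d, c), (column_module (rep (atWm hv))); split=> //.
    exact: Sph_non_column.
  exact: models_iso hm.
Qed.

Theorem Sph_non_supersingular :
  bij_classes (fun v : k * k => ptsW v /\ v.1 = 0)
    (@supersingular_non F k iota lam) (@isomorphic k H) (@Sph_non F k iota lam).
Proof.
split.
- by move=> v [hv _]; exists (column_module (rep (atWm hv))); apply: Sph_non_column.
- move=> v M [hv v0] /(Sph_non_models hv)[m1 [m2 hm]]; split.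
    by apply: non_models_simple hm _; rewrite v0 expr0n.
  by exists v.2 => //; apply: non_models_standard hm v0.
- by move=> v v' M M' [hv _] [hv' _] hM hM'; apply: Sph_non_eq.
- move=> M [sM [b b0 [m [hb hS hSU hUU]]]].
  have [hs hf] := kbasis2P hb.
  have hv : ptsW ((0, b) : k * k) by [].
  (* The generator m of the standard module plays the role of m2, and at z1 = 0 the matrices require
     U m2 = - b m1. *)
  pose m1 := (- b^-1)%:A *: (U *: m).
  have acts : forall a, acts_by (rep (atWm hv)) m1 m a.
    apply: non_acts => //=.
    - by rewrite /m1 -kscaleC hSU kscale0 scaler0.
    - rewrite /m1 -kscaleC hUU kscaleA mulNr mulVf // /comb kscale0 add0r.
      by [].
    - rewrite /m1 /comb expr0n sub0r oppr0 kscale0 addr0 kscaleA.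
      by rewrite mulrN mulNr opprK mulfV // kscale1.
  have free : kfree2 m1 m.
    move=> p q; rewrite /m1 kscaleA addrC => /hf[-> /eqP h]; split=> //; apply/eqP.
    by move: h; rewrite mulf_eq0 oppr_eq0 invr_eq0 (negPf b0) orbF.
  have hm : models (rep (atWm hv)) m1 m.
    split=> //; apply: simple_kspan2 sM _ acts.
    by case: (kfree2_neq0 free).
  exists (0, b), (column_module (rep (atWm hv))); split=> //.
    exact: Sph_non_column.
  exact: models_iso hm.
Qed.

(** The composition series is arbitrary, but its submodule is a line of common eigenvectors of S and
    U, and the line of m2 is the only one. It affords (-1, -z1), and the quotient, spanned by the
    image of m1, affords (0, z1). *)
Lemma Sph1_non_characters v p : ptsW v -> v.2 = v.1 ^+ 2 -> Sph1_non v p ->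
  exists chi chi' : {lrmorphism H -> k^o},
    [/\ p = char_pair chi chi', chi S = 0, chi U = v.1, chi' S = -1 & chi' U = - v.1].
Proof.
move=> hv hd [M [L [L' [chi [chi' [hM hJH aL aL' ->]]]]]].
have [m1 [m2 hm]] := Sph_non_models hv hM.
have [hs hf _] := hm; have [hS1 hS2 hU1 hU2] := non_models_act hm.
have [m10 m20] := kfree2_neq0 hf.
have v10 := parabola_neq0 hv hd.
have [N [f [g [finj gsurj gker hN]]]] := jordan_holder2 hJH.
have [g' [g'inj g'surj]] := jordan_holder1 hN.
have hchi' (h : H) (n : N) : h *: n = (chi' h : k)%:A *: n.
  by apply: g'inj; rewrite !linearZ /= aL'.2.
have [n fn0] : exists n : N, f n != 0.
  have [l l0] := affords_generator aL'; have [n gn] := g'surj l.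
  exists n; apply: contra l0 => /eqP fn0; rewrite -gn.
  by rewrite (_ : n = 0) ?linear0 //; apply: finj; rewrite fn0 linear0.
have hfn (h : H) : h *: f n = (chi' h : k)%:A *: f n.
  have fZ a (x : N) : a *: f x = f (a *: x) by rewrite linearZ.
  by rewrite !fZ hchi'.
have [c [d fnE]] := hs (f n); rewrite -/(comb m1 m2 c d) in fnE.
have [hc hd'] : (chi' S : k) * c = 0 /\ (chi' S : k) * d = - d.
  apply: (comb_inj hf); rewrite -combZ -fnE -hfn fnE comb_lin hS1 hS2 scaler0 add0r.
  by rewrite -comb_k2 kscaleN scalerN.
have [hcU hdU] : (chi' U : k) * c = v.1 * c /\ (chi' U : k) * d = - c - v.1 * d.
  apply: (comb_inj hf); rewrite -combZ -fnE -hfn fnE comb_lin hU1 hU2 hd !combZ combD.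
  by congr comb; ring.
(* A component along m1 makes the eigenvalue of S equal to 0, so d = 0; but U m1 = z1 m1 - m2 is not
   a multiple of m1. *)
have c0 : c = 0.
  apply/eqP; apply: contraT => c_neq0.
  have s0 : (chi' S : k) = 0 by apply: (mulIf c_neq0); rewrite hc mul0r.
  have d0 : d = 0 by apply: oppr_inj; rewrite -hd' s0 mul0r oppr0.
  by move/eqP: hdU; rewrite d0 !mulr0 subr0 eq_sym oppr_eq0 (negPf c_neq0).
have d0 : d != 0 by apply: contra fn0 => /eqP d0; rewrite fnE c0 d0 comb00.
have gm2 : g m2 = 0.
  apply/gker; exists ((d^-1)%:A *: n); rewrite linearZ /= fnE combZ c0 mulr0 mulVf //.
  exact: comb01.
have gm1 : g m1 != 0.
  have [l l0] := affords_generator aL; have [m gm] := gsurj l.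
  apply: contra l0 => /eqP gm1; rewrite -gm; have [x [y ->]] := hs m.
  by rewrite linearD !linearZ /= gm1 gm2 !scaler0 addr0.
exists chi, chi'; split=> //.
- apply: (kscale_inj gm1); rewrite -aL.2 kscale0 -[RHS](linear0 g) -hS1.
  by rewrite linearZ.
- apply: (kscale_inj gm1); rewrite -aL.2.
  have -> : U *: g m1 = g (U *: m1) by rewrite linearZ.
  by rewrite hU1 /comb linearD !linearZ /= gm2 scaler0 addr0.
- by apply: (mulIf d0); rewrite mulN1r.
- by apply: (mulIf d0); rewrite hdU c0 oppr0 sub0r mulNr.
Qed.

Lemma Sph1_non_exists v (hv : ptsW v) : v.2 = v.1 ^+ 2 ->
  exists p, @Sph1_non F k iota lam v p.
Proof.
move=> hd; have v10 := parabola_neq0 hv hd.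
have [chi [chiS chiU]] := @hecke_char F k iota lam sl 0 v.1
  ltac:(by rewrite mulr0 oppr0) v10.
have nv10 : - v.1 != 0 by rewrite oppr_eq0.
have [chi' [chi'S chi'U]] := @hecke_char F k iota lam sl (-1) (- v.1)
  ltac:(by rewrite mulrNN mulr1 opprK) nv10.
exists (char_pair chi chi'), (column_module (rep (atWm hv))), (char_module chi).
exists (char_module chi'), chi, chi'; split=> //; try exact: char_module_affords.
  exact: Sph_non_column.
(* On the parabola the upper right entry z1^2 - z2 of U vanishes, so all matrices are lower
   triangular, with the two characters on the diagonal; the second coordinate axis is the
   submodule. *)
have triang (a : H) : rep (atWm hv) a =
    mx2 (chi a) (0 : k^o) (rep (atWm hv) a 1 0) (chi' a).
  have inv (f : {lrmorphism H -> k^o}) : (f U : k) != 0 ->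
      f (cUinv iota lam) = (f U : k)^-1 :> k.
    by move=> fU; apply: (mulfI fU); rewrite mulfV // -rmorphM cUV rmorph1.
  have chiV : chi (cUinv iota lam) = v.1^-1 by rewrite inv chiU.
  have chi'V : chi' (cUinv iota lam) = - v.1^-1 by rewrite inv chi'U // invrN.
  elim/(@non_ind _ _ iota _ sl): a => [|||c|a b ha hb|a b ha hb].
  - by rewrite !non_repE !mx2E chiS chi'S.
  - by rewrite !non_repE !mx2E !atWE chiU chi'U hd subrr.
  - rewrite !non_repE !mx2E !atWE chiV chi'V hd subrr mulr0.
    by have -> : (v.1 ^+ 2)^-1 * v.1 = v.1^-1 by rewrite expr2 invfM mulfVK.
  - by rewrite !non_rep_cst !mx2E !linearZ !rmorph1.
  - by rewrite !raddfD /= {1}ha {1}hb mx2D mxalgDE addr0.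
  - have a11 : rep (atWm hv) a 1 1 = chi' a by rewrite ha mx2E.
    have b00 : rep (atWm hv) b 0 0 = chi b by rewrite hb mx2E.
    rewrite !rmorphM /= {1}ha {1}hb mx2M mxalgME a11 b00.
    by congr mx2; rewrite ?mulr0 ?mul0r ?addr0 ?add0r.
have fl : linear (fun c : char_module chi' => ((0, c) : column_module (rep (atWm hv)))).
  move=> a c d; rewrite column_moduleE /col_act triang !mx2E /=.
  by congr (_, _); rewrite /= ?mulr0 ?mul0r ?addr0 ?add0r.
have gl : linear (fun u : column_module (rep (atWm hv)) => (u.1 : char_module chi)).
  by move=> a c d; rewrite column_moduleE /col_act triang !mx2E /= mul0r addr0.
apply: (jh_cons (f := mklinear fl) (g := mklinear gl)).
- by move=> c d [].
- by move=> l; exists (l, 0).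
- move=> [c d] /=; split=> [->|[n [<- _]]//].
  by exists d.
- exact: char_module_simple.
(* Functions on the empty ordinal serve as the zero module that ends the series. *)
have zl : linear (fun _ : {ffun 'I_0 -> char_module chi'} => (0 : char_module chi')).
  by move=> a c d; rewrite scaler0 addr0.
have il : linear (fun u : char_module chi' => u) by [].
apply: (jh_cons (f := mklinear zl) (g := mklinear il)).
- by move=> c d _; apply/ffunP => -[].
- by move=> l; exists l.
- by move=> m /=; split=> [->|[n <-]//]; exists 0.
- exact: char_module_simple.
- by apply: jh_nil => m; apply/ffunP => -[].
Qed.

Theorem Sph1_non_bijective :
  bij_classes (fun v : k * k => ptsW v /\ v.2 = v.1 ^+ 2)
    (@spherical_pair F k iota lam) eq (@Sph1_non F k iota lam).
Proof.
have pair_eq (chi chi' psi psi' : {lrmorphism H -> k^o}) (u : k) :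
    chi S = 0 -> chi U = u -> chi' S = -1 -> chi' U = - u ->
    psi S = 0 -> psi U = u -> psi' S = -1 -> psi' U = - u ->
    char_pair chi chi' = char_pair psi psi'.
  move=> h1 h2 h3 h4 h5 h6 h7 h8; rewrite /char_pair.
  have -> : (chi : H -> k) = psi.
    by apply/funext/(hecke_char_eq sl); rewrite ?h1 ?h2 ?h5 ?h6.
  suff -> : (chi' : H -> k) = psi' by [].
  by apply/funext/(hecke_char_eq sl); rewrite ?h3 ?h4 ?h7 ?h8.
split.
- by move=> v [hv hd]; apply: Sph1_non_exists.
- move=> v p [hv hd] /(Sph1_non_characters hv hd)[chi [chi' [-> h1 h2 h3 h4]]].
  by exists v.1; [exact: parabola_neq0 | exists chi, chi'].
- move=> v v' p p' [hv hd] [hv' hd'].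
  move=> /(Sph1_non_characters hv hd)[chi [chi' [-> h1 h2 h3 h4]]].
  move=> /(Sph1_non_characters hv' hd')[psi [psi' [-> h5 h6 h7 h8]]].
  split=> [e|].
    by apply: (@pair_eq _ _ _ _ v.1) => //; rewrite e.
  (* The pairs are unordered: chi is psi or psi', and the value 0 at S excludes psi', whose value is
     -1. Then z1 is the common value at U and determines the point of the parabola. *)
  move=> e; have : char_pair psi psi' (chi : H -> k) by rewrite -e; left.
  have vE : v.1 = v'.1 -> v = v'.
    by move: hd hd'; case: (v) (v') => [? ?] [? ?] /= -> -> ->.
  case=> h.
    by apply: vE; rewrite -h2 -h6 h.
  have : (chi S : k) = psi' S by rewrite h.
  by rewrite h1 h7 => /eqP; rewrite eq_sym oppr_eq0 oner_eq0.
- move=> p [a a0 [psi [psi' [-> h5 h6 h7 h8]]]].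
  have hv : ptsW (a, a ^+ 2) by rewrite /ptsW /= expf_neq0.
  have [p' hp'] := @Sph1_non_exists (a, a ^+ 2) hv erefl.
  exists (a, a ^+ 2), p'; split=> //.
  have [chi [chi' [-> h1 h2 h3 h4]]] := Sph1_non_characters hv erefl hp'.
  exact: (@pair_eq _ _ _ _ a).
Qed.
End NonregularBijections.

(** * Branch locus *)

Section PrimeIdeals.
Variable R : comNzRingType.

Lemma prime_ideal_exists (Q : R -> Prop) : Q 0 -> ~ Q 1 ->
  (forall a u v, Q u -> Q v -> Q (a * u + v)) ->
  (forall u v, Q (u * v) -> Q u \/ Q v) ->
  exists P : prime_idealr R, forall a, a \in P <-> Q a.
Proof.
move=> Q0 Q1 Ql Qp; pose q : R -> bool := fun a => `[< Q a >].
have c1 : idealr_closed q.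
  split=> [||a u v]; rewrite ?unfold_in /q.
  - exact/asboolP.
  - exact/asboolPn.
  - by move=> /asboolP hu /asboolP hv; apply/asboolP/Ql.
have c2 : prime_idealr_closed q.
  move=> u v; rewrite !unfold_in /q => /asboolP/Qp[]h; apply/orP.
    by left; apply/asboolP.
  by right; apply/asboolP.
pose P : prime_idealr R := HB.pack q (isIdealr.Build R q c1)
  (isPrimeIdealrClosed.Build R q c2).
by exists P => a; rewrite unfold_in; split=> /asboolP.
Qed.

Variable P : prime_idealr R.

Lemma primeD a b : a \in P -> b \in P -> a + b \in P.
Proof. exact: rpredD. Qed.
Lemma primeB a b : a \in P -> b \in P -> a - b \in P.
Proof. exact: rpredB. Qed.
Lemma primeMl a b : b \in P -> a * b \in P.
Proof. by rewrite prime_idealrM orbC => ->. Qed.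
Lemma primeMr a b : a \in P -> a * b \in P.
Proof. by rewrite prime_idealrM => ->. Qed.

Lemma to_loc_inv a : a \notin P -> exists x : loc P, x * to_loc P a = 1.
Proof.
move=> ha; exists (frc (mkfrac 1 ha)).
apply: etrans (frcM _ _) _; apply/frcP; exists 1; first exact: mem1P.
by rewrite /=; ring.
Qed.

End PrimeIdeals.

Lemma prime_preimage (R R' : comNzRingType) (phi : {rmorphism R -> R'})
    (P : prime_idealr R') : exists Q : prime_idealr R, forall a, (a \in Q) = (phi a \in P).
Proof.
have [||a u v|u v|Q hQ] := @prime_ideal_exists R (fun a => phi a \in P).
- by rewrite rmorph0 idealr0.
- by rewrite rmorph1 idealr1.
- by move=> hu hv; rewrite rmorphD rmorphM primeD // primeMl.
- by rewrite rmorphM prime_idealrM => /orP.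
by exists Q => a; apply/idP/idP => /hQ.
Qed.

Lemma prime_zero (R : idomainType) : exists Q : prime_idealr R, forall a, (a \in Q) = (a == 0).
Proof.
have [||a u v|u v|Q hQ] := @prime_ideal_exists R (fun a => a == 0).
- exact: eqxx.
- by rewrite oner_eq0.
- by move=> /eqP-> /eqP->; rewrite mulr0 addr0.
- by rewrite mulf_eq0 => /orP.
by exists Q => a; apply/idP/idP => /hQ.
Qed.

(** * Maps between local rings *)

Section LocalMorphism.
Variables (R R' : comNzRingType) (phi : {rmorphism R -> R'}).
Variables (P : prime_idealr R) (P' : prime_idealr R').
Hypothesis PP' : forall a, (a \in P) = (phi a \in P').

Fact loc_map_den (q : frac_pre P) : phi (val q).2 \notin P'.
Proof. by rewrite -PP'; apply: denP. Qed.
Definition frac_map (q : frac_pre P) : frac_pre P' :=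
  mkfrac (phi (val q).1) (loc_map_den q).
Definition loc_map (x : loc P) : loc P' := frc (frac_map (generic_quotient.repr x)).

Lemma loc_mapE q : loc_map (frc q) = frc (frac_map q).
Proof.
have [u hu h] := repr_frc q; apply/frcP; exists (phi u); first by rewrite -PP'.
by rewrite /= -!rmorphM -rmorphB -rmorphM h rmorph0.
Qed.

Lemma loc_map_to_loc a : loc_map (to_loc P a) = to_loc P' (phi a).
Proof.
rewrite loc_mapE; apply/frcP; exists 1; first exact: mem1P.
by rewrite /= rmorph1; ring.
Qed.

Lemma loc_mapD x y : loc_map (x + y) = loc_map x + loc_map y.
Proof.
elim/loc_ind: x => p; elim/loc_ind: y => q.
have -> : frc p + frc q = frc (fadd p q) by apply: frcD.
rewrite !loc_mapE; apply: etrans (esym (frcD _ _)); apply/frcP; exists 1.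
  exact: mem1P.
by rewrite /= !(rmorphD, rmorphM) /=; ring.
Qed.
Lemma loc_mapM x y : loc_map (x * y) = loc_map x * loc_map y.
Proof.
elim/loc_ind: x => p; elim/loc_ind: y => q.
have -> : frc p * frc q = frc (fmul p q) by apply: frcM.
rewrite !loc_mapE; apply: etrans (esym (frcM _ _)); apply/frcP; exists 1.
  exact: mem1P.
by rewrite /= !rmorphM /=; ring.
Qed.
Lemma loc_map1 : loc_map 1 = 1.
Proof. by rewrite -[1]/(to_loc P 1) loc_map_to_loc rmorph1. Qed.

Definition loc_act (x : loc P) (n : loc P') : loc P' := loc_map x * n.
Fact loc_actM x y n : loc_act x (loc_act y n) = loc_act (x * y) n.
Proof. by rewrite /loc_act loc_mapM mulrA. Qed.
Fact loc_act1 : left_id 1 loc_act.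
Proof. by move=> n; rewrite /loc_act loc_map1 mul1r. Qed.
Fact loc_actDr : right_distributive loc_act +%R.
Proof. by move=> x m n; rewrite /loc_act mulrDr. Qed.
Fact loc_actDl n : {morph loc_act^~ n : x y / x + y}.
Proof. by move=> x y; rewrite /loc_act loc_mapD mulrDl. Qed.
(** The local ring at P' as a module over the one at P: the target of the derivation that detects
    ramification. *)
Definition loc_module : lmodType (loc P) :=
  acted_on (RingAction loc_actM loc_act1 loc_actDr loc_actDl).
End LocalMorphism.

(** * Derivations along X = Y = 0 *)

Section Tangent.
Variables (k : fieldType) (E : comAlgType k) (zeta zeta' : E).
Hypothesis zz : zeta * zeta' = 1.

Lemma origin_morph : exists f : {lrmorphism coordV k -> E},
  [/\ f cX = 0, f cY = 0, f (cZ k) = zeta & f (cZinv k) = zeta'].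
Proof.
have h : respects (com_rel (@relV k)) (valV 0 0 zeta zeta') by apply: valVP; rewrite ?mulr0.
by exists (evalV h); split; apply: (pres_eval_gen h).
Qed.
(** Restriction to X = Y = 0 with z2 sent to a unit zeta of an algebra E, so that generic points are
    covered as well as k-points. *)
Definition sigma0 := sval (cid origin_morph).
Lemma sigma0E : (sigma0 cX = 0) * (sigma0 cY = 0) * (sigma0 (cZ k) = zeta) *
  (sigma0 (cZinv k) = zeta').
Proof. by have [] := svalP (cid origin_morph). Qed.

(** X and Y become multiples of one element of square zero, so X Y = 0 holds for all a and b: the
    crossing of the two branches leaves three free parameters on a surface. The last matrix contains
    the derivative of 1/z2. *)
Lemma tangent_morph (a b c : E) : exists f : {lrmorphism coordV k -> mxalg E},
  [/\ f cX = mx2 0 a 0 0, f cY = mx2 0 b 0 0, f (cZ k) = mx2 zeta c 0 zeta &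
      f (cZinv k) = mx2 zeta' (- c * zeta' * zeta') 0 zeta'].
Proof.
have h : respects (com_rel (@relV k)) (valV (mx2 0 a 0 0 : mxalg E) (mx2 0 b 0 0)
    (mx2 zeta c 0 zeta) (mx2 zeta' (- c * zeta' * zeta') 0 zeta')).
  apply: com_rel_comm; last first.
    move=> _ _ [] /=; rewrite mx2M.
      by rewrite scale0r mx2_0; congr mx2; ring.
    rewrite scale1r mx2_1 !mulr0 !mul0r !addr0 add0r zz; congr mx2.
    have -> : zeta * (- c * zeta' * zeta') = - c * zeta' * (zeta * zeta') by ring.
    by rewrite zz mulr1 mulNr addNr.
  by case; case; rewrite /GRing.comm !mx2M; congr mx2; ring.
by exists (evalV h); split; apply: (pres_eval_gen h).
Qed.
(* A morphism to dual numbers, its (0, 1) entry being a derivation. *)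
Definition tangent a b c := sval (cid (tangent_morph a b c)).
Lemma tangentE a b c : (tangent a b c cX = mx2 0 a 0 0) * (tangent a b c cY = mx2 0 b 0 0) *
  (tangent a b c (cZ k) = mx2 zeta c 0 zeta) *
  (tangent a b c (cZinv k) = mx2 zeta' (- c * zeta' * zeta') 0 zeta').
Proof. by have [] := svalP (cid (tangent_morph a b c)). Qed.

Definition derivation a b c (u : coordV k) : E := tangent a b c u 0 1.

Lemma tangent_cst a b c (d : k) : tangent a b c d%:A = mx2 d%:A 0 0 d%:A.
Proof. by rewrite linearZ rmorph1 /= mx2_1 mx2Z !scaler0. Qed.

Lemma tangent_shape a b c u :
  tangent a b c u = mx2 (sigma0 u) (derivation a b c u) 0 (sigma0 u).
Proof.
rewrite /derivation; elim/coordV_ind: u => [||||d|u w hu hw|u w hu hw].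
- by rewrite tangentE !mx2E sigma0E.
- by rewrite tangentE !mx2E sigma0E.
- by rewrite tangentE !mx2E sigma0E.
- by rewrite tangentE !mx2E sigma0E.
- by rewrite tangent_cst !mx2E linearZ rmorph1.
- by rewrite !raddfD /= !mxalgDE {1}hu {1}hw mx2D addr0.
- rewrite !rmorphM /= !mxalgME.
  have -> : tangent a b c w 1 1 = sigma0 w by rewrite hw mx2E.
  have -> : tangent a b c u 0 0 = sigma0 u by rewrite hu mx2E.
  by rewrite {1}hu {1}hw mx2M; congr mx2; ring.
Qed.

Lemma derivationD a b c u w : derivation a b c (u + w) = derivation a b c u + derivation a b c w.
Proof. by rewrite /derivation raddfD mxalgDE. Qed.
Lemma derivationM a b c u w :
  derivation a b c (u * w) = sigma0 u * derivation a b c w + sigma0 w * derivation a b c u.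
Proof.
rewrite /derivation rmorphM /= mxalgME ![tangent _ _ _ _]tangent_shape !mx2E.
by rewrite /derivation; ring.
Qed.

Lemma derivation_linear a b c u : derivation a b c u =
  a * derivation 1 0 0 u + b * derivation 0 1 0 u + c * derivation 0 0 1 u.
Proof.
elim/coordV_ind: u => [||||d|u w hu hw|u w hu hw].
- by rewrite /derivation !tangentE !mx2E; ring.
- by rewrite /derivation !tangentE !mx2E; ring.
- by rewrite /derivation !tangentE !mx2E; ring.
- by rewrite /derivation !tangentE !mx2E; ring.
- by rewrite /derivation !tangent_cst !mx2E; ring.
- by rewrite !derivationD hu hw; ring.
- by rewrite !derivationM hu hw; ring.
Qed.
End Tangent.

Section BranchLocus.
Variable k : fieldType.

Fact coveringP : respects (com_rel (@relW k)) (valW (cX + cY) (cZ k) (cZinv k)).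
Proof. by apply: valWP; apply: cZV. Qed.
Lemma covm_subproof : {f : {lrmorphism coordW k -> coordV k} | f =1 @covering k}.
Proof. by exists (evalW coveringP). Qed.
Definition covm := sval covm_subproof.
Lemma covmK : covm =1 @covering k. Proof. exact: (svalP covm_subproof). Qed.
Lemma covmE : (covm cW1 = cX + cY) * (covm cW2 = cZ k) * (covm cW2inv = cZinv k).
Proof. by rewrite !covmK; do !split; apply: (pres_eval_gen coveringP). Qed.

(* Since (Y - X)^2 = z1^2, the element Y - X is a unit at P when z1 is not in P,
   and D (Y^2) = D (z1 Y) reads (Y - X) D Y = 0. *)
Lemma branch_W1 (p : prime_idealr (coordW k)) : branch_locus (@covering k) p -> cW1 \in p.
Proof.
move=> [P [hP nram]]; apply: contraT => hW1; case: nram => N D DD DM Dphi.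
have Dcov b : D (covm b) = 0 by rewrite covmK.
have hXY : cX + cY \notin P by rewrite -covmE.1.1 covmK -hP.
have hd : cY - cX \notin P.
  apply: contra hXY => h; have : (cY - cX) * (cY - cX) \in P by apply: primeMr.
  have -> : (cY - cX) * (cY - cX) = (cX + cY) * (cX + cY) - 4%:R * (cX * cY) :> coordV k.
    by ring.
  by rewrite cXY mulr0 subr0 prime_idealrM orbb.
have DY : D cY = 0.
  have [x hx] := to_loc_inv hd.
  rewrite -[LHS]scale1r -hx -scalerA (_ : _ *: D cY = 0) ?scaler0 //.
  have h : cY * cY = (cX + cY) * cY :> coordV k by rewrite mulrDl cXY add0r.
  have := congr1 D h; rewrite !DM -covmE.1.1 Dcov scaler0 addr0 covmE => e.
  have -> : to_loc P (cY - cX) = to_loc P cY + to_loc P cY - to_loc P (cX + cY).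
    rewrite -to_locD; apply/eqP; rewrite eq_sym subr_eq -to_locD; apply/eqP.
    by congr to_loc; ring.
  by rewrite scalerBl scalerDl e subrr.
have DX : D cX = 0 by have := Dcov cW1; rewrite covmE DD DY addr0.
apply: coordV_ind => // [||c|a b ha hb|a b ha hb].
- by rewrite -covmE.1.2.
- by rewrite -covmE.2.
- by have := Dcov c%:A; rewrite linearZ rmorph1.
- by rewrite DD ha hb addr0.
- by rewrite DM ha hb !scaler0 addr0.
Qed.

(* On the branch locus the derivation with values X -> -1, Y -> 1, z2 -> 0 at
   the points X = Y = 0 kills X + Y and z2. *)
Lemma W1_branch (p : prime_idealr (coordW k)) : cW1 \in p -> branch_locus (@covering k) p.
Proof.
move=> hW1; pose sg := sigma0 (@cW2V k); pose D := derivation (@cW2V k) (-1) 1 0.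
have [P hP] := prime_preimage sg p.
(* [sg] maps into the coordinate ring of the quotient. Composed with the covering it is the identity
   modulo z1, hence modulo p, so the preimage P of p under [sg] lies over p. *)
have sc b : sg (covm b) - b \in p.
  elim/coordW_ind: b => [|||c|a b ha hb|a b ha hb].
  - by rewrite covmE raddfD /= !sigma0E add0r sub0r rpredN.
  - by rewrite covmE sigma0E subrr idealr0.
  - by rewrite covmE sigma0E subrr idealr0.
  - by rewrite linearZ rmorph1 linearZ rmorph1 subrr idealr0.
  - by rewrite !raddfD addrACA primeD.
  - rewrite !rmorphM.
    have -> : sg (covm a) * sg (covm b) - a * b =
      sg (covm a) * (sg (covm b) - b) + (sg (covm a) - a) * b by ring.
    by apply: primeD; [apply: primeMl|apply: primeMr].
exists P; split.
  move=> b; rewrite -covmK hP; apply/idP/idP => h.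
    by have := primeD (sc b) h; rewrite subrK.
  by have := primeB h (sc b); rewrite subKr.
move=> /(_ (loc_module hP) (fun a => to_loc p (D a))) h.
have : to_loc p (D cY) = 0.
  apply: h.
  - by move=> a b; rewrite /D derivationD to_locD.
  - move=> a b.
    have act (c : coordV k) (n : loc p) :
      to_loc P c *: (n : loc_module hP) = to_loc p (sg c) * n.
      by rewrite -[LHS]/(loc_act _ _ _) /loc_act loc_map_to_loc.
    by rewrite !act /D derivationM to_locD !to_locM.
  - move=> b; rewrite -covmK -[RHS]/(to_loc p 0); congr to_loc.
    rewrite /D; elim/coordW_ind: b => [|||c|a b ha hb|a b ha hb].
    + by rewrite covmE derivationD /derivation !tangentE !mx2E addNr.
    + by rewrite covmE /derivation tangentE mx2E.
    + by rewrite covmE /derivation tangentE mx2E oppr0 !mul0r.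
    + by rewrite linearZ rmorph1 /= /derivation tangent_cst mx2E.
    + by rewrite raddfD derivationD ha hb addr0.
    + by rewrite rmorphM derivationM ha hb !mulr0 addr0.
rewrite /D /derivation tangentE mx2E => /eqP.
by rewrite -[to_loc p 1]/(1 : loc p) oner_eq0.
Qed.

Theorem branch_locusP (p : prime_idealr (coordW k)) :
  branch_locus (@covering k) p <-> cW1 \in p.
Proof. by split; [apply: branch_W1|apply: W1_branch]. Qed.

(** A prime containing z1 and z2 - z1^2 would contain the unit z2. *)
Theorem branch_locus_D2 (p : prime_idealr (coordW k)) :
  branch_locus (@covering k) p -> D2 p.
Proof.
move=> /branch_W1 h1 h2.
have : (cW2 - cW1 ^+ 2 + cW1 * cW1) * cW2inv \in p.
  by rewrite primeMr // primeD // primeMr.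
by rewrite expr2 subrK cW2V idealr1.
Qed.

End BranchLocus.

(** * The k-points of the loci *)

Section RationalPoints.
Variable k : fieldType.

(** The ideal of v exists as the preimage of the zero ideal of k under evaluation, so only its
    membership in C has to be computed. *)
Lemma kptsWE (C : prime_idealr (coordW k) -> Prop) (Q : k * k -> Prop) v :
  (forall P : prime_idealr (coordW k), ptsW v ->
     (forall f, (f \in P) = (atW v f == 0)) -> (C P <-> Q v)) ->
  kptsW C v <-> ptsW v /\ Q v.
Proof.
move=> h; split=> [[hv [P [CP hP]]]|[hv Qv]]; split=> //.
  exact: (h P hv hP).1.
have [P0 hP0] := prime_zero k^o; have [P hP] := prime_preimage (atWm hv) P0.
have hP' f : (f \in P) = (atW v f == 0) by rewrite -(atWmE hv) hP hP0.
by exists P; split=> //; apply/h.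
Qed.

Lemma kptsVE (C : prime_idealr (coordV k) -> Prop) (Q : k * k * k -> Prop) v :
  (forall P : prime_idealr (coordV k), ptsV v ->
     (forall f, (f \in P) = (atV v f == 0)) -> (C P <-> Q v)) ->
  kptsV C v <-> ptsV v /\ Q v.
Proof.
move=> h; split=> [[hv [P [CP hP]]]|[hv Qv]]; split=> //.
  exact: (h P hv hP).1.
have [P0 hP0] := prime_zero k^o; have [P hP] := prime_preimage (atVm hv) P0.
have hP' f : (f \in P) = (atV v f == 0) by rewrite -(atVmE hv) hP hP0.
by exists P; split=> //; apply/h.
Qed.

Lemma kptsW_D1 v : kptsW (@D1 k) v <-> ptsW v /\ v.2 = v.1 ^+ 2.
Proof.
apply: (kptsWE (Q := fun v : k * k => v.2 = v.1 ^+ 2)) => P hv hP.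
rewrite /D1 hP -(atWmE hv) raddfB /= rmorphXn /= !atWE subr_eq0.
by split=> /eqP.
Qed.

Lemma kptsW_D2 v : kptsW (@D2 k) v <-> ptsW v /\ v.2 != v.1 ^+ 2.
Proof.
apply: (kptsWE (Q := fun v : k * k => v.2 != v.1 ^+ 2)) => P hv hP.
rewrite /D2 /D1 hP -(atWmE hv) raddfB /= rmorphXn /= !atWE.
by rewrite subr_eq0; split=> [/negP|/negP].
Qed.

Lemma kptsW_branch v : kptsW (branch_locus (@covering k)) v <-> ptsW v /\ v.1 = 0.
Proof.
apply: (kptsWE (Q := fun v : k * k => v.1 = 0)) => P hv hP.
by rewrite branch_locusP hP -(atWmE hv) !atWE; split=> /eqP.
Qed.
End RationalPoints.

(** * Singular locus *)

Lemma exists_minimal (T : Type) (S : T -> Prop) (mu : T -> nat) : (exists x, S x) ->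
  exists x, S x /\ forall y, S y -> (mu x <= mu y)%N.
Proof.
move=> [x0 Sx0]; pose p n := `[< exists x, S x /\ mu x = n >].
have ex : exists n, p n by exists (mu x0); apply/asboolP; exists x0.
case: (ex_minnP ex) => n /asboolP[x [Sx mx]] hmin; exists x; split=> // y Sy.
by rewrite mx; apply: hmin; apply/asboolP; exists y.
Qed.

(** The polynomial is a constant times linear factors; the constant becomes a unit, so primality
    puts one linear factor in P. *)
Lemma prime_root (k : closedFieldType) (R : comNzRingType) (phi : {rmorphism {poly k} -> R})
    (P : prime_idealr R) (c : {poly k}) :
  c != 0 -> phi c \in P -> exists a, phi ('X - a%:P) \in P.
Proof.
have [r ->] := closed_field_poly_normal c; rewrite scaler_eq0 negb_or => /andP[c0 _].
have nP (d : k) : d != 0 -> phi d%:P \notin P.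
  move=> d0; apply/negP => h; have : phi d^-1%:P * phi d%:P \in P by apply: primeMl.
  by rewrite -rmorphM -polyCM mulVf // rmorph1 idealr1.
rewrite -mul_polyC rmorphM prime_idealrM (negPf (nP _ c0)) /=.
elim: r => [|a r ih]; first by rewrite big_nil rmorph1 idealr1.
by rewrite big_cons rmorphM prime_idealrM => /orP[h|/ih //]; exists a.
Qed.

(** * Chains of primes in the plane *)

Section PlaneChains.
Variable k : closedFieldType.
Local Notation B := {poly {poly k}}.
Implicit Types P : prime_idealr B.

(** The inner variable is x and the outer one z: this is restriction to the line x = a, a polynomial
    in z, and [lift_z] extends it back as constant in x. *)
Definition at_x (a : k) (h : B) : {poly k} := map_poly (horner_eval a) h.
Definition lift_z (q : {poly k}) : B := map_poly polyC q.
Definition x_minus (a : k) : B := ('X - a%:P)%:P.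

Lemma at_xP a h : exists q, h = lift_z (at_x a h) + x_minus a * q.
Proof.
elim/poly_ind: h => [|h c [q hq]].
  by exists 0; rewrite /at_x /lift_z !rmorph0 mulr0 addr0.
have /factor_theorem[q' hq'] : root (c - c.[a]%:P) a.
  by rewrite /root !hornerE subrr.
exists (q * 'X + q'%:P).
rewrite /at_x /lift_z !(rmorphD, rmorphM) /= !map_polyX !map_polyC /= /horner_eval.
rewrite -/(at_x a h) -/(lift_z _) {1}hq.
rewrite -[c in LHS](subrK c.[a]%:P) hq' polyCD polyCM /x_minus; ring.
Qed.

Lemma pseudo_divP (f h : B) : f != 0 -> exists m q r,
  (lead_coef f ^+ m)%:P * h = q * f + r /\ (size r < size f)%N.
Proof.
move=> f0; exists (scalp h f), (h %/ f), (h %% f).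
rewrite mul_polyC Pdiv.Idomain.divp_eq; split=> //.
by rewrite ltn_modp.
Qed.

(** The remainder of the pseudo-division by f lies in P and has smaller degree in z, so it
    vanishes. *)
Lemma prime_min_div P (f : B) : f \in P -> f != 0 ->
  (forall g, g \in P -> g != 0 -> (size f <= size g)%N) ->
  forall h, h \in P -> exists m q, (lead_coef f ^+ m)%:P * h = q * f.
Proof.
move=> fP f0 fmin h hP; have [m [q [r [e sr]]]] := pseudo_divP h f0.
exists m, q; rewrite e; have -> : r = 0; last by rewrite addr0.
apply/eqP; apply: contraTT sr => r0; rewrite -leqNgt; apply: fmin => //.
have -> : r = (lead_coef f ^+ m)%:P * h - q * f by rewrite e addrC addKr.
by rewrite primeB ?primeMl.
Qed.

Lemma lead_expC_neq0 (f : B) m : f != 0 -> (lead_coef f ^+ m)%:P != 0 :> B.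
Proof. by move=> f0; rewrite polyC_eq0 expf_neq0 // lead_coef_eq0. Qed.

(* Otherwise an element g of P2 of least degree divides those of P2 up to its
   leading coefficient, a unit modulo P2.  This applies to an element f of P1 of
   least degree and forces g, hence all of P2, into P1. *)
Lemma chain_meets_kx P1 P2 (f0 g0 : B) :
  {subset (P1 : pred B) <= (P2 : pred B)} -> f0 \in P1 -> f0 != 0 ->
  g0 \in P2 -> g0 \notin P1 ->
  exists c : {poly k}, c != 0 /\ c%:P \in P2.
Proof.
move=> sub f0P f00 g0P g0P1; apply: contrapT => none.
have nC (c : {poly k}) : c != 0 -> c%:P \notin P2.
  by move=> c0; apply/negP => cP; apply: none; exists c.
have [f [[fP fn0] fmin]] :=
  @exists_minimal _ (fun f => f \in P1 /\ f != 0) (fun f => size f)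
    (ex_intro _ f0 (conj f0P f00)).
have fP2 := sub _ fP.
have [g [[gP gn0] gmin]] :=
  @exists_minimal _ (fun f => f \in P2 /\ f != 0) (fun f => size f)
    (ex_intro _ f (conj fP2 fn0)).
have {}gmin h : h \in P2 -> h != 0 -> (size g <= size h)%N by move=> *; apply: gmin.
have lP m : (lead_coef g ^+ m)%:P \notin P2 by rewrite nC // expf_neq0 // lead_coef_eq0.
have [m [q e]] := prime_min_div gP gn0 gmin fP2.
have : q * g \in P1 by rewrite -e primeMl.
rewrite prime_idealrM => /orP[qP|gP1].
  (* With q in P1, minimality of f gives deg q >= deg f = deg q + deg g, so g would be a nonzero
     element of k[x] in P2. *)
  have q0 : q != 0.
    by apply: contra_eq_neq e => ->; rewrite mul0r mulf_neq0 ?lead_expC_neq0.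
  have := fmin q (conj qP q0).
  have : size ((lead_coef g ^+ m)%:P * f) = size f.
    by rewrite mul_polyC size_scale // expf_neq0 // lead_coef_eq0.
  rewrite e size_mul // => <-; rewrite -ltnS -(size_poly_gt0 q) in q0 *.
  move=> h; have sg : (size g <= 1)%N.
    move: h q0; move: (size q) (size g) => [|a] [|[|b]] //= h _.
    by rewrite !addnS !ltnS ltnNge leq_addr in h.
  move/size1_polyC: sg gP gn0 => ->; rewrite polyC_eq0 => cP c0.
  by move: cP; rewrite (negPf (nC _ c0)).
(* With g in P1, a power of its leading coefficient times g0 lies in P1; as g0 does not, the power
   lies in P1, hence in P2. *)
have [m' [q' e']] := prime_min_div gP gn0 gmin g0P.
have : (lead_coef g ^+ m')%:P * g0 \in P1 by rewrite e' primeMl.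
rewrite prime_idealrM (negPf g0P1) orbF => /sub.
by rewrite (negPf (lP _)).
Qed.

(* P2 contains some x - a.  If every element of P2 is a multiple of x - a, then
   dividing by x - a lowers the leading coefficient of an element of P1 without
   leaving P1. *)
Lemma chain_rational_point P1 P2 (f0 g0 : B) :
  {subset (P1 : pred B) <= (P2 : pred B)} -> f0 \in P1 -> f0 != 0 ->
  g0 \in P2 -> g0 \notin P1 ->
  exists a b, x_minus a \in P2 /\ lift_z ('X - b%:P) \in P2.
Proof.
move=> sub f0P f00 g0P g0P1.
have [c [c0 cP]] := chain_meets_kx sub f0P f00 g0P g0P1.
have [a aP] := @prime_root k B (polyC : {rmorphism {poly k} -> B}) P2 c c0 cP.
exists a.
have [[h [hP hn0]]|none] := pselect (exists h, h \in P2 /\ at_x a h != 0).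
  have [q hq] := at_xP a h.
  have : lift_z (at_x a h) \in P2.
    have -> : lift_z (at_x a h) = h - x_minus a * q by rewrite {2}hq addrK.
    by rewrite primeB // primeMr.
  move=> /(@prime_root k B (map_poly polyC : {rmorphism {poly k} -> B}) P2 _ hn0).
  by case=> b bP; exists b.
have dvd h : h \in P2 -> exists q, h = x_minus a * q.
  move=> hP; have [q hq] := at_xP a h; exists q; rewrite hq.
  have -> : at_x a h = 0.
    by apply/eqP; apply: contrapT => /negP hn; apply: none; exists h.
  by rewrite /lift_z rmorph0 add0r.
have aP1 : x_minus a \notin P1.
  by apply: contra g0P1 => aP1; have [q ->] := dvd _ g0P; apply: primeMr.
have [f [[fP fn0] fmin]] :=
  @exists_minimal _ (fun f => f \in P1 /\ f != 0) (fun f => size (lead_coef f))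
    (ex_intro _ f0 (conj f0P f00)).
have [q fq] := dvd f (sub _ fP).
have q0 : q != 0 by apply: contraNneq fn0 => q0; rewrite fq q0 mulr0.
have qP : q \in P1.
  by move: fP; rewrite fq prime_idealrM (negPf aP1).
have := fmin q (conj qP q0).
rewrite fq lead_coefM lead_coefC size_mul ?polyXsubC_eq0 ?lead_coef_eq0 //.
by rewrite size_XsubC add2n ltnn.
Qed.
End PlaneChains.

(** * Primes and generators of a local ring *)

Section LocalRing.
Variables (R : comNzRingType) (P : prime_idealr R).

Fact to_loc_zmod : zmod_morphism (to_loc P).
Proof.
move=> a b; apply/eqP; rewrite eq_sym subr_eq -to_locD; apply/eqP.
by congr to_loc; ring.
Qed.
Fact to_loc_monoid : monoid_morphism (to_loc P).
Proof. by split=> // a b; apply: to_locM. Qed.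
Definition to_locm : {rmorphism R -> loc P} :=
  HB.pack (to_loc P) (GRing.isZmodMorphism.Build _ _ _ to_loc_zmod)
   (GRing.isMonoidMorphism.Build _ _ _ to_loc_monoid).

Lemma to_locP a b : to_loc P a = to_loc P b <-> exists2 u, u \notin P & u * a = u * b.
Proof.
split=> [/frcP[u hu /=]|[u hu h]].
  by rewrite !mulr1 mulrBr => /eqP; rewrite subr_eq0 => /eqP; exists u.
by apply/frcP; exists u => //=; rewrite !mulr1 mulrBr h subrr.
Qed.

Lemma loc_num (x : loc P) : exists u a, u \notin P /\ to_loc P u * x = to_loc P a.
Proof.
elim/loc_ind: x => q; exists (val q).2, (val q).1; split; first exact: denP.
apply: etrans (frcM _ _) _; apply/frcP; exists 1; first exact: mem1P.
by rewrite /=; ring.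
Qed.

Section Extension.
Variable Q : R -> Prop.
Hypotheses (QD : forall a b, Q a -> Q b -> Q (a + b)) (QM : forall a b, Q b -> Q (a * b)).

(** The extension of the ideal Q to the local ring, phrased by a denominator u that clears x. *)
Definition loc_ext (x : loc P) : Prop :=
  exists u a, [/\ u \notin P, Q a & to_loc P u * x = to_loc P a].

Lemma loc_extD x y : loc_ext x -> loc_ext y -> loc_ext (x + y).
Proof.
move=> [u [a [hu ha eu]]] [v [b [hv hb ev]]].
exists (u * v), (v * a + u * b); split; first exact: memMP.
  by apply: QD; apply: QM.
by rewrite to_locD !to_locM -eu -ev; ring.
Qed.
Lemma loc_extM x y : loc_ext y -> loc_ext (x * y).
Proof.
move=> [u [a [hu ha eu]]]; have [v [b [hv ev]]] := loc_num x.
exists (v * u), (b * a); split; [exact: memMP|exact: QM|].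
by rewrite !to_locM -eu -ev; ring.
Qed.
Lemma loc_ext_sum (n : nat) (c x : 'I_n -> loc P) : Q 0 ->
  (forall i, loc_ext (x i)) -> loc_ext (\sum_i c i * x i).
Proof.
move=> Q0 hx; elim/big_ind: _ => [||i _]; last exact: loc_extM.
  by exists 1, 0; split; rewrite ?mem1P // mulr0.
exact: loc_extD.
Qed.
Lemma loc_ext_to_loc w : loc_ext (to_loc P w) -> exists2 u, u \notin P & Q (u * w).
Proof.
move=> [u [a [hu ha]]]; rewrite -to_locM => /to_locP[v hv e].
by exists (v * u); [exact: memMP | rewrite -mulrA e; apply: QM].
Qed.
Lemma loc_ext_of a : Q a -> loc_ext (to_loc P a).
Proof. by move=> h; exists 1, a; split; rewrite ?mem1P // mul1r. Qed.
End Extension.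

Lemma loc_nonunitP x : (~ exists y, x * y = 1) <-> loc_ext (fun a => a \in P) x.
Proof.
have [u [a [hu e]]] := loc_num x; split=> [h|[v [b [hv hb e']]] [y xy]].
  exists u, a; split=> //; apply: contrapT => /negP/to_loc_inv[y hy].
  by apply: h; exists (y * to_loc P u); rewrite mulrC -mulrA e.
have : loc_ext (fun a => a \in P) (to_loc P 1).
  have -> : to_loc P 1 = y * x by rewrite mulrC xy.
  apply: loc_extM => [c d|]; [exact: primeMl | by exists v, b].
case/loc_ext_to_loc => [c d|w hw]; first exact: primeMl.
by rewrite mulr1 (negPf hw).
Qed.

(** With [prime_pull], the correspondence between primes of the local ring and primes inside P,
    along which chains are transported. The prime is the extension of Q. *)
Lemma prime_push (Q : prime_idealr R) : {subset (Q : pred R) <= (P : pred R)} ->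
  exists c : prime_idealr (loc P), forall a, (to_loc P a \in c) = (a \in Q).
Proof.
move=> sub; pose q a := a \in Q.
have nQ u : u \notin P -> u \notin Q by apply: contra; apply: sub.
have qD a b : q a -> q b -> q (a + b) by apply: primeD.
have qM a b : q b -> q (a * b) by apply: primeMl.
have [||a u v|x y|c hc] := @prime_ideal_exists _ (loc_ext q).
- exact: (loc_ext_of (idealr0 Q)).
- move=> /(loc_ext_to_loc qM)[u hu]; rewrite /q mulr1.
  by rewrite (negPf (nQ u hu)).
- by move=> hu hv; apply: loc_extD => //; apply: loc_extM.
- have [u [a [hu ea]]] := loc_num x; have [v [b [hv eb]]] := loc_num y.
  move=> hxy; have : loc_ext q (to_loc P (a * b)).
    have -> : to_loc P (a * b) = to_loc P (u * v) * (x * y).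
      by rewrite !to_locM -ea -eb; ring.
    exact: loc_extM.
  move=> /(loc_ext_to_loc qM)[w hw]; rewrite /q !prime_idealrM (negPf (nQ w hw)) /=.
  by case/orP=> h; [left; exists u, a|right; exists v, b].
exists c => a; apply/idP/idP => [/hc/(loc_ext_to_loc qM)[u hu]|h].
  by rewrite /q prime_idealrM (negPf (nQ u hu)).
by apply/hc/loc_ext_of.
Qed.

Lemma prime_pull (c : prime_idealr (loc P)) : exists Q : prime_idealr R,
  {subset (Q : pred R) <= (P : pred R)} /\ forall a, (a \in Q) = (to_loc P a \in c).
Proof.
have [Q hQ] := prime_preimage to_locm c; exists Q; split=> // a.
rewrite hQ => h; apply: contraT => /to_loc_inv[y hy].
by have := primeMl y h; rewrite [y * _]hy idealr1.
Qed.

Lemma loc_mem_num (c : prime_idealr (loc P)) (x : loc P) u a :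
  u \notin P -> to_loc P u * x = to_loc P a -> (x \in c) = (to_loc P a \in c).
Proof.
move=> hu <-; rewrite prime_idealrM; have [y hy] := to_loc_inv hu.
suff -> : (to_loc P u \in c) = false by [].
by apply/negP => h; have := primeMl y h; rewrite hy idealr1.
Qed.

Lemma chain_pull n (c : 'I_n.+1 -> prime_idealr (loc P)) : prime_chain c ->
  exists Q : 'I_n.+1 -> prime_idealr R,
    (forall i, {subset (Q i : pred R) <= (P : pred R)}) /\ prime_chain Q.
Proof.
move=> hc; have /choice[Q hQ] := fun i => prime_pull (c i).
exists Q; split=> [i|i j /hc[s [x xj xi]]]; first by case: (hQ i).
split=> [a|]; first by rewrite (hQ i).2 (hQ j).2; apply: s.
have [u [a [hu e]]] := loc_num x.
exists a; first by rewrite (hQ j).2 -(loc_mem_num _ hu e).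
by rewrite (hQ i).2 -(loc_mem_num _ hu e).
Qed.

Lemma chain_push n (Q : 'I_n.+1 -> prime_idealr R) :
  (forall i, {subset (Q i : pred R) <= (P : pred R)}) -> prime_chain Q ->
  exists c : 'I_n.+1 -> prime_idealr (loc P), prime_chain c.
Proof.
move=> sub hQ; have /choice[c hc] := fun i => prime_push (sub i).
exists c => i j /hQ[s [a aj ai]]; split; last first.
  by exists (to_loc P a); rewrite hc.
move=> x; have [u [b [hu e]]] := loc_num x.
by rewrite !(loc_mem_num _ hu e) !hc; apply: s.
Qed.

(** P has to be generated only up to multipliers outside P, which become units; such a multiplier
    will remove the second branch. *)
Lemma regular_generators n (G : 'I_n -> R) : (forall i, G i \in P) ->
  (forall a, a \in P -> exists u r, u \notin P /\ u * a = \sum_i r i * G i) ->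
  forall x : loc P, (~ exists y, x * y = 1) <->
    exists c : 'I_n -> loc P, x = \sum_i c i * to_loc P (G i).
Proof.
move=> GP hG x; split=> [/loc_nonunitP[u [a [hu aP e]]]|[c ->]].
  have [v [r [hv er]]] := hG a aP.
  have [y hy] := to_loc_inv (memMP hv hu).
  exists (fun i => y * to_loc P (r i)).
  have -> : x = y * to_loc P (v * a).
    by rewrite to_locM -e -[LHS]mul1r -hy to_locM !mulrA.
  rewrite er -[to_loc P (\sum_i _)]/(to_locm _) rmorph_sum big_distrr.
  by apply: eq_bigr => i _; rewrite rmorphM; apply: mulrA.
apply/loc_nonunitP/loc_ext_sum => [a b|a b||i]; rewrite ?idealr0 //.
- exact: primeD.
- exact: primeMl.
by apply: loc_ext_of.
Qed.
End LocalRing.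

(** * Chains of primes in the coordinate ring of V *)

Section CoordinateChains.
Variable k : closedFieldType.
Local Notation R := (coordV k).
Local Notation B := {poly {poly k}}.
Implicit Types P : prime_idealr R.

Definition rational P : Prop := [/\ exists x : k, cX - x%:A \in P,
  exists y : k, cY - y%:A \in P & exists z : k, cZ k - z%:A \in P].

Lemma cst_prime P (c : k) : (c%:A \in P) = (c == 0).
Proof.
apply/idP/eqP => [h|->]; last by rewrite scale0r idealr0.
apply: contraTeq h => c0; apply/negP => h; have := primeMl (c^-1)%:A h.
by rewrite mulr_algl scalerA mulVf // scale1r idealr1.
Qed.

Lemma cZ_prime P : cZ k \notin P.
Proof. by apply/negP => h; have := primeMr (cZinv k) h; rewrite cZV idealr1. Qed.

Lemma rationalP P : rational P -> forall a, exists c : k, a - c%:A \in P.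
Proof.
move=> [hX hY [z hz]]; have z0 : z != 0.
  by apply: contraNneq (cZ_prime P) => z0; move: hz; rewrite z0 scale0r subr0.
apply: coordV_ind => // [||c|a b [c hc] [d hd]|a b [c hc] [d hd]].
- by exists z.
- exists z^-1.
  have -> : cZinv k - (z^-1)%:A = - ((z^-1)%:A * cZinv k) * (cZ k - z%:A).
    rewrite mulrBr !mulNr -mulrA [cZinv k * _]mulrC cZV mulr1 opprK [LHS]addrC.
    by congr (_ + _); rewrite mulr_algr mulr_algl scalerA mulfV // scale1r.
  exact: primeMl.
- by exists c; rewrite subrr idealr0.
- by exists (c + d); rewrite scalerDl opprD addrACA primeD.
- exists (c * d).
  have -> : a * b - (c * d)%:A = a * (b - d%:A) + d%:A * (a - c%:A).
    by rewrite -scalerA -[c *: d%:A]mulr_algl; ring.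
  by apply: primeD; apply: primeMl.
Qed.

Lemma rational_maximal P P' : rational P -> {subset (P : pred R) <= (P' : pred R)} ->
  {subset (P' : pred R) <= (P : pred R)}.
Proof.
move=> rP sub a aP'; have [c hc] := rationalP rP a.
have cP' : c%:A \in P' by rewrite -[c%:A](subKr a) primeB //; apply: sub.
by move: hc; rewrite cst_prime in cP'; rewrite (eqP cP') scale0r subr0.
Qed.

(* The inner variable goes to the coordinate T of a branch, the outer one to z2. *)
Definition plane_eval (T : R) : {rmorphism B -> R} :=
  horner_eval (cZ k) \o map_poly (horner_alg T).

Lemma plane_evalZ T : plane_eval T 'X = cZ k.
Proof. by rewrite /= map_polyX /horner_eval hornerX. Qed.
Lemma plane_evalC T c : plane_eval T c%:P = horner_alg T c.
Proof. by rewrite /= map_polyC /horner_eval hornerC. Qed.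
Lemma plane_eval_x T a : plane_eval T (x_minus a) = T - a%:A.
Proof. by rewrite /x_minus plane_evalC raddfB /= horner_algX horner_algC. Qed.
Lemma plane_eval_z T b : plane_eval T (lift_z ('X - b%:P)) = cZ k - b%:A.
Proof.
have -> : lift_z ('X - b%:P) = 'X - b%:P%:P.
  by rewrite /lift_z raddfB /= map_polyX map_polyC.
by rewrite rmorphB plane_evalZ plane_evalC horner_algC.
Qed.

(** A power of z2 absorbs its inverse, so modulo I every element is brought into the subring G. It
    serves to restrict to a branch, with I = (T'), and to compute residue maps at X = Y = 0. *)
Lemma coord_decomposition (G I : R -> Prop) :
  (forall c : k, G c%:A) -> G (cZ k) ->
  (forall a b, G a -> G b -> G (a + b)) -> (forall a b, G a -> G b -> G (a * b)) ->
  I 0 -> (forall a b, I a -> I b -> I (a + b)) -> (forall a b, I b -> I (a * b)) ->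
  (exists2 g, G g & I (cX - g)) -> (exists2 g, G g & I (cY - g)) ->
  forall u, exists N g, G g /\ I (u * cZ k ^+ N - g).
Proof.
move=> Gc GZ GD GM I0 ID IM hX hY.
have G1 : G 1 by rewrite -[1]scale1r; apply: Gc.
have GX N : G (cZ k ^+ N) by elim: N => [|N ih] //; rewrite exprS; apply: GM.
apply: coordV_ind => [||||c|a b [N [g [hg hI]]] [M [h [hh hJ]]]|
                            a b [N [g [hg hI]]] [M [h [hh hJ]]]].
- by have [g hg hI] := hX; exists 0%N, g; rewrite expr0 mulr1.
- by have [g hg hI] := hY; exists 0%N, g; rewrite expr0 mulr1.
- by exists 0%N, (cZ k); rewrite expr0 mulr1 subrr.
- by exists 1%N, 1; rewrite expr1 mulrC cZV subrr.
- by exists 0%N, c%:A; rewrite expr0 mulr1 subrr.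
- exists (N + M)%N, (g * cZ k ^+ M + h * cZ k ^+ N); split.
    by apply: GD; apply: GM.
  have -> : (a + b) * cZ k ^+ (N + M) - (g * cZ k ^+ M + h * cZ k ^+ N) =
    cZ k ^+ M * (a * cZ k ^+ N - g) + cZ k ^+ N * (b * cZ k ^+ M - h).
    by rewrite exprD; ring.
  by apply: ID; apply: IM.
- exists (N + M)%N, (g * h); split; first exact: GM.
  have -> : a * b * cZ k ^+ (N + M) - g * h =
    b * cZ k ^+ M * (a * cZ k ^+ N - g) + g * (b * cZ k ^+ M - h).
    by rewrite exprD; ring.
  by apply: ID; apply: IM.
Qed.

Section PlaneBranch.
Variables T T' : R.
Hypothesis TT' : (T = cX /\ T' = cY) \/ (T = cY /\ T' = cX).

Lemma branchTT : T * T' = 0.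
Proof. by case: TT' => -[-> ->]; rewrite 1?[cY * _]mulrC cXY. Qed.

(** The polynomial p describes u on the branch T' = 0, a plane with coordinates T and z2 where z2 is
    inverted. *)
Lemma branch_decomposition u : exists N p r, u * cZ k ^+ N = plane_eval T p + r * T'.
Proof.
have h1 : exists2 g, (exists p, g = plane_eval T p) & exists r, T - g = r * T'.
  exists T; last by exists 0; rewrite subrr mul0r.
  by exists 'X%:P; rewrite plane_evalC horner_algX.
have h2 : exists2 g, (exists p, g = plane_eval T p) & exists r, T' - g = r * T'.
  exists 0; last by exists 1; rewrite subr0 mul1r.
  by exists 0; rewrite rmorph0.
have [|||||||||N [g [[p ->] [r e]]]] := @coord_decomposition
  (fun g => exists p, g = plane_eval T p) (fun i => exists r, i = r * T') _ _ _ _ _ _ _ _ _ u.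
- by move=> c; exists c%:P%:P; rewrite plane_evalC horner_algC.
- by exists 'X; rewrite plane_evalZ.
- by move=> _ _ [p ->] [q ->]; exists (p + q); rewrite rmorphD.
- by move=> _ _ [p ->] [q ->]; exists (p * q); rewrite rmorphM.
- by exists 0; rewrite mul0r.
- by move=> _ _ [p ->] [q ->]; exists (p + q); rewrite mulrDl.
- by move=> a _ [p ->]; exists (a * p); rewrite mulrA.
- by case: TT' h1 h2 => -[-> ->].
- by case: TT' h1 h2 => -[-> ->].
by exists N, p, r; rewrite -e addrC subrK.
Qed.

Lemma branch_mem P u N p r : T' \in P -> u * cZ k ^+ N = plane_eval T p + r * T' ->
  (u \in P) = (plane_eval T p \in P).
Proof.
move=> hT' e; have hN : cZ k ^+ N \notin P.
  elim: N {e} => [|N ih]; first by rewrite expr0 idealr1.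
  by rewrite exprS prime_idealrM negb_or cZ_prime.
have -> : (u \in P) = (u * cZ k ^+ N \in P) by rewrite prime_idealrM (negPf hN) orbF.
by rewrite e; apply: rpredDr; apply: primeMl.
Qed.

Lemma branch_rational P (a b : k) : T' \in P -> T - a%:A \in P -> cZ k - b%:A \in P ->
  rational P.
Proof.
move=> h' h hz; have h'0 : T' - (0 : k)%:A \in P by rewrite scale0r subr0.
by case: TT' h h'0 => -[-> ->] h h'0; split;
  [exists a|exists 0|exists b|exists 0|exists a|exists b].
Qed.
End PlaneBranch.

(** As X Y = 0, the smallest prime contains one of X, Y, and the chain lives on one branch. Its
    preimages Q1 and Q2 in k[x][z] are distinct, and Q1 is nonzero because f is not in P0. *)
Lemma chain_rational (P0 P1 P2 : prime_idealr R) f g :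
  {subset (P0 : pred R) <= (P1 : pred R)} -> f \in P1 -> f \notin P0 ->
  {subset (P1 : pred R) <= (P2 : pred R)} -> g \in P2 -> g \notin P1 -> rational P2.
Proof.
move=> s01 f1 f0 s12 g2 g1.
have [T [T' [hTT hT']]] : exists T T' : R,
    ((T = cX /\ T' = cY) \/ (T = cY /\ T' = cX)) /\ T' \in P0.
  have : cX * cY \in P0 by rewrite cXY idealr0.
  by rewrite prime_idealrM => /orP[h|h]; [exists cY, cX|exists cX, cY]; split; auto.
have [Q1 hQ1] := prime_preimage (plane_eval T) P1.
have [Q2 hQ2] := prime_preimage (plane_eval T) P2.
have [N [p [r ef]]] := branch_decomposition hTT f.
have [M [q [s eg]]] := branch_decomposition hTT g.
have hT1 := s01 _ hT'; have hT2 := s12 _ hT1.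
have p0 : p != 0.
  by apply: contraNneq f0 => p0; rewrite (branch_mem hT' ef) p0 rmorph0 idealr0.
have [|||||a [b]] := @chain_rational_point _ Q1 Q2 p q.
- by move=> h; rewrite hQ1 hQ2; apply: s12.
- by rewrite hQ1 -(branch_mem hT1 ef).
- by [].
- by rewrite hQ2 -(branch_mem hT2 eg).
- by rewrite hQ1 -(branch_mem hT1 eg).
rewrite !hQ2 plane_eval_x plane_eval_z => -[ha hb].
exact: (branch_rational hTT hT2 ha hb).
Qed.

(** The third member of a chain is the maximal ideal of a k-point: nothing lies strictly above it,
    and P, which contains it, is rational too. *)
Lemma loc_chain_bound P m (c : 'I_m.+1 -> prime_idealr (loc P)) : prime_chain c ->
  (m <= 2)%N /\ ((2 <= m)%N -> rational P).
Proof.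
move=> /chain_pull[Q [sub hQ]].
have key : (2 <= m)%N -> rational (Q (inord 2)) /\
    {subset (Q (inord 2) : pred R) <= (P : pred R)}.
  move=> m2; split; last exact: sub.
  have [|s01 [f f1 f0]] := hQ (inord 0) (inord 1).
    by rewrite !inordK // ltnS ltnW.
  have [|s12 [g g2 g1]] := hQ (inord 1) (inord 2).
    by rewrite !inordK // ltnS ltnW.
  exact: chain_rational s01 f1 f0 s12 g2 g1.
split.
  rewrite leqNgt; apply/negP => m3; have [r2 _] := key (ltnW m3).
  have [|s23 [h h3 h2]] := hQ (inord 2) (inord 3).
    by rewrite !inordK // ltnS // ltnW.
  by move: h2; rewrite (rational_maximal r2 s23 h3).
move=> /key[[[x hx] [y hy] [z hz]] s].
by split; [exists x|exists y|exists z]; apply: s.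
Qed.
End CoordinateChains.

Section RationalFunctions.
Variable k : fieldType.

(** The function field k(x, z), in which the residue maps below take their values. *)
Definition ratfun := {fraction {poly {poly k}}}.
HB.instance Definition _ := GRing.Field.on ratfun.

Definition ratfun_scale (c : k) (f : ratfun) : ratfun := tofrac (c%:P%:P) * f.
Fact ratfun_scaleA c d f : ratfun_scale c (ratfun_scale d f) = ratfun_scale (c * d) f.
Proof. by rewrite /ratfun_scale mulrA -!rmorphM. Qed.
Fact ratfun_scale1 : left_id 1 ratfun_scale.
Proof. by move=> f; rewrite /ratfun_scale !rmorph1 mul1r. Qed.
Fact ratfun_scaleDr : right_distributive ratfun_scale +%R.
Proof. by move=> c f g; apply: mulrDr. Qed.
Fact ratfun_scaleDl f : {morph ratfun_scale^~ f : c d / c + d}.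
Proof. by move=> c d; rewrite /ratfun_scale !raddfD mulrDl. Qed.
HB.instance Definition _ := GRing.Zmodule_isLmodule.Build k ratfun
  ratfun_scaleA ratfun_scale1 ratfun_scaleDr ratfun_scaleDl.
Fact ratfun_scaleAl (c : k) (f g : ratfun) : c *: (f * g) = (c *: f) * g.
Proof. exact: mulrA. Qed.
HB.instance Definition _ := GRing.Lmodule_isLalgebra.Build k ratfun ratfun_scaleAl.
Fact ratfun_scaleAr (c : k) (f g : ratfun) : c *: (f * g) = f * (c *: g).
Proof. exact: mulrCA. Qed.
HB.instance Definition _ := GRing.Lalgebra_isAlgebra.Build k ratfun ratfun_scaleAr.

Definition rat_of (p : {poly {poly k}}) : ratfun := tofrac p.
Fact rat_of_zmod : zmod_morphism rat_of.
Proof. exact: raddfB. Qed.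
Fact rat_of_monoid : monoid_morphism rat_of.
Proof. by split; [exact: rmorph1 | exact: rmorphM]. Qed.
HB.instance Definition _ := GRing.isZmodMorphism.Build _ _ rat_of rat_of_zmod.
HB.instance Definition _ := GRing.isMonoidMorphism.Build _ _ rat_of rat_of_monoid.

Lemma rat_of_cst (c : k) : rat_of c%:P%:P = c%:A.
Proof. by rewrite -[LHS]mulr1. Qed.
Lemma rat_of_eq0 p : (rat_of p == 0) = (p == 0).
Proof. exact: tofrac_eq0. Qed.
End RationalFunctions.

Lemma biv_morph_eq (k : fieldType) (A : pzRingType) (f g : {rmorphism {poly {poly k}} -> A}) :
  f 'X = g 'X -> f ('X%:P) = g ('X%:P) -> (forall c : k, f c%:P%:P = g c%:P%:P) -> f =1 g.
Proof.
move=> hZ hX hc.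
have hC (c : {poly k}) : f c%:P = g c%:P.
  elim/poly_ind: c => [|c d ih]; first by rewrite !rmorph0.
  by rewrite !polyCD !polyCM !rmorphD !rmorphM ih hX hc.
elim/poly_ind => [|p c ih]; first by rewrite !rmorph0.
by rewrite !rmorphD !rmorphM ih hZ hC.
Qed.

(** * Regularity away from X = Y = 0 *)

Section RegularPoints.
Variable k : closedFieldType.
Local Notation R := (coordV k).
Local Notation B := {poly {poly k}}.
Local Notation E := (ratfun k).
Variables T T' : R.
Hypothesis TT' : (T = cX /\ T' = cY) \/ (T = cY /\ T' = cX).
Local Notation x := (rat_of ('X%:P : B)).
Local Notation z := (rat_of ('X : B)).

Lemma z_neq0 : z != 0.
Proof. by rewrite rat_of_eq0 polyX_eq0. Qed.

Lemma branch_morph (t : E) : exists f : {lrmorphism R -> E},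
  [/\ f T = t, f T' = 0 & f (cZ k) = z].
Proof.
have h1 : respects (com_rel (@relV k)) (valV t 0 z z^-1).
  by apply: valVP; rewrite ?mulr0 // mulfV // z_neq0.
have h2 : respects (com_rel (@relV k)) (valV 0 t z z^-1).
  by apply: valVP; rewrite ?mul0r // mulfV // z_neq0.
by case: TT' => -[-> ->]; [exists (evalV h1)|exists (evalV h2)]; split;
  first [exact: (pres_eval_gen h1) | exact: (pres_eval_gen h2)].
Qed.

(** Its kernel is the prime of the branch T' = 0, and that of [special_morph a] is the prime of the
    line T = a on this branch; they are the lower members of the chain at a k-point. *)
Definition generic_morph := sval (cid (branch_morph x)).
Definition special_morph (a : k) := sval (cid (branch_morph a%:A)).

Lemma generic_morphP : [/\ generic_morph T = x, generic_morph T' = 0 &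
  generic_morph (cZ k) = z].
Proof. exact: (svalP (cid (branch_morph x))). Qed.
Lemma special_morphP a : [/\ special_morph a T = a%:A, special_morph a T' = 0 &
  special_morph a (cZ k) = z].
Proof. exact: (svalP (cid (branch_morph a%:A))). Qed.

Lemma generic_plane p : generic_morph (plane_eval T p) = rat_of p.
Proof.
have [hT hT' hZ] := generic_morphP.
apply: (biv_morph_eq (f := generic_morph \o plane_eval T) (g := @rat_of k)) => [||c].
- by rewrite -[LHS]/(generic_morph (plane_eval T _)) plane_evalZ hZ.
- by rewrite -[LHS]/(generic_morph (plane_eval T _)) plane_evalC horner_algX hT.
- rewrite -[LHS]/(generic_morph (plane_eval T _)) plane_evalC horner_algC.
  by rewrite linearZ rmorph1; apply/esym/rat_of_cst.
Qed.

Lemma special_plane a p : special_morph a (plane_eval T p) = rat_of (lift_z (at_x a p)).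
Proof.
have [hT hT' hZ] := special_morphP a.
pose g : {rmorphism B -> E} := @rat_of k \o (map_poly polyC \o map_poly (horner_eval a)).
apply: (biv_morph_eq (f := special_morph a \o plane_eval T) (g := g)) => [||c].
- rewrite -[LHS]/(special_morph a (plane_eval T _)) plane_evalZ hZ.
  by rewrite -[RHS]/(rat_of (map_poly _ (map_poly _ _))) !map_polyX.
- rewrite -[LHS]/(special_morph a (plane_eval T _)) plane_evalC horner_algX hT.
  rewrite -[RHS]/(rat_of (map_poly _ (map_poly _ _))) !map_polyC /= /horner_eval hornerX.
  by rewrite rat_of_cst.
- rewrite -[LHS]/(special_morph a (plane_eval T _)) plane_evalC horner_algC.
  rewrite linearZ rmorph1 -[RHS]/(rat_of (map_poly _ (map_poly _ _))) !map_polyC /=.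
  by rewrite /horner_eval hornerC rat_of_cst.
Qed.

Lemma morph_num (f : {lrmorphism R -> E}) u N p r :
  f T' = 0 -> f (cZ k) = z -> u * cZ k ^+ N = plane_eval T p + r * T' ->
  (f u == 0) = (f (plane_eval T p) == 0).
Proof.
move=> h0 hz e; have zN : z ^+ N != 0 by rewrite expf_neq0 // z_neq0.
have := congr1 f e; rewrite rmorphM rmorphD rmorphXn rmorphM /= h0 hz mulr0 addr0 => <-.
by rewrite mulf_eq0 (negPf zN) orbF.
Qed.

Lemma morph_kernel (f : {lrmorphism R -> E}) :
  exists Q : prime_idealr R, forall u, (u \in Q) = (f u == 0).
Proof.
have [P0 hP0] := prime_zero E; have [Q hQ] := prime_preimage f P0.
by exists Q => u; rewrite hQ hP0.
Qed.

Variable P : prime_idealr R.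
Hypotheses (TP : T \notin P) (T'P : T' \in P).

Lemma cZX_prime (Q : prime_idealr R) N : cZ k ^+ N \notin Q.
Proof.
elim: N => [|N ih]; first by rewrite expr0 idealr1.
by rewrite exprS prime_idealrM negb_or cZ_prime.
Qed.

(* Multiplying by T removes the component along the branch T = 0. *)
Lemma branch_clear u N p r : u * cZ k ^+ N = plane_eval T p + r * T' ->
  T * cZ k ^+ N \notin P /\ T * cZ k ^+ N * u = T * plane_eval T p.
Proof.
move=> e; split; first by rewrite prime_idealrM negb_or TP cZX_prime.
rewrite -mulrA [_ * u]mulrC e mulrDr.
by rewrite [r * T']mulrC mulrA (branchTT TT') mul0r addr0.
Qed.

Definition chain3 (Q0 Q1 Q2 : prime_idealr R) n (i : 'I_n) : prime_idealr R :=
  match val i with 0%N => Q0 | 1%N => Q1 | _ => Q2 end.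

Definition strictly_below (Q Q' : prime_idealr R) : Prop :=
  {subset (Q : pred R) <= (Q' : pred R)} /\ exists2 a, a \in Q' & a \notin Q.

Lemma strictly_below_trans Q0 Q1 Q2 :
  strictly_below Q0 Q1 -> strictly_below Q1 Q2 -> strictly_below Q0 Q2.
Proof.
move=> [s01 _] [s12 [a a2 a1]]; split; first by move=> u /s01/s12.
by exists a => //; apply: contra a1; apply: s01.
Qed.

Lemma krull_dim2 Q0 Q1 : strictly_below Q0 Q1 -> strictly_below Q1 P ->
  krull_dim (loc P) 2.
Proof.
move=> h01 h12; have h02 := strictly_below_trans h01 h12.
split; last by move=> m c /loc_chain_bound[].
apply: (@chain_push _ _ 2 (@chain3 Q0 Q1 P 3)).
  move=> [[|[|[|//]]] hi] //=; rewrite /chain3 /=.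
    by case: h02.
  by case: h12.
by move=> [[|[|[|//]]] hi] [[|[|[|//]]] hj].
Qed.

Lemma krull_dim1 Q0 : strictly_below Q0 P -> ~ rational P -> krull_dim (loc P) 1.
Proof.
move=> h01 nr; split; last first.
  by move=> m c /loc_chain_bound[_ h]; rewrite leqNgt; apply/negP => /h.
apply: (@chain_push _ _ 1 (@chain3 Q0 P P 2)).
  by move=> [[|[|//]] hi] //=; rewrite /chain3 /=; case: h01.
by move=> [[|[|//]] hi] [[|[|//]] hj].
Qed.

Lemma regular_localI n (G : 'I_n -> R) : krull_dim (loc P) n -> (forall i, G i \in P) ->
  (forall a, a \in P -> exists u r, u \notin P /\ u * a = \sum_i r i * G i) ->
  regular_local (loc P).
Proof.
move=> kd GP hG; exists n; split=> //; exists (fun i => to_loc P (G i)).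
exact: regular_generators.
Qed.

Lemma generic_kernel : exists Q0 : prime_idealr R,
  forall u N p r, u * cZ k ^+ N = plane_eval T p + r * T' -> (u \in Q0) = (p == 0).
Proof.
have [_ h0 hz] := generic_morphP; have [Q0 hQ0] := morph_kernel generic_morph.
exists Q0 => u N p r e.
by rewrite hQ0 (morph_num h0 hz e) generic_plane rat_of_eq0.
Qed.

Lemma plane_decomposition p : plane_eval T p * cZ k ^+ 0 = plane_eval T p + 0 * T'.
Proof. by rewrite expr0 mulr1 mul0r addr0. Qed.

Lemma generic_below (Q0 : prime_idealr R) (p0 : B) :
  (forall u N p r, u * cZ k ^+ N = plane_eval T p + r * T' -> (u \in Q0) = (p == 0)) ->
  p0 != 0 -> plane_eval T p0 \in P -> strictly_below Q0 P.
Proof.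
move=> hQ0 p00 p0P; split; last first.
  by exists (plane_eval T p0) => //; rewrite (hQ0 _ _ _ _ (plane_decomposition p0)).
move=> u; have [N [p [r e]]] := branch_decomposition TT' u.
rewrite (hQ0 _ _ _ _ e) => /eqP p_0.
by rewrite (branch_mem T'P e) p_0 rmorph0 idealr0.
Qed.

(** P is the generic point of the branch: each of its elements is killed by some T z2^N outside P,
    so the maximal ideal of the local ring is zero and the dimension is 0. *)
Lemma regular_generic : (forall p, plane_eval T p \in P -> p = 0) ->
  regular_local (loc P).
Proof.
move=> min; have P0 u : u \in P -> exists w, w \notin P /\ w * u = 0.
  have [N [p [r e]]] := branch_decomposition TT' u.
  rewrite (branch_mem T'P e) => /min p0; have [h1 h2] := branch_clear e.
  by exists (T * cZ k ^+ N); rewrite h2 p0 rmorph0 mulr0.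
apply: (@regular_localI 0 (fun=> 0)) => [|[]//|u /P0[w [hw e]]]; last first.
  by exists w, (fun=> 0); rewrite big_ord0.
split.
  apply: (@chain_push _ _ 0 (fun=> P)); first by move=> i u.
  by move=> i j; rewrite !ord1.
move=> m c /chain_pull[Q [sub hQ]]; rewrite leqn0; apply: contraT; rewrite -lt0n => m0.
have [|s [f f1 f0]] := hQ (inord 0) (inord 1); first by rewrite !inordK // ltnS.
have [w [hw e]] := P0 f (sub _ _ f1).
have : w * f \in Q (inord 0) by rewrite e idealr0.
rewrite prime_idealrM (negPf f0) orbF => /sub.
by rewrite (negPf hw).
Qed.

Lemma plane_eval_cst b : plane_eval T (lift_z b%:P) = b%:A.
Proof. by rewrite /lift_z map_polyC plane_evalC horner_algC. Qed.

(** Branch, line T = a and point form a chain of length 2, and the parameters are T - a and z2 -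
    b. *)
Lemma regular_rational : rational P -> regular_local (loc P).
Proof.
move=> [[a1 h1] [a2 h2] [b hb]].
have [a ha] : exists a : k, T - a%:A \in P.
  by case: TT' => -[-> _]; [exists a1|exists a2].
have xa0 : x_minus a != 0 by rewrite /x_minus polyC_eq0 polyXsubC_eq0.
have [Q0 hQ0] := generic_kernel.
have [sT sT' sZ] := special_morphP a.
have [Q1 hQ1] := morph_kernel (special_morph a).
have h01 : strictly_below Q0 Q1.
  split; last first.
    exists (plane_eval T (x_minus a)).
      by rewrite hQ1 plane_eval_x raddfB /= sT linearZ rmorph1 /= subrr.
    by rewrite (hQ0 _ _ _ _ (plane_decomposition _)).
  move=> u; have [N [p [r e]]] := branch_decomposition TT' u.
  rewrite (hQ0 _ _ _ _ e) => /eqP p_0.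
  by rewrite hQ1 (morph_num sT' sZ e) p_0 !rmorph0.
have h12 : strictly_below Q1 P.
  split; last first.
    exists (cZ k - b%:A) => //.
    rewrite hQ1; have -> : special_morph a (cZ k - b%:A) = rat_of ('X - b%:P%:P).
      by rewrite !raddfB /= sZ linearZ rmorph1 rat_of_cst.
    by rewrite rat_of_eq0 polyXsubC_eq0.
  move=> u; have [N [p [r e]]] := branch_decomposition TT' u.
  rewrite hQ1 (morph_num sT' sZ e) special_plane rat_of_eq0 => /eqP p_0.
  have [q hq] := at_xP a p.
  rewrite (branch_mem T'P e) hq p_0 add0r rmorphM plane_eval_x.
  by rewrite primeMr.
pose G := pair2 (T - a%:A) (cZ k - b%:A).
apply: (@regular_localI 2 G) => [|i|u].
- exact: krull_dim2 h01 h12.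
- by rewrite /G /pair2; case: ifP.
have [N [p [r e]]] := branch_decomposition TT' u; rewrite (branch_mem T'P e) => pP.
have [q hq] := at_xP a p; pose s := at_x a p.
have /factor_theorem[q2 hq2] : root (s - s.[b]%:P) b by rewrite /root !hornerE subrr.
(* Division by T - a, then of the remainder by z2 - b; the last remainder is a constant lying in P,
   hence 0. *)
have pE : plane_eval T p = plane_eval T (lift_z q2) * (cZ k - b%:A) + (s.[b])%:A +
    (T - a%:A) * plane_eval T q.
  rewrite {1}hq -/s -[s in LHS](subrK s.[b]%:P) hq2 rmorphD [X in _ + X = _]rmorphM.
  rewrite plane_eval_x; congr (_ + _).
  rewrite /lift_z rmorphD rmorphM -!/(lift_z _) rmorphD rmorphM plane_eval_z.
  by rewrite plane_eval_cst.
have s0 : s.[b] = 0.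
  apply/eqP; rewrite -(cst_prime P).
  have -> : (s.[b])%:A = plane_eval T p - (T - a%:A) * plane_eval T q -
      plane_eval T (lift_z q2) * (cZ k - b%:A) :> R by rewrite pE; ring.
  apply: primeB; last exact: primeMl.
  by apply: primeB => //; apply: primeMr.
have [hw ew] := branch_clear e.
exists (T * cZ k ^+ N), (pair2 (T * plane_eval T q) (T * plane_eval T (lift_z q2))).
split=> //; rewrite ew pE s0 scale0r addr0 sum2E /pair2 /G /=.
by rewrite mulrDr addrC !mulrA; congr (_ + _); rewrite mulrAC.
Qed.

(** P is a curve on the branch: either a line T = a, or a curve on which no nonzero polynomial in T
    vanishes. One equation generates in each case. *)
Lemma regular_nonrational p0 : ~ rational P -> p0 != 0 -> plane_eval T p0 \in P ->
  regular_local (loc P).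
Proof.
move=> nr p00 p0P; have [Q0 hQ0] := generic_kernel.
have kd := krull_dim1 (generic_below hQ0 p00 p0P) nr.
have [[c [c0 cP]]|none] := pselect (exists c : {poly k}, c != 0 /\ horner_alg T c \in P).
  have [a ha] := prime_root (phi := (horner_alg T : {rmorphism {poly k} -> R})) c0 cP.
  rewrite raddfB /= horner_algX horner_algC in ha.
  apply: (@regular_localI 1 (fun=> T - a%:A)) => // u.
  have [N [p [r e]]] := branch_decomposition TT' u; rewrite (branch_mem T'P e) => pP.
  have [q hq] := at_xP a p.
  (* Otherwise this polynomial in z2 lies in P, so some z2 - b does, and with T - a it makes P
     rational. *)
  have s0 : at_x a p = 0.
    apply/eqP; apply: contrapT => /negP sn0; apply: nr.
    pose phi : {rmorphism {poly k} -> R} := plane_eval T \o map_poly polyC.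
    have [b hb] : exists b, phi ('X - b%:P) \in P.
      apply: (prime_root (phi := phi) sn0).
      have -> : phi (at_x a p) = plane_eval T p - (T - a%:A) * plane_eval T q.
        by rewrite {2}hq rmorphD rmorphM plane_eval_x addrK.
      by apply: primeB => //; apply: primeMr.
    apply: (branch_rational TT' T'P ha (b := b)).
    by rewrite -(plane_eval_z T).
  have [hw ew] := branch_clear e.
  exists (T * cZ k ^+ N), (fun=> T * plane_eval T q); split=> //.
  rewrite ew big_ord1 hq s0 /lift_z rmorph0 add0r rmorphM plane_eval_x.
  by rewrite mulrA mulrAC.
(* Nonzero polynomials in T are now units at P, among them the leading coefficient of an element f
   of least degree in z2; pseudo-division then makes f a generator. *)
have [P' hP'] := prime_preimage (plane_eval T) P.
have [f [[fP fn0] fmin]] :=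
  @exists_minimal _ (fun f => f \in P' /\ f != 0) (fun f => size f)
    (ex_intro _ p0 (conj (etrans (hP' p0) p0P) p00)).
have {}fmin h : h \in P' -> h != 0 -> (size f <= size h)%N by move=> *; apply: fmin.
apply: (@regular_localI 1 (fun=> plane_eval T f)) => // [_|u]; first by rewrite -hP'.
have [N [p [r e]]] := branch_decomposition TT' u; rewrite (branch_mem T'P e) -hP' => pP.
have [m [q ef]] := prime_min_div fP fn0 fmin pP.
have [hw ew] := branch_clear e.
exists (plane_eval T (lead_coef f ^+ m)%:P * (T * cZ k ^+ N)), (fun=> T * plane_eval T q).
split.
  apply: memMP => //; apply/negP => hl; apply: none.
  exists (lead_coef f ^+ m); rewrite -plane_evalC; split=> //.
  by rewrite expf_neq0 // lead_coef_eq0.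
rewrite -(mulrA _ _ u) ew big_ord1 mulrCA -rmorphM ef rmorphM.
by rewrite mulrA.
Qed.

(** The three cases are those of a local ring of dimension 2, 1 and 0. *)
Lemma regular_branch : regular_local (loc P).
Proof.
have [/regular_rational//|nr] := pselect (rational P).
have [[p0 [p00 p0P]]|none] := pselect (exists p0, p0 != 0 /\ plane_eval T p0 \in P).
  exact: regular_nonrational nr p00 p0P.
apply: regular_generic => p pP; apply/eqP; apply: contrapT => /negP p0.
by apply: none; exists p.
Qed.
End RegularPoints.

(** The matrix with rows v1, v2, v3 has rank at most 2, so its left kernel is nonzero. *)
Lemma common_annihilator (E : fieldType) (m : nat) (v1 v2 v3 : 'I_m -> E) : (m <= 2)%N ->
  exists a b c : E, ~ [/\ a = 0, b = 0 & c = 0] /\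
    forall j, a * v1 j + b * v2 j + c * v3 j = 0.
Proof.
move=> m2; pose V : 'M[E]_(3, m) :=
  \matrix_(i, j) match val i with 0%N => v1 j | 1%N => v2 j | _ => v3 j end.
have : kermx V != 0.
  rewrite -mxrank_eq0 mxrank_ker subn_eq0 -ltnNge ltnS.
  exact: leq_trans (rank_leq_col V) m2.
move=> /rowV0Pn[l /sub_kermxP lV l0].
exists (l 0 (inord 0)), (l 0 (inord 1)), (l 0 (inord 2)); split=> [[h0 h1 h2]|j].
  case/eqP: l0; apply/rowP => i; rewrite mxE -[i]inord_val.
  by case: i => -[|[|[|//]]] hi /=.
have := congr1 (fun M : 'rV_m => M 0 j) lV; rewrite !mxE !big_ord_recl big_ord0 !mxE /=.
rewrite addr0 addrA => h; rewrite -[RHS]h.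
by congr (l 0 _ * _ + l 0 _ * _ + l 0 _ * _); apply: val_inj; rewrite /= inordK.
Qed.

(** * Singularity along X = Y = 0 *)

Section SingularPoints.
Variable k : closedFieldType.
Local Notation R := (coordV k).
Local Notation E := (ratfun k).
Variable P : prime_idealr R.
Hypotheses (XP : cX \in P) (YP : cY \in P).

Section Residue.
Variables (zeta zeta' : E).
Hypothesis zz : zeta * zeta' = 1.
Hypothesis Psigma : forall u, (u \in P) = (sigma0 zz u == 0).

(** The elements killed by both the residue map and the derivation form an ideal Q. It contains the
    numerators of the generators, so its extension contains the maximal ideal. *)
Lemma derivation_vanishes n (g : 'I_n -> loc P) (t u : 'I_n -> R) (a b c : E) :
  (forall x : loc P, (~ exists y, x * y = 1) <->
     exists d : 'I_n -> loc P, x = \sum_i d i * g i) ->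
  (forall i, [/\ u i \notin P, t i \in P & to_loc P (u i) * g i = to_loc P (t i)]) ->
  (forall i, derivation zz a b c (t i) = 0) ->
  forall w, w \in P -> derivation zz a b c w = 0.
Proof.
move=> hg htu ht w wP.
pose Q v := sigma0 zz v = 0 /\ derivation zz a b c v = 0.
have QD v v' : Q v -> Q v' -> Q (v + v').
  by move=> [h1 h2] [h3 h4]; rewrite /Q raddfD derivationD /= h1 h2 h3 h4 !addr0.
have QM v v' : Q v' -> Q (v * v').
  move=> [h1 h2]; rewrite /Q rmorphM derivationM /= h1 h2 !mulr0 mul0r addr0.
  by [].
have Q0 : Q 0.
  rewrite -(mul0r (0 : R)); apply: QM; split; first exact: rmorph0.
  by rewrite /derivation rmorph0 mx2_0 mx2E.
have gQ i : loc_ext Q (g i).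
  have [hu hP e] := htu i; exists (u i), (t i); split=> //.
  by split=> //; apply/eqP; rewrite -Psigma.
have : loc_ext (fun a => a \in P) (to_loc P w) by apply: loc_ext_of.
move=> /loc_nonunitP/hg[d e].
have : loc_ext Q (to_loc P w) by rewrite e; apply: loc_ext_sum.
move=> /(loc_ext_to_loc QM)[v hv [_]]; rewrite derivationM.
(* Some v outside P brings v w into Q; the derivation of v w is then the residue of v, which is
   nonzero, times that of w. *)
have -> : sigma0 zz w = 0 by apply/eqP; rewrite -Psigma.
rewrite mul0r addr0 => /eqP; rewrite mulf_eq0 -Psigma (negPf hv) /=.
by move/eqP.
Qed.
End Residue.

(** X and Y lie both in P and in the kernel of [sigma0], and z2 is a unit on both sides, so
    comparing the two ideals on G is enough. *)
Lemma residue_kernel (zeta zeta' : E) (zz : zeta * zeta' = 1) (G : R -> Prop) :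
  (forall c : k, G c%:A) -> G (cZ k) ->
  (forall a b, G a -> G b -> G (a + b)) -> (forall a b, G a -> G b -> G (a * b)) ->
  (forall g, G g -> (g \in P) = (sigma0 zz g == 0)) ->
  forall u, (u \in P) = (sigma0 zz u == 0).
Proof.
move=> Gc GZ GD GM hG u.
have G0 : G 0 by rewrite -(scale0r 1); apply: Gc.
have [|||||N [g [Gg [h1 h2]]]] := @coord_decomposition k G
  (fun a => a \in P /\ sigma0 zz a = 0) Gc GZ GD GM _ _ _ _ _ u.
- by rewrite idealr0 rmorph0.
- by move=> a b [h1 h2] [h3 h4]; rewrite primeD // rmorphD /= h2 h4 addr0.
- by move=> a b [h1 h2]; rewrite primeMl // rmorphM /= h2 mulr0.
- by exists 0 => //; rewrite subr0 sigma0E.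
- by exists 0 => //; rewrite subr0 sigma0E.
have hZ : cZ k ^+ N \notin P by apply: cZX_prime.
have z0 : zeta != 0 by apply/eqP => z0; move/eqP: (zz); rewrite z0 mul0r eq_sym oner_eq0.
transitivity (u * cZ k ^+ N \in P); first by rewrite prime_idealrM (negPf hZ) orbF.
rewrite -[_ * _](subrK g); have -> : (u * cZ k ^+ N - g + g \in P) = (g \in P).
  exact: rpredDl.
rewrite (hG _ Gg); have -> : sigma0 zz g = sigma0 zz (u * cZ k ^+ N).
  by apply/eqP; rewrite eq_sym -subr_eq0 -raddfB; apply/eqP.
by rewrite rmorphM rmorphXn /= sigma0E mulf_eq0 expf_eq0 (negPf z0) andbF orbF.
Qed.

Lemma rational_residue b : cZ k - b%:A \in P ->
  exists (zeta zeta' : E) (zz : zeta * zeta' = 1),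
    zeta = b%:A /\ forall u, (u \in P) = (sigma0 zz u == 0).
Proof.
move=> hb; have b0 : b != 0.
  by apply: contraNneq (cZ_prime P) => b0; move: hb; rewrite b0 scale0r subr0.
have zz : b%:A * (b^-1)%:A = 1 :> E by rewrite mulr_algl scalerA mulfV // scale1r.
exists b%:A, (b^-1)%:A, zz; split=> //.
pose I a := a \in P /\ sigma0 zz a = 0.
have ID u v : I u -> I v -> I (u + v).
  by move=> [h1 h2] [h3 h4]; rewrite /I primeD // rmorphD /= h2 h4 addr0.
have IM u v : I v -> I (u * v).
  by move=> [h1 h2]; rewrite /I primeMl // rmorphM /= h2 mulr0.
have sc (c : k) : sigma0 zz c%:A = c%:A by rewrite linearZ rmorph1.
apply: (@residue_kernel _ _ _ (fun g => exists c : k, I (g - c%:A))).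
- by move=> c; exists c; rewrite subrr /I idealr0 rmorph0.
- by exists b; rewrite /I hb raddfB /= sigma0E sc subrr.
- move=> u v [c hc] [d hd]; exists (c + d).
  by rewrite scalerDl opprD addrACA; apply: ID.
- move=> u v [c hc] [d hd]; exists (c * d).
  have -> : u * v - (c * d)%:A = u * (v - d%:A) + d%:A * (u - c%:A).
    by rewrite -scalerA -[c *: d%:A]mulr_algl; ring.
  by apply: ID; apply: IM.
move=> g [c [h1 h2]].
have -> : (g \in P) = (c%:A \in P).
  by rewrite -[in LHS](subrK c%:A g); apply: rpredDl.
have -> : sigma0 zz g = c%:A.
  by apply/eqP; rewrite -subr_eq0 -sc -raddfB; apply/eqP.
rewrite cst_prime -rat_of_cst rat_of_eq0 !polyC_eq0 //.
Qed.

(** Here z2 is transcendental modulo P: a nonzero polynomial in z2 lying in P would have a root b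
    with z2 - b in P, making P rational. So z2 can be sent to a variable. *)
Lemma nonrational_residue : ~ rational P ->
  exists (zeta zeta' : E) (zz : zeta * zeta' = 1),
    forall u, (u \in P) = (sigma0 zz u == 0).
Proof.
move=> nr; have zz : rat_of ('X : {poly {poly k}}) * (rat_of 'X)^-1 = 1 :> E.
  by rewrite mulfV // z_neq0.
exists (rat_of 'X), (rat_of 'X)^-1, zz.
apply: (@residue_kernel _ _ _ (fun g => exists q, g = horner_alg (cZ k) q)).
- by move=> c; exists c%:P; rewrite horner_algC.
- by exists 'X; rewrite horner_algX.
- by move=> _ _ [p ->] [q ->]; exists (p + q); rewrite rmorphD.
- by move=> _ _ [p ->] [q ->]; exists (p * q); rewrite rmorphM.
move=> _ [q ->].
have -> : sigma0 zz (horner_alg (cZ k) q) = rat_of (lift_z q).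
  elim/poly_ind: q => [|q c ih]; first by rewrite /lift_z !rmorph0.
  rewrite /lift_z !(rmorphD, rmorphM) /= -/(lift_z q) ih horner_algX horner_algC.
  by rewrite map_polyX map_polyC /= sigma0E rat_of_cst linearZ rmorph1.
have -> : (rat_of (lift_z q) == 0) = (q == 0).
  by rewrite rat_of_eq0 -(inj_eq (map_inj_poly (@polyC_inj k) (polyC0 k)) q 0) map_poly0.
apply/idP/eqP => [hq|->]; last by rewrite rmorph0 idealr0.
apply/eqP; apply: contrapT => /negP q0; apply: nr.
have [b] := prime_root (phi := (horner_alg (cZ k) : {rmorphism {poly k} -> R})) q0 hq.
rewrite raddfB /= horner_algX horner_algC => hb.
by split; [exists 0; rewrite scale0r subr0|exists 0; rewrite scale0r subr0|exists b].
Qed.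

(* Generators of the maximal ideal in number n leave, among the three derivations
   d/dX, d/dY, d/dz2 into the residue field, a nonzero combination vanishing on
   P as soon as n <= 2.  At a nonclosed point n <= 1, and an additional equation
   discards d/dz2. *)
Lemma singular_origin : singular P.
Proof.
move=> [n [[[c hc] _] [g hg]]].
have [n2 nr] := loc_chain_bound hc.
have /choice[ut hut] : forall i, exists ut : R * R,
    [/\ ut.1 \notin P, ut.2 \in P & to_loc P ut.1 * g i = to_loc P ut.2].
  move=> i; have : ~ exists y, g i * y = 1.
    apply/hg; exists (fun j => (j == i)%:R).
    rewrite (bigD1 i) //= eqxx mul1r big1 ?addr0 // => j /negPf->.
    by rewrite mul0r.
  by move/loc_nonunitP => [u [a [h1 h2 h3]]]; exists (u, a).
have [rP|nrP] := pselect (rational P).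
  have [_ _ [b hb]] := rP.
  have [zeta [zeta' [zz [_ hs]]]] := rational_residue hb.
  have [l1 [l2 [l3 [l0 hl]]]] := common_annihilator
    (fun j => derivation zz 1 0 0 (ut j).2) (fun j => derivation zz 0 1 0 (ut j).2)
    (fun j => derivation zz 0 0 1 (ut j).2) n2.
  have van : forall w, w \in P -> derivation zz l1 l2 l3 w = 0.
    apply: (derivation_vanishes hs hg hut) => j.
    by rewrite derivation_linear hl.
  apply: l0; split.
  - by rewrite -(van _ XP) /derivation tangentE mx2E.
  - by rewrite -(van _ YP) /derivation tangentE mx2E.
  - have := van _ hb; rewrite -scaleNr derivationD /derivation tangentE tangent_cst.
    by rewrite !mx2E addr0.
have [zeta [zeta' [zz hs]]] := nonrational_residue nrP.
have n1 : (n.+1 <= 2)%N.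
  by rewrite leqNgt; apply/negP => /nr.
(* Index 0 carries the equation l3 = 0, the others the generators. The derivation d/dz2 vanishes on
   P at this point, so a multiple of it would give no contradiction. *)
pose D a b c (j : 'I_n.+1) (o : E) :=
  if unlift ord0 j is Some j' then derivation zz a b c (ut j').2 else o.
have [l1 [l2 [l3 [l0 hl]]]] := common_annihilator
    (fun j => D 1 0 0 j 0) (fun j => D 0 1 0 j 0) (fun j => D 0 0 1 j 1) n1.
have l30 : l3 = 0 by have := hl ord0; rewrite /D unlift_none !mulr0 mulr1 !add0r.
have van : forall w, w \in P -> derivation zz l1 l2 l3 w = 0.
  apply: (derivation_vanishes hs hg hut) => j.
  by have := hl (lift ord0 j); rewrite /D liftK => e; rewrite derivation_linear.
apply: l0; split=> //.
- by rewrite -(van _ XP) /derivation tangentE mx2E.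
- by rewrite -(van _ YP) /derivation tangentE mx2E.
Qed.
End SingularPoints.

Theorem singularP (k : closedFieldType) (P : prime_idealr (coordV k)) :
  singular P <-> (cX \in P /\ cY \in P).
Proof.
split=> [sing|[hX hY]]; last exact: singular_origin.
have : cX * cY \in P by rewrite cXY idealr0.
have [hX|hX] := boolP (cX \in P); have [hY|hY] := boolP (cY \in P) => //.
- by case: sing; apply: (@regular_branch _ cY cX) => //; right.
- by case: sing; apply: (@regular_branch _ cX cY) => //; left.
- by rewrite prime_idealrM (negPf hX) (negPf hY).
Qed.

Lemma kptsV_singular (k : closedFieldType) (v : k * k * k) :
  kptsV (@singular (coordV k)) v <-> ptsV v /\ (v.1.1 = 0 /\ v.1.2 = 0).
Proof.
apply: (kptsVE (Q := fun v : k * k * k => v.1.1 = 0 /\ v.1.2 = 0)) => P hv hP.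
rewrite singularP !hP -!(atVmE hv) !atVE.
by split=> -[/eqP h1 /eqP h2].
Qed.

Lemma eq_bij_classes (X Y : Type) (D D' : X -> Prop) (E : Y -> Prop)
    (eqv : Y -> Y -> Prop) (f : X -> Y -> Prop) :
  (forall x, D x <-> D' x) -> bij_classes D' E eqv f -> bij_classes D E eqv f.
Proof. by move=> h; have -> : D = D' by apply/funext => x; apply/propext. Qed.

Theorem theoremE
  (F : finFieldType) (k : closedFieldType) (iota : {rmorphism F -> k})
  (k_algebraic : forall x : k, algebraicOver iota x) :
  (forall lam : torus_char F k, swap_char lam != lam ->
    [/\ bij_classes (@ptsV k)
          (fun M : lmodType (hecke_comp iota lam) =>
             simple M /\ finite_dimensional M)
          (@isomorphic k (hecke_comp iota lam))
          (@Sph_reg F k iota lam),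
        forall P : prime_idealr (coordV k),
          singular P <-> (cX \in P /\ cY \in P)
      & bij_classes (kptsV (@singular (coordV k)))
          (@supersingular_reg F k iota lam)
          (@isomorphic k (hecke_comp iota lam))
          (@Sph_reg F k iota lam)])
  /\
  (forall lam : torus_char F k, swap_char lam = lam ->
    [/\ bij_classes (kptsW (@D2 k))
          (fun M : lmodType (hecke_comp iota lam) =>
             simple M /\ has_kdim M 2)
          (@isomorphic k (hecke_comp iota lam))
          (@Sph_non F k iota lam),
        bij_classes (kptsW (@D1 k))
          (@spherical_pair F k iota lam)
          eq
          (@Sph1_non F k iota lam),
        forall P : prime_idealr (coordW k),
          branch_locus (@covering k) P -> D2 P,
        forall P : prime_idealr (coordW k),
          branch_locus (@covering k) P <-> cW1 \in P
      & bij_classes (kptsW (branch_locus (@covering k)))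
          (@supersingular_non F k iota lam)
          (@isomorphic k (hecke_comp iota lam))
          (@Sph_non F k iota lam)]).

Proof.
split=> lam hlam; split.
- exact: Sph_reg_bijective.
- exact: singularP.
- exact: eq_bij_classes (@kptsV_singular k) (Sph_reg_supersingular iota hlam).
- exact: eq_bij_classes (@kptsW_D2 k) (Sph_non_bijective iota hlam).
- exact: eq_bij_classes (@kptsW_D1 k) (Sph1_non_bijective iota hlam).
- exact: branch_locus_D2.
- exact: branch_locusP.
- exact: eq_bij_classes (@kptsW_branch k) (Sph_non_supersingular iota hlam).
Qed.
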